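(* Let $\mu$ be a one dimensional Bernoulli measure (with distinguished index $k$) on a self-affine Sierpiński sponge which satisfies the Very Strong Separation Condition. Then for all $\alpha\in A(\tilde P)$, $$\dim_{\mathcal P}D_\mu(\alpha)=\frac{H^1(\sigma,\tilde P,\alpha)}{\log a_1}+\sum_{m=2}^d\left(\frac{1}{\log a_m}-\frac{1}{\log a_{m-1}}\right)H^m(\sigma,\tilde P,\alpha).$$
   Context: Let $a_1>a_2>\cdots>a_d\ge2$ be natural numbers, $\mathcal{D}\subseteq\prod_{q=1}^d\{0,\dots,a_q-1\}$ a digit set, $\Sigma=\mathcal{D}^{\mathbb{N}}$ with left shift $\sigma$, and $\Pi:\Sigma\to[0,1]^d\subset\mathbb{R}^d$, $\Pi((\omega_\nu)_\nu)=\left(\sum_{\nu}i_j(\nu)a_j^{-\nu}\right)_{j=1}^d$ where $\omega_\nu=(i_j(\nu))_{j=1}^d$. $\Lambda=\Pi(\Sigma)$ is the self-affine Sierpiński sponge. For $1\le m\le d$ let $\eta_m$ be the map $(i_j)_{j=1}^d\mapsto(i_j)_{j=m}^d$ on $\mathcal{D}$, $\Sigma_m=\eta_m(\mathcal{D})^{\mathbb{N}}$ with left shift $\sigma_m$, and $\chi_m:\Sigma\to\Sigma_m$, $(\omega_\nu)_\nu\mapsto(\eta_m(\omega_\nu))_\nu$. Very Strong Separation Condition: whenever $i,j\in\mathcal{D}$ are distinct and $m$ is the largest index with $i_m\ne j_m$, then $|i_m-j_m|>1$. A Bernoulli measure on $\Lambda$ is the image under $\Pi$ of the Bernoulli measure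 on $\Sigma$ given by a strictly positive probability vector $(p_i)_{i\in\mathcal{D}}$. For $t\in\eta_m(\mathcal{D})$ put $p_t=\sum_{i\in\mathcal{D}:\,\eta_m(i)=t}p_i$. Define $P_j:\Sigma\to\mathbb{R}$ by $$P_j(\omega)=-\frac{\log\left(p_{\eta_j(\omega_1)}/p_{\eta_{j+1}(\omega_1)}\right)}{\log a_j}\ (1\le j\le d-1),\qquad P_d(\omega)=-\frac{\log p_{\eta_d(\omega_1)}}{\log a_d}.$$ The Bernoulli measure is one dimensional if there is $k\in\{1,\dots,d\}$ such that $p_{\eta_q(i)}/p_{\eta_{q+1}(i)}=\#\eta_{q+1}(\mathcal{D})/\#\eta_q(\mathcal{D})$ for all $i\in\mathcal{D}$ and all $q\in\{1,\dots,d-1\}\setminus\{k\}$, and, provided $k\ne d$, $p_t=1/\#\eta_d(\mathcal{D})$ for all $t\in\eta_d(\mathcal{D})$. In that case, for each $j\ne k$, $P_j$ is equal to a constant $c_j$, and $\tilde P:=P_k+\sum_{j\ne k}c_j$. $\mathcal{M}_\sigma(\Sigma)$ is the set of $\sigma$-invariant Borel probability measures on $\Sigma$; $A(\tilde P)=\{\int\tilde P\,dm:m\in\mathcal{M}_\sigma(\Sigma)\}$; $H^j(\sigma,\tilde P,\alpha)=\sup\{h_{m\circ\chi_j^{-1}}(\sigma_j):m\in\mathcal{M}_\sigma(\Sigma),\int\tilde P\,dm=\alpha\}$, where $h$ is Kolmogorov–Sinai entropy. $D_\mu(\alpha)=\{x\in\Lambda:\lim_{r\to0}\frac{\log\mu(B(x,r))}{\log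 r}=\alpha\}$ with Euclidean balls $B(x,r)$. $\dim_{\mathcal P}$ denotes packing dimension. *)

(* Defs.v *)
From HB Require Import structures.
From mathcomp Require Import all_boot all_order all_algebra.
From mathcomp Require Import all_classical all_reals all_analysis.

Set Implicit Arguments.
Unset Strict Implicit.
Unset Printing Implicit Defensive.

Import Order.TTheory GRing.Theory Num.Theory.
Import numFieldNormedType.Exports.
Local Open Scope classical_set_scope.
Local Open Scope ring_scope.

(** * Nonempty finite alphabets *)

(* A measurableType must be pointed, hence the nonemptiness requirement (which
   the existence of a probability vector on the set would imply anyway). *)
Record neset (T : finType) := NESet {
  nesetval :> {set T};
  neset_gt0 : (0 < #|nesetval|)%N }.

Definition alphabet (T : finType) (E : neset T) : Type :=
  {x : T | x \in nesetval E}.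

Section alphabet_instances.
Variables (T : finType) (E : neset T).

HB.instance Definition _ := Finite.on (alphabet E).

Lemma alphabet_inhabited : exists x, x \in nesetval E.
Proof. by apply/card_gt0P; exact: neset_gt0. Qed.

HB.instance Definition _ := isPointed.Build (alphabet E)
  (exist _ (xchoose alphabet_inhabited) (xchooseP alphabet_inhabited)).

End alphabet_instances.

Lemma imneset_gt0 (T U : finType) (f : T -> U) (E : neset T) :
  (0 < #|f @: nesetval E|)%N.
Proof.
have [x xE] := alphabet_inhabited E.
by apply/card_gt0P; exists (f x); exact: imset_f.
Qed.

Definition imneset (T U : finType) (f : T -> U) (E : neset T) : neset U :=
  NESet (imneset_gt0 f E).

(** * Symbolic spaces *)

(* One-sided sequences over A with the Borel sigma-algebra of the product of
   the discrete topologies.  Sequences are indexed from 0: the letter at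
   position nu >= 1 is w nu.-1. *)
Definition seqspace (A : pointedType) :=
  g_sigma_algebraType (@open (prod_topology (fun _ : nat => discrete_topology A))).

Definition shift (A : pointedType) (w : seqspace A) : seqspace A :=
  fun n => w n.+1.

Definition bernoulli_seq (R : realType) (T : finType) (E : neset T)
    (p : alphabet E -> R) (nu : probability (seqspace (alphabet E)) R) : Prop :=
  forall (n : nat) (w : n.-tuple (alphabet E)),
    nu [set x | forall i : 'I_n, x i = tnth w i]
      = (\prod_(i < n) p (tnth w i))%:E.

(** * Measure-theoretic entropy *)

Section entropy.
Context (R : realType) (disp : measure_display) (X : measurableType disp).
Implicit Types (mu : set X -> \bar R) (T : X -> X).

Definition invariant_measure T mu : Prop :=
  forall B, measurable B -> pushforward mu T B = mu B.

(* A finite partition is given by the map f sending a point to the label of its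
   cell; cells may be empty, and [ln 0 = 0] makes null cells contribute 0. *)
Definition partition_entropy mu (C : finType) (f : X -> C) : R :=
  - \sum_(c : C) (fine (mu (f @^-1` [set c])) * ln (fine (mu (f @^-1` [set c])))).

(* The labelling of the join of the T^-i f for i < n. *)
Definition itinerary T (C : finType) (f : X -> C) (n : nat) (x : X) :
    {ffun 'I_n -> C} := [ffun i : 'I_n => f (iter i T x)].

Definition entropy_wrt mu T (C : finType) (f : X -> C) : R :=
  limn (fun n : nat => partition_entropy mu (itinerary T f n) / n%:R).

Definition ks_entropy mu T : \bar R :=
  ereal_sup [set h | exists (k : nat) (f : X -> 'I_k),
    (forall c, measurable (f @^-1` [set c])) /\ h = (entropy_wrt mu T f)%:E].

End entropy.

(** * Euclidean balls, local dimension and packing dimension in R^n *)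

Section euclidean.
Context (R : realType) (n : nat).
Implicit Types (x y : 'rV[R]_n) (E : set 'rV[R]_n) (s : R).

(* The library's distance on ['rV[R]_n] is that of the sup norm. *)
Definition edist x y : R := Num.sqrt (\sum_(j < n) (x ord0 j - y ord0 j) ^+ 2).

Definition eball x (r : R) : set 'rV[R]_n := [set y | edist x y <= r].

Definition borel_rV := g_sigma_algebraType (@open 'rV[R]_n).

Definition local_dim_set (L : set 'rV[R]_n) (mu : set 'rV[R]_n -> \bar R)
    (alpha : R) : set 'rV[R]_n :=
  [set x | L x /\
    (fun r : R => ln (fine (mu (eball x r))) / ln r) @ 0^'+ --> alpha].

(* An at most countable family of disjoint balls of radii at most delta, centred
   in E; the index set I may be finite or empty. *)
Definition is_packing E (delta : R)
    (I : set nat) (c : nat -> 'rV[R]_n) (r : nat -> R) : Prop :=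
  (forall i, I i -> E (c i) /\ 0 < r i <= delta) /\
  trivIset I (fun i => eball (c i) (r i)).

Definition packing_sup s (delta : R) E : \bar R :=
  ereal_sup [set v | exists I c r, is_packing E delta I c r /\
    v = (\esum_(i in I) ((2 * r i) `^ s)%:E)%E].

(* [packing_sup] is nondecreasing in delta: the infimum is the limit at 0. *)
Definition packing_premeasure s E : \bar R :=
  ereal_inf [set packing_sup s delta E | delta in [set delta : R | 0 < delta]].

Definition packing_measure s E : \bar R :=
  ereal_inf [set v | exists F : nat -> set 'rV[R]_n,
    E `<=` \bigcup_i F i /\
    v = (\sum_(0 <= i <oo) packing_premeasure s (F i))%E].

Definition packing_dim E : \bar R :=
  ereal_inf [set s%:E | s in [set s : R | 0 <= s /\ packing_measure s E = 0%E]].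

End euclidean.

(** * Self-affine sponges *)

Section sponge.
Context (d : nat) (a : 'I_d -> nat).

Definition digit : finType := {dffun forall q : 'I_d, 'I_(a q)}.

(* Coordinates are numbered from 0, so the coordinates m, ..., d of the usual
   numbering are kept by [eta m.-1]. *)
Definition tail (m : nat) : finType :=
  {dffun forall q : {q : 'I_d | (m <= q)%N}, 'I_(a (val q))}.

Definition eta (m : nat) (i : digit) : tail m :=
  [ffun q : {q : 'I_d | (m <= q)%N} => i (val q)].

Definition very_strong_separation (D : {set digit}) : Prop :=
  forall i j : digit, i \in D -> j \in D ->
  forall m : 'I_d, i m != j m ->
    (forall q : 'I_d, (m < q)%N -> i q = j q) ->
    1 < `|(i m : nat)%:Z - (j m : nat)%:Z|.

Context (D : neset digit).

Definition Sigma := seqspace (alphabet D).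

Definition Sigma_ (m : nat) := seqspace (alphabet (imneset (@eta m) D)).

Definition chi (m : nat) (w : Sigma) : Sigma_ m :=
  fun n => exist (fun t => t \in nesetval (imneset (@eta m) D))
             (eta m (sval (w n))) (imset_f (@eta m) (svalP (w n))).

Section real.
Context (R : realType).

Definition coding (w : Sigma) : 'rV[R]_d :=
  \row_j limn (fun N : nat =>
    \sum_(0 <= n < N) (sval (w n) j : nat)%:R / (a j)%:R ^+ n.+1 : R).

Definition sponge : set 'rV[R]_d := range coding.

Definition probability_vector (p : alphabet D -> R) : Prop :=
  (forall i, 0 < p i) /\ \sum_i p i = 1.

Definition bernoulli_image (nu : probability Sigma R) : set 'rV[R]_d -> \bar R :=
  pushforward nu (coding : Sigma -> borel_rV R d).

Definition marg (p : alphabet D -> R) (m : nat) (t : tail m) : R :=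
  \sum_(i : alphabet D | eta m (sval i) == t) p i.

Definition P_ (p : alphabet D -> R) (j : 'I_d) (w : Sigma) : R :=
  if (j.+1 < d)%N then
    - ln (marg p (eta j (sval (w 0%N))) / marg p (eta j.+1 (sval (w 0%N))))
      / ln (a j)%:R
  else - ln (marg p (eta j (sval (w 0%N)))) / ln (a j)%:R.

Definition neta (m : nat) : nat := #|@eta m @: nesetval D|.

Definition one_dimensional (p : alphabet D -> R) (k : 'I_d) : Prop :=
  (forall (i : alphabet D) (q : 'I_d), (q.+1 < d)%N -> q != k ->
     marg p (eta q (sval i)) / marg p (eta q.+1 (sval i))
       = (neta q.+1)%:R / (neta q)%:R) /\
  (k.+1 != d ->
     forall t : tail d.-1, t \in @eta d.-1 @: nesetval D ->
       marg p t = (neta d.-1)%:R^-1).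

(* The value of a constant function, and 0 for a nonconstant one. *)
Definition constant_value (X : Type) (f : X -> R) : R :=
  xget 0 [set c | forall x, f x = c].

Definition Ptilde (p : alphabet D -> R) (k : 'I_d) (w : Sigma) : R :=
  P_ p k w + \sum_(j < d | j != k) constant_value (P_ p j).

Definition averages (f : Sigma -> R) : set R :=
  [set alpha | exists m : probability Sigma R,
    invariant_measure (@shift _) m /\
    (\int[m]_w (f w)%:E)%E = alpha%:E].

(* The index j - 1 of [H_] corresponds to the exponent j of H^j. *)
Definition H_ (j : nat) (f : Sigma -> R) (alpha : R) : \bar R :=
  ereal_sup [set h | exists m : probability Sigma R,
    [/\ invariant_measure (@shift _) m,
        (\int[m]_w (f w)%:E)%E = alpha%:E &
        h = ks_entropy (pushforward m (@chi j)) (@shift _)]].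

End real.
End sponge.

Arguments coding {d a} D R w.
Arguments sponge {d a} D R _.

(* Main.v *)
Require Import Defs.
From HB Require Import structures.
From mathcomp Require Import all_boot all_order all_algebra.
From mathcomp Require Import all_classical all_reals all_analysis.
From mathcomp Require Import ring lra zify.

Set Implicit Arguments.
Unset Strict Implicit.
Unset Printing Implicit Defensive.

Import Order.TTheory GRing.Theory Num.Theory.
Import numFieldNormedType.Exports.
Local Open Scope classical_set_scope.
Local Open Scope ring_scope.

(** Why the dimension formula holds.

    The natural neighbourhoods of a point of the sponge are its approximate
    squares: the square of scale [rho] of the point coded by [w] gathers the
    codes that agree with [w], in each direction [q], up to the position [scale
    a rho q], about [rho / ln (a q)], so that all its sides are about [exp (-
    rho)] ([same_square]).  The scales increase with [q]; hence the positions
    split into consecutive ranges, the [m]-th of which prescribes exactly the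
    coordinates of index at least [m] and has length about [rho * ((ln (a m))^-1
    - (ln (a m.-1))^-1)].  The weights of the formula are these lengths.

    Local dimensions are Birkhoff averages.  When two codes lie in different
    squares, the separation condition applies to the last coordinate that
    differs at the first position of disagreement, and a gap of two digits
    cannot be bridged by later digits ([coding_far]).  Balls are thus squeezed
    between squares of comparable sizes ([ball_mass]).  The logarithmic mass of
    a square is a sum over the directions, and for a one dimensional measure all
    of them but the [k]-th contribute constant multiples of [rho]: up to a
    bounded error it is a multiple of a single Birkhoff sum of [Ptilde]
    ([mass_birkhoff]).  Therefore the level set consists of the points with a
    code along which the averages of [Ptilde] tend to [alpha]
    ([birkhoff_of_local_dim], [local_dim_of_birkhoff]).

    Entropies.  [Ptilde] depends on the first letter only.  The entropy of an
    invariant measure is at most that of its law of one letter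
    ([ks_entropy_le]), and a Bernoulli measure, whose projections are again
    Bernoulli, attains this bound.  So [H_ m] is the maximum, over the letter
    laws of mean [alpha], of the entropy of the projection to the coordinates of
    index at least [m] ([H_max_entropy]).

    Upper bound.  Consider codes in distinct squares of scale [rho] whose
    averages are close to [alpha] from a fixed time on.  Their words over each
    range of positions have averages close to [alpha], so that the mean letter
    frequencies of the family over the range have a projected entropy at most
    about [H m].  Gibbs' inequality between the uniform law on the family and
    the product of these frequencies bounds its cardinal by the exponential of
    [rho] times nearly the right-hand side ([card_squares_le]).  The centres of
    a packing by balls of radius about [exp (- rho)] form such a family, which
    bounds the packing premeasure of each of the countably many sets of points
    with a given rate of convergence ([packing_dim_ub]).

    Lower bound.  Cut time into blocks of lengths 0, 1, 2 and so on, and call a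
    code balanced when the sum of [Ptilde - alpha] over each block is bounded by
    a constant.  The averages along balanced codes tend to [alpha], and the
    words of different blocks can be chosen independently.  A long block of
    length [j] can receive about [exp (j * H m)] words with distinct
    projections, for every [m]: the rearrangements of a word whose letter
    frequencies are nearly optimal for [m] ([block_words]).  Filling each block
    with words adapted to the range where it lies, one finds in every cylinder,
    at every small scale, as many balanced codes in distinct squares as the
    formula predicts ([separated_balanced]).  The optimal laws for different [m]
    need not be related, since the families at different scales need not be
    compatible.  The balanced codes form a closed set: by Baire's theorem, in
    any countable cover of the level set some member is dense in a cylinder of
    this set, inherits these families and so has positive packing premeasure
    ([packing_dim_lb]). *)

(** * Entropy of finite probability vectors *)

Section finite_entropy.
Context (R : realType).
Implicit Types (C B : finType).

Definition shannon C (q : C -> R) : R := - \sum_c q c * ln (q c).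

Definition stochastic C (q : C -> R) : Prop :=
  (forall c, 0 <= q c) /\ \sum_c q c = 1.

Definition image_law C B (f : C -> B) (q : C -> R) (b : B) : R :=
  \sum_(c | f c == b) q c.

Definition mean C (v q : C -> R) : R := \sum_c q c * v c.

Lemma sum_image_law C B (f : C -> B) (q : C -> R) (g : B -> R) :
  \sum_b image_law f q b * g b = \sum_c q c * g (f c).
Proof.
rewrite (partition_big f xpredT)//=; apply: eq_bigr => b _.
rewrite /image_law mulr_suml; apply: eq_bigr => c /eqP <- //.
Qed.

Lemma stochastic_image_law C B (f : C -> B) (q : C -> R) :
  stochastic q -> stochastic (image_law f q).
Proof.
move=> [q0 q1]; split=> [b|]; first exact: sumr_ge0.
by have := sum_image_law f q (fun=> 1); under eq_bigr do rewrite mulr1;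
  move=> ->; under eq_bigr do rewrite mulr1.
Qed.

Lemma image_law_comp C B B' (f : C -> B) (g : B -> B') (q : C -> R) (b' : B') :
  image_law g (image_law f q) b' = image_law (g \o f) q b'.
Proof.
rewrite /image_law [RHS](partition_big f (fun b => g b == b'))//=.
apply: eq_bigr => b /eqP gb; apply: eq_bigl => c.
by have [->|] := eqVneq (f c) b; rewrite ?gb ?eqxx ?andbF.
Qed.

Lemma stochastic_le1 C (q : C -> R) c : stochastic q -> q c <= 1.
Proof. by move=> [q0 <-]; rewrite (bigD1 c)//= lerDl sumr_ge0. Qed.

Lemma ln_le_subr1 (x : R) : 0 < x -> ln x <= x - 1.
Proof. by move=> x0; rewrite -[X in ln X](subrKC 1) le_ln1Dx// ltrBrDl subrr. Qed.

Lemma ln_prod (I : finType) (P : pred I) (F : I -> R) :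
  (forall i, P i -> 0 < F i) -> ln (\prod_(i | P i) F i) = \sum_(i | P i) ln (F i).
Proof.
move=> F0; apply: (@proj2 (0 < \prod_(i | P i) F i)).
elim/big_rec2: _ => [|i y x Pi [x0 <-]]; first by rewrite ln1.
by rewrite mulr_gt0 ?F0// lnM ?posrE ?F0.
Qed.

(** Gibbs' inequality: relative entropy is nonnegative, because
    [ln x <= x - 1]. *)
Lemma gibbs C (p q : C -> R) : stochastic p -> (forall c, 0 <= q c) ->
  \sum_c q c <= 1 -> (forall c, 0 < p c -> 0 < q c) ->
  shannon p <= - \sum_c p c * ln (q c).
Proof.
move=> [p0 p1] q0 q1 pq; rewrite lerNl opprK -subr_ge0 -sumrB.
apply: (@le_trans _ _ (\sum_c (p c - q c))).
  by rewrite sumrB p1 subr_ge0.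
apply: ler_sum => c _; have := p0 c; rewrite le_eqVlt => /orP[/eqP pc|pc].
  by rewrite -pc !mul0r subrr sub0r oppr_le0.
have qc := pq _ pc.
have := ler_wpM2l (ltW pc) (ln_le_subr1 (divr_gt0 qc pc)).
rewrite ln_div ?posrE// !mulrBr mulrCA divff ?gt_eqF// !mulr1; lra.
Qed.

Lemma shannon_ge0 C (q : C -> R) : stochastic q -> 0 <= shannon q.
Proof.
move=> sq; rewrite oppr_ge0 sumr_le0// => c _.
by rewrite mulr_ge0_le0 ?(proj1 sq)// ln_le0// stochastic_le1.
Qed.

(** Each atom of the image has at least the mass of the atoms above it. *)
Lemma shannon_image_law C B (f : C -> B) (q : C -> R) : stochastic q ->
  shannon (image_law f q) <= shannon q.
Proof.
move=> [q0 q1]; rewrite lerN2 sum_image_law; apply: ler_sum => c _.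
have := q0 c; rewrite le_eqVlt => /orP[/eqP<-|qc]; first by rewrite !mul0r.
have qf : q c <= image_law f q (f c).
  by rewrite /image_law (bigD1 c)//= lerDl sumr_ge0.
by rewrite ler_wpM2l ?q0// ler_ln ?posrE// (lt_le_trans qc).
Qed.

Lemma shannon_le_lncard C (q : C -> R) : stochastic q ->
  shannon q <= ln #|C|%:R.
Proof.
move=> sq; have [q0 q1] := sq.
have C0 : (0 < #|C|)%N.
  rewrite lt0n; apply/eqP => /card0_eq C0; move: q1.
  by rewrite big_pred0// => /eqP; rewrite eq_sym oner_eq0.
have C0R : 0 < #|C|%:R :> R by rewrite ltr0n.
apply: le_trans (@gibbs _ q (fun=> #|C|%:R^-1) _ _ _ _) _ => //.
- by rewrite sumr_const -[_ *+ _]mulr_natl divff// gt_eqF.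
- by move=> *; rewrite invr_gt0.
- by rewrite -mulr_suml q1 mul1r lnV ?posrE// opprK.
Qed.

Lemma xlnx_bound (x : R) : 0 <= x <= 1 -> `|x * ln x| <= 2 * Num.sqrt x.
Proof.
move=> /andP[]; rewrite le_eqVlt => /orP[/eqP <- _|x0 x1].
  by rewrite mul0r normr0 mulr_ge0// sqrtr_ge0.
have s0 : 0 < Num.sqrt x by rewrite sqrtr_gt0.
rewrite ler0_norm ?mulr_ge0_le0 ?ln_le0// ?(ltW x0)//.
have xE : x = Num.sqrt x ^+ 2 by rewrite sqr_sqrtr// ltW.
have sV : 0 < (Num.sqrt x)^-1 by rewrite invr_gt0.
have := ln_le_subr1 sV; rewrite lnV ?posrE// => h.
have sVs : Num.sqrt x * (Num.sqrt x)^-1 = 1 by rewrite divff// gt_eqF.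
have lnE : ln x = ln (Num.sqrt x) *+ 2 by rewrite {1}xE lnXn.
have -> : x * ln x = Num.sqrt x ^+ 2 * (ln (Num.sqrt x) *+ 2) by rewrite -xE lnE.
set s := Num.sqrt x in s0 h sV sVs *; set l := ln s in h *; set t := s^-1 in h sV sVs.
have : s ^+ 2 * - l <= s ^+ 2 * (t - 1) by rewrite ler_wpM2l// sqr_ge0.
rewrite mulrBr expr2 -[s * s * t]mulrA sVs mulr1 => h2.
have := mulr_gt0 s0 s0; rewrite -mulr_natr; lra.
Qed.

Lemma continuous_xlnx : continuous (fun x : R => x * ln x).
Proof.
move=> x; have [x0|x0|->] := ltgtP x 0.
- apply: (@cvg_near_cst _ _ (x * ln x)).
  near=> y; rewrite !ln0 ?mulr0// ?ltW//.
  by near: y; exact: lt_nbhsl.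
- by apply: cvgM; [exact: cvg_id | exact: continuous_ln].
- change (y * ln y @[y --> (0 : R)] --> (0 : R) * ln 0).
  rewrite mul0r; apply/cvgr0Pnorm_lt => e e0.
  have e2 : 0 < e / 3 by rewrite divr_gt0.
  near=> y.
  have [y0|y0] := leP y 0; first by rewrite ln0// mulr0 normr0.
  have y1 : y < 1 by near: y; exact: lt_nbhsl.
  have ye : y < (e / 3) ^+ 2 by near: y; apply: lt_nbhsl; rewrite exprn_gt0.
  apply: le_lt_trans (xlnx_bound _) _; first by rewrite !ltW.
  have : Num.sqrt y < e / 3.
    by rewrite -[e / 3]ger0_norm ?ltW// -sqrtr_sqr ltr_sqrt// exprn_gt0.
  lra.
Unshelve. all: by end_near.
Qed.

Lemma cvg_fin_sum (T : Type) (F : set_system T) {FF : Filter F} (I : finType)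
    (P : pred I) (g : I -> T -> R) (l : I -> R) :
  (forall i, P i -> g i x @[x --> F] --> l i) ->
  \sum_(i | P i) g i x @[x --> F] --> \sum_(i | P i) l i.
Proof. by move=> gl; apply: (cvg_big add_continuous). Qed.

Lemma continuous_fin_sum (T : topologicalType) (I : finType) (P : pred I)
    (g : I -> T -> R) : (forall i, continuous (g i)) ->
  continuous (fun x => \sum_(i | P i) g i x).
Proof. by move=> gc x; apply: cvg_fin_sum => i _; exact: gc. Qed.

End finite_entropy.

(** * Type classes *)

Definition type_class (T : finType) (n : nat) (c : T -> nat) : {set n.-tuple T} :=
  [set w : n.-tuple T | [forall t, count_mem t w == c t]].

Lemma type_classP (T : finType) (n : nat) (c : T -> nat) (w : n.-tuple T) :
  reflect (forall t, count_mem t w = c t) (w \in type_class n c).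
Proof.
rewrite inE; apply: (iffP forallP) => h t; first exact/eqP.
by rewrite h.
Qed.

(** The multinomial coefficient, by recursion on the first letter. *)
Lemma card_type_class (T : finType) (n : nat) (c : T -> nat) :
  (\sum_t c t)%N = n -> (#|type_class n c| * \prod_t (c t)`! = n`!)%N.
Proof.
elim: n c => [|n IHn] c sc.
  have c0 t : c t = 0%N.
    by apply/eqP; rewrite -leqn0 -sc (bigD1 t)//= leq_addr.
  rewrite (_ : type_class 0 c = [set [tuple]]%SET).
    by rewrite cards1 mul1n big1// => t _; rewrite c0.
  apply/setP => w; apply/type_classP/set1P => [_|-> t].
    by rewrite tuple0.
  by rewrite c0.
have fibre t : (#|[set w in type_class n.+1 c | thead w == t]%SET| *
    \prod_s (c s)`! = c t * n`!)%N.
  have [ct0|ct0] := posnP (c t).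
    rewrite ct0 mul0n; apply/eqP; rewrite muln_eq0; apply/orP; left.
    rewrite cards_eq0; apply/eqP/setP => w; rewrite !inE.
    apply/negP => /andP[/forallP/(_ t)/eqP + /eqP].
    by rewrite ct0; case/tupleP: w => x w; rewrite theadE => + /= xt;
      rewrite /= xt eqxx.
  pose c' s := (c s - (s == t))%N.
  have c'E s : c s = (c' s + (s == t))%N.
    by rewrite /c' subnK//; case: eqP => // ->.
  have sc' : (\sum_s c' s)%N = n.
    move: sc; under eq_bigr do rewrite c'E.
    rewrite big_split/= (bigD1 t)//= (bigD1 t (P := xpredT)) //= eqxx.
    by rewrite [X in (_ + (_ + X))%N]big1 => [|i /negbTE->//]; lia.
  rewrite (_ : [set w in _ | _]%SET =
      [set [tuple of t :: w] | w : n.-tuple T in type_class n c']%SET); last first.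
    apply/setP => w; apply/idP/imsetP => [|[w' /type_classP w'c ->]].
      rewrite inE => /andP[/type_classP wc /eqP wt].
      case/tupleP: w wc wt => x w; rewrite theadE => /= wc xt.
      exists w; last by apply/val_inj; rewrite /= xt.
      by apply/type_classP => s; rewrite /c' -wc/= xt eq_sym addKn.
    rewrite inE theadE eqxx andbT; apply/type_classP => s /=.
    by rewrite w'c c'E eq_sym addnC.
  rewrite card_imset; last by move=> w w' /(congr1 val)[] /val_inj.
  rewrite -(IHn _ sc') (bigD1 t)//= [in RHS](bigD1 t)//=.
  rewrite c'E eqxx addn1 factS.
  rewrite (eq_bigr (fun i => (c' i)`!)); last first.
    by move=> i /negbTE it; rewrite c'E it addn0.
  by rewrite !mulnA; congr (_ * _)%N; rewrite mulnAC mulnC mulnA.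
rewrite -sum1_card (partition_big (@thead n T) xpredT)//= big_distrl/=.
under eq_bigr => t _.
  rewrite (_ : (\sum_(_ in _ | _) 1)%N =
    #|[set w in type_class n.+1 c | thead w == t]%SET|); last first.
    by rewrite -sum1_card; apply: eq_bigl => w; rewrite !inE.
  rewrite fibre; over.
by rewrite -big_distrl/= sc factS.
Qed.

Section factorial_bounds.
Context (R : realType).

Lemma ln_le_linear (M x : R) : 0 < M -> 0 < x -> ln x <= x / M + ln M - 1.
Proof.
move=> M0 x0; have := ln_le_subr1 (divr_gt0 x0 M0).
by rewrite ln_div ?posrE//; lra.
Qed.

Lemma ln_fact_ge (n : nat) : n%:R * ln n%:R - n%:R <= ln n`!%:R :> R.
Proof.
elim: n => [|[|n] IHn]; first by rewrite mul0r subrr fact0 ln1.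
  by rewrite factS fact0 ln1 mulr0 sub0r oppr_le0.
rewrite factS natrM lnM ?posrE ?ltr0n ?fact_gt0//.
set x := n.+1%:R in IHn *; have x0 : 0 < x :> R by rewrite ltr0n.
have x'E : n.+2%:R = x + 1 by rewrite -natr1.
have := ln_le_linear x0 (_ : 0 < x + 1); rewrite x'E => /(_ (addr_gt0 x0 ltr01)).
rewrite mulrDl divff ?gt_eqF// => /(ler_wpM2l (ltW x0)).
rewrite mul1r mulrBr !mulrDr divff ?gt_eqF// => h; move: IHn; lra.
Qed.

Lemma ln_fact_le (n : nat) :
  ln n`!%:R <= n%:R * ln n%:R - n%:R + ln n.+1%:R + 1 :> R.
Proof.
case: n => [|n]; first by rewrite fact0 mul0r ln1; lra.
suff : ln n.+1`!%:R <= n.+1%:R * ln n.+1%:R - n.+1%:R + ln n.+1%:R + 1 :> R.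
  move=> /le_trans; apply; rewrite lerD2r lerD2l ler_ln ?posrE ?ltr0n//.
  by rewrite ler_nat.
elim: n => [|n IHn]; first by rewrite factS fact0 ln1; lra.
rewrite factS natrM lnM ?posrE ?ltr0n ?fact_gt0//.
set x := n.+1%:R in IHn *; have x0 : 0 < x :> R by rewrite ltr0n.
have x'E : n.+2%:R = x + 1 by rewrite -natr1.
have x1 : 0 < x + 1 by rewrite addr_gt0.
have := ln_le_linear x1 x0; rewrite x'E => /(ler_wpM2l (ltW x1)).
rewrite mulrBr !mulrDr mulrCA divff ?gt_eqF// => h; move: IHn; lra.
Qed.

(** Factorial bounds with a logarithmic error suffice: such errors vanish after
    division by the length. *)
Lemma ln_card_type_class (T : finType) (n : nat) (c : T -> nat) :
  (\sum_t c t)%N = n -> (0 < n)%N ->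
  n%:R * shannon (fun t => (c t)%:R / n%:R) - #|T|%:R * (1 + ln n.+1%:R)
    <= ln #|type_class n c|%:R :> R.
Proof.
move=> sc n0; have n0R : 0 < n%:R :> R by rewrite ltr0n.
have snE : n%:R * shannon (fun t => (c t)%:R / n%:R : R) =
    n%:R * ln n%:R - \sum_t (c t)%:R * ln (c t)%:R.
  have -> : n%:R * ln n%:R = \sum_t (c t)%:R * ln n%:R :> R.
    by rewrite -mulr_suml -natr_sum sc.
  rewrite /shannon mulrN mulr_sumr -sumrN -sumrB; apply: eq_bigr => t _.
  rewrite mulrA mulrCA divff ?gt_eqF// mulr1.
  have [->|ct] := posnP (c t); first by rewrite !mul0r subrr oppr0.
  by rewrite ln_div ?posrE ?ltr0n//; lra.
have cn t : (c t <= n)%N by rewrite -sc (bigD1 t)//= leq_addr.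
have prodE : ln (\prod_t (c t)`!)%:R = \sum_t ln (c t)`!%:R :> R.
  by rewrite natr_prod ln_prod// => t _; rewrite posrE ltr0n fact_gt0.
have class_gt0 : (0 < #|type_class n c|)%N.
  by have := fact_gt0 n; rewrite -(card_type_class sc) muln_gt0 => /andP[].
have /(congr1 (fun k => ln k%:R : R)) := card_type_class sc.
rewrite natrM lnM ?posrE ?ltr0n// ?prodn_gt0// => [|t]; last exact: fact_gt0.
rewrite prodE snE => cardE.
have le_fact : \sum_t ln (c t)`!%:R <=
    \sum_t ((c t)%:R * ln (c t)%:R - (c t)%:R + (1 + ln n.+1%:R)) :> R.
  apply: ler_sum => t _; apply: le_trans (ln_fact_le _) _.
  have : ln (c t).+1%:R <= ln n.+1%:R :> R.
    by rewrite ler_ln ?posrE ?ltr0n// ler_nat ltnS.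
  lra.
rewrite big_split/= sumrB -natr_sum sc sumr_const -[X in _ + X]mulr_natl in le_fact.
have := ln_fact_ge n; lra.
Qed.

End factorial_bounds.

(** * Words with prescribed letter frequencies *)

Section block_words.
Context (R : realType).

(** Rounding all but one of the frequencies down leaves the remaining count
    within [#|A|] of its target. *)
Lemma exists_rounding (A : finType) (q : A -> R) : stochastic q ->
  exists c : nat -> A -> nat, (forall j, (\sum_i c j i)%N = j) /\
    forall j i, `|(c j i)%:R - j%:R * q i| <= #|A|%:R.
Proof.
move=> sq; have [q0 q1] := sq.
have [i0] : exists i0 : A, true.
  have [i _|A0] := pickP (@predT A); first by exists i.
  by move: q1; rewrite big_pred0// => /eqP; rewrite eq_sym oner_eq0.
move=> _; pose rest j := (\sum_(i | i != i0) Num.truncn (j%:R * q i))%N.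
have tr j i : (Num.truncn (j%:R * q i))%:R <= j%:R * q i < (Num.truncn (j%:R * q i)).+1%:R.
  by apply: truncn_itv; rewrite mulr_ge0.
have restE j : j%:R * q i0 = j%:R - \sum_(i | i != i0) j%:R * q i.
  have : \sum_i j%:R * q i = j%:R by rewrite -mulr_sumr q1 mulr1.
  by rewrite (bigD1 i0)//=; lra.
have rest_le j : (rest j)%:R <= \sum_(i | i != i0) j%:R * q i.
  by rewrite /rest natr_sum; apply: ler_sum => i _; case/andP: (tr j i).
have rest_lej j : (rest j <= j)%N.
  rewrite -(ler_nat R); apply: le_trans (rest_le j) _.
  by rewrite -subr_ge0 -restE mulr_ge0.
exists (fun j i => if i == i0 then (j - rest j)%N else Num.truncn (j%:R * q i)).
split=> [j|j i].
  rewrite (bigD1 i0)//= eqxx (eq_bigr (fun i => Num.truncn (j%:R * q i))).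
    by rewrite subnK.
  by move=> i /negbTE ->.
have A1 : 1 <= #|A|%:R :> R.
  by rewrite ler1n; apply/card_gt0P; exists i0.
case: eqP => [->|_]; last first.
  apply: le_trans A1; case/andP: (tr j i); rewrite -natr1 => h1 h2.
  by rewrite ler_norml; apply/andP; split; lra.
rewrite natrB// restE ler_norml; apply/andP; split.
  by have := rest_le j; have := A1; lra.
suff : \sum_(i | i != i0) j%:R * q i - (rest j)%:R <= #|A|%:R by lra.
rewrite /rest natr_sum -sumrB.
apply: (@le_trans _ _ (\sum_(i : A | i != i0) 1)).
  by apply: ler_sum => k _; case/andP: (tr j k); rewrite -natr1; lra.
by rewrite sumr_const ler_nat max_card.
Qed.

Lemma exists_seq_of_counts (A : finType) (c : A -> nat) :
  exists s : seq A, forall i, count_mem i s = c i.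
Proof.
exists (flatten [seq nseq (c i) i | i <- enum A]) => i.
rewrite count_flatten -map_comp sumnE big_map big_enum/= (bigD1 i)//=.
rewrite count_nseq/= eqxx mul1n big1 ?addn0// => j /negbTE ji.
by rewrite count_nseq/= ji.
Qed.

Lemma count_sum_mem (A : finType) (P : pred A) (s : seq A) :
  count P s = (\sum_(i | P i) count_mem i s)%N.
Proof.
elim: s => [|x s IHs]; first by rewrite big1.
rewrite /= IHs big_split/=; congr (_ + _)%N.
case Px : (P x).
  by rewrite (bigD1 x)//= eqxx big1 ?addn0// => i /andP[_]; rewrite eq_sym => /negbTE ->.
by rewrite big1// => i Pi; case: eqP => // xi; rewrite xi Pi in Px.
Qed.

Lemma sum_seq_count (A : finType) (v : A -> R) (s : seq A) :
  \sum_(x <- s) v x = \sum_i (count_mem i s)%:R * v i.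
Proof.
elim: s => [|x s IHs]; first by rewrite big_nil big1// => i _; rewrite mul0r.
rewrite big_cons IHs/= [RHS](eq_bigr (fun i => (x == i)%:R * v i +
   (count_mem i s)%:R * v i)) => [|i _]; last by rewrite natrD mulrDl.
rewrite big_split/=; congr (_ + _).
by rewrite (bigD1 x)//= eqxx mul1r big1 ?addr0// => i; rewrite eq_sym => /negbTE->; rewrite mul0r.
Qed.

Lemma ln_nat_sublinear (e : R) : 0 < e ->
  exists j0, forall j, (j0 <= j)%N -> 1 + ln j.+1%:R <= e * j%:R.
Proof.
move=> e0; have M0 : 0 < 2 / e by rewrite divr_gt0.
pose K := (2 / e)^-1 + ln (2 / e); pose j0 := Num.truncn (`|2 / e * K|).
exists j0.+1 => j jj0; have := ln_le_linear M0 (ltr0Sn R j).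
have : `|2 / e * K| < j%:R.
  by apply: lt_le_trans (truncnS_gt _) _; rewrite ler_nat.
move=> /(le_lt_trans (ler_norm _)); rewrite mulrAC ltr_pdivrMr//.
have jS : j.+1%:R = j%:R + 1 :> R by rewrite -natr1.
have KE : ln (2 / e) + e / 2 = K by rewrite /K invf_div addrC.
rewrite invf_div jS mulrDl mul1r => h1 h2; move: h1 h2; lra.
Qed.

(** All rearrangements of one word with the letter frequencies of [q]: their
    images under [f] form a type class. *)
Lemma block_words (A B : finType) (f : A -> B) (q v : A -> R) (e : R) :
  stochastic q -> 0 < e ->
  exists j0, forall j, (j0 <= j)%N -> exists (I : finType) (u : I -> nat -> A),
    [/\ forall x, `|\sum_(i < j) (v (u x i) - mean v q)| <= #|A|%:R * \sum_a `|v a|,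
        forall x y, x != y -> exists2 i, (i < j)%N & f (u x i) != f (u y i) &
        expR (j%:R * (shannon (image_law f q) - e)) <= #|I|%:R].
Proof.
move=> sq e0; have [c [sc cq]] := exists_rounding sq.
pose c' j b := (\sum_(i | f i == b) c j i)%N.
have sc' j : (\sum_b c' j b)%N = j by rewrite -[RHS]sc (partition_big f xpredT).
have shcvg : shannon (fun b => (c' j b)%:R / j%:R : R) @[j --> \oo] -->
    shannon (image_law f q).
  rewrite /shannon; apply: cvgN; apply: cvg_fin_sum => b _.
  apply: (@continuous_cvg _ _ _ _ _ _ (fun x : R => x * ln x)).
    exact: continuous_xlnx.
  rewrite /c' /image_law; under eq_fun do rewrite natr_sum mulr_suml.
  apply: cvg_fin_sum => i _; apply/cvgrPdist_le => d d0.
  near=> j; have j0 : 0 < j%:R :> R by rewrite ltr0n; near: j; exists 1%N.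
  have -> : q i - (c j i)%:R / j%:R = (j%:R * q i - (c j i)%:R) / j%:R.
    by rewrite mulrBl mulrAC divff ?gt_eqF// mul1r.
  rewrite normrM normfV (gtr0_norm j0) ler_pdivrMr// distrC.
  apply: le_trans (cq j i) _.
  rewrite mulrC -ler_pdivrMr//; near: j; exact: nbhs_infty_ger.
have [N1 _ HN1] : \forall j \near \oo,
    `|shannon (image_law f q) - shannon (fun b => (c' j b)%:R / j%:R : R)| <= e / 2.
  by move/cvgrPdist_le: shcvg; apply; rewrite divr_gt0.
pose cB : R := #|B|%:R + 1.
have cB0 : 0 < cB by rewrite ltr_wpDl.
have [N2 HN2] : exists j0, forall j, (j0 <= j)%N -> 1 + ln j.+1%:R <= (e / 2 / cB) * j%:R :> R.
  by apply: ln_nat_sublinear; rewrite !divr_gt0.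
exists (maxn 1 (maxn N1 N2)) => j; rewrite !geq_max => /and3P[j0 jN1 jN2].
have [s sE] := exists_seq_of_counts (c j).
have size_s : size s = j.
  by rewrite -count_predT count_sum_mem -[RHS]sc; apply: eq_bigr => i _.
have i0 : A.
  by move: j0; rewrite -size_s; case: {sE size_s} s => // x.
pose I : finType := {w : j.-tuple B | w \in type_class j (c' j)}.
have lift (w : I) : exists s', perm_eq s' s /\ [seq f x | x <- s'] = val w.
  case: w => w /= /type_classP wc.
  have pw : perm_eq w [seq f x | x <- s].
    apply/allP => b _ /=; rewrite wc count_map count_sum_mem /c'.
    by apply/eqP/eq_bigr => i _.
  move/(perm_iotaP (f i0)): pw => [js pjs ->].
  exists [seq nth i0 s k | k <- js]; split.
    by apply/(perm_iotaP i0); exists js => //; rewrite size_map in pjs.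
  rewrite -map_comp; apply/eq_in_map => k; rewrite (perm_mem pjs) mem_iota.
  by rewrite size_map /= => ks; rewrite (nth_map i0).
have [g gP] := choice lift.
have size_g w : size (g w) = j by rewrite (perm_size (proj1 (gP w))).
exists I, (fun w i => nth i0 (g w) i); split=> [w|w w' ww'|].
- have -> : \sum_(i < j) (v (nth i0 (g w) i) - mean v q) =
      \sum_a ((c j a)%:R - j%:R * q a) * v a.
    rewrite sumrB sumr_const card_ord -[_ *+ _]mulr_natl.
    rewrite -(big_mkord xpredT (fun i => v (nth i0 (g w) i))).
    rewrite -{1}(size_g w) -(big_nth i0 xpredT v) (perm_big s) ?(proj1 (gP w))//=.
    rewrite sum_seq_count /mean mulr_sumr -sumrB; apply: eq_bigr => a _.
    by rewrite sE mulrBl mulrA.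
  apply: le_trans (ler_norm_sum _ _ _) _; rewrite mulr_sumr; apply: ler_sum => a _.
  by rewrite normrM ler_wpM2r.
- have : val w != val w' by rewrite (inj_eq val_inj).
  have [_ gw] := gP w; have [_ gw'] := gP w'.
  move=> /eqP ne; apply: contrapT => h; apply: ne; apply/val_inj.
  rewrite /= -gw -gw'; apply: (@eq_from_nth _ (f i0)); rewrite !size_map !size_g//.
  move=> i ij; rewrite !(nth_map i0) ?size_g//; apply/eqP/negPn/negP => ne.
  by apply: h; exists i.
- have jR : 0 < j%:R :> R by rewrite ltr0n.
  have cl0 : (0 < #|type_class j (c' j)|)%N.
    by have := fact_gt0 j; rewrite -(card_type_class (sc' j)) muln_gt0 => /andP[].
  rewrite card_sig -[leRHS]lnK ?posrE ?ltr0n// ler_expR.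
  apply: le_trans (ln_card_type_class R (sc' j) j0).
  have /= := HN1 _ jN1; rewrite ler_norml => /andP[_ /(ler_wpM2l (ltW jR)) h1].
  have B0 : 0 <= #|B|%:R :> R by [].
  have /(ler_wpM2l (ltW cB0)) := HN2 _ jN2.
  rewrite mulrA mulrCA divff ?gt_eqF// mulr1 /cB => h2.
  have ln1 : 0 <= 1 + ln j.+1%:R :> R by rewrite addr_ge0// ln_ge0// ler1n.
  by move: h1 h2; rewrite !mulrBr mulrDl; lra.
Unshelve. all: by end_near.
Qed.

End block_words.

(** * Counting words by entropy *)

Section entropy_bounds.
Context (R : realType).

(** The vectors [q] form a compact set on which the entropy is continuous, so a
    bound valid on the slice [mean v q = alpha] nearly holds on nearby slices. *)
Lemma shannon_near_slice (A B : finType) (f : A -> B) (v : A -> R) (alpha h e : R) :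
  (forall q, stochastic q -> mean v q = alpha -> shannon (image_law f q) <= h) ->
  0 < e ->
  exists2 eta, 0 < eta & forall q, stochastic q -> `|mean v q - alpha| <= eta ->
    shannon (image_law f q) <= h + e.
Proof.
move=> hq e0; apply: contrapT => nex.
have /choice[q qP] : forall n : nat, exists q : A -> R, [/\ stochastic q,
    `|mean v q - alpha| <= n.+1%:R^-1 & h + e < shannon (image_law f q)].
  move=> n; apply: contrapT => nq; apply: nex; exists n.+1%:R^-1 => //.
  move=> q sq mq; rewrite leNgt; apply/negP => lt; apply: nq.
  by exists q.
pose X := prod_topology (fun _ : A => R).
have cont_proj (a : A) : continuous (fun q : X => q a).
  exact: (@proj_continuous A (fun=> R) a).
have cont_mean : continuous (fun q : X => mean v q).
  apply: (@continuous_fin_sum R X A xpredT (fun a q => q a * v a)) => a x.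
  apply: (@continuous_comp _ _ _ (fun q : X => q a) (fun y : R => y * v a)).
    exact: cont_proj.
  by apply: cvgM; [exact: cvg_id | exact: cvg_cst].
have cont_sh : continuous (fun q : X => shannon (image_law f q)).
  have c : continuous (fun q : X =>
      \sum_b image_law f q b * ln (image_law f q b)).
    apply: (@continuous_fin_sum R X B xpredT
      (fun b q => image_law f q b * ln (image_law f q b))) => b x.
    apply: (@continuous_comp _ _ _ (fun q : X => image_law f q b)
      (fun y : R => y * ln y)); last exact: continuous_xlnx.
    exact: (@continuous_fin_sum R X A (fun a => f a == b) (fun a q => q a)).
  move=> x; apply: (@continuous_comp _ _ _ (fun q : X =>
    \sum_b image_law f q b * ln (image_law f q b)) (@GRing.opp R)).
    exact: c.
  exact: opp_continuous.
have cont_sum : continuous (fun q : X => \sum_a q a).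
  exact: (@continuous_fin_sum R X A xpredT (fun a q => q a)).
have cK : compact [set q : X | forall a, `[0, 1]%classic (q a)].
  exact: (@tychonoff A (fun=> R) (fun=> `[0, 1]%classic) (fun a => @segment_compact R 0 1)).
pose F : set_system X := (q : nat -> X) @ \oo.
have FF : ProperFilter F by rewrite /F; typeclasses eauto.
have Fall (C : set X) : (forall n, C (q n)) -> F C.
  by move=> Cq; exists 0%N => // n _; exact: Cq.
have Fnear (C : set X) : (\forall n \near \oo, C (q n)) -> F C by [].
have FK : F [set q : X | forall a, `[0, 1]%classic (q a)].
  apply: Fall => n a /=; rewrite in_itv/=.
  by have [[q0 q1] _ _] := qP n; rewrite q0 (@stochastic_le1 _ _ (q n)).
have [x [_ clx]] := cK F FF FK.
have limit (C : set X) : closed C -> F C -> C x.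
  by move=> clC FC; rewrite clusterE in clx; have := clx _ FC; rewrite -(proj1 (closure_id C) clC).
have ge_closed (g : X -> R) (y : R) : continuous g -> closed [set q | y <= g q].
  by move=> cg; apply: (@preimage_closed _ _ g [set z | y <= z]) => [? _|]; [exact: cg|exact: closed_ge].
have le_closed (g : X -> R) (y : R) : continuous g -> closed [set q | g q <= y].
  by move=> cg; apply: (@preimage_closed _ _ g [set z | z <= y]) => [? _|]; [exact: cg|exact: closed_le].
have sx : stochastic (x : A -> R).
  split=> [a|].
    apply: (limit [set q | 0 <= q a]); first exact: (ge_closed _ _ (cont_proj a)).
    by apply: Fall => n; have [[q0 _] _ _] := qP n; exact: q0.
  apply/eqP; rewrite eq_le; apply/andP; split.
    apply: (limit [set q | \sum_a q a <= 1]); first exact: (le_closed _ _ cont_sum).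
    by apply: Fall => n; have [[_ q1] _ _] := qP n; rewrite /= q1.
  apply: (limit [set q | 1 <= \sum_a q a]); first exact: (ge_closed _ _ cont_sum).
  by apply: Fall => n; have [[_ q1] _ _] := qP n; rewrite /= q1.
have mx : mean v x = alpha.
  apply/eqP; rewrite -subr_eq0 -normr_le0; apply/ler_addgt0Pr => d d0; rewrite add0r.
  rewrite ler_norml lerBlDr lerBrDr; apply/andP; split.
    apply: (limit [set q | - d + alpha <= mean v q]); first exact: (ge_closed _ _ cont_mean).
    apply: Fnear; near=> n; have [_ mq _] := qP n.
    have le_d : n.+1%:R^-1 <= d
      by apply: ltW; near: n; exact: (near_infty_natSinv_lt (PosNum d0)).
    by have /= := le_trans mq le_d; rewrite ler_norml => /andP[]; lra.
  apply: (limit [set q | mean v q <= d + alpha]); first exact: (le_closed _ _ cont_mean).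
  apply: Fnear; near=> n; have [_ mq _] := qP n.
  have le_d : n.+1%:R^-1 <= d
      by apply: ltW; near: n; exact: (near_infty_natSinv_lt (PosNum d0)).
  by have /= := le_trans mq le_d; rewrite ler_norml => /andP[]; lra.
have := hq _ sx mx; apply/negP; rewrite -ltNge.
apply: (@lt_le_trans _ _ (h + e)); first by rewrite ltrDl.
apply: (limit [set q | h + e <= shannon (image_law f q)]).
  exact: (ge_closed _ _ cont_sh).
by apply: Fall => n; have [_ _ /ltW] := qP n.
Unshelve. all: by end_near.
Qed.

(** Distinct classes are disjoint sets of words, so a product law gives them
    total mass at most [1]. *)
Lemma class_mass_le1 (A : finType) (N : nat) (B : 'I_N -> finType)
    (f : forall n, A -> B n) (g : 'I_N -> A -> R) (I : finType) (z : I -> 'I_N -> A) :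
  (forall n, stochastic (g n)) ->
  (forall x y, x != y -> exists n, f n (z x n) != f n (z y n)) ->
  \sum_x \prod_n image_law (f n) (g n) (f n (z x n)) <= 1.
Proof.
move=> sg sep.
under eq_bigr => x _ do rewrite bigA_distr_big_dep.
rewrite (exchange_big_dep xpredT)//=.
have tot : \sum_(w : {ffun 'I_N -> A}) \prod_n g n (w n) = 1.
  by rewrite -bigA_distr_bigA big1// => n _; exact: (proj2 (sg n)).
rewrite -[leRHS]tot; apply: ler_sum => w _.
have pw : 0 <= \prod_n g n (w n) by apply: prodr_ge0 => n _; exact: (proj1 (sg n)).
rewrite sumr_const -mulr_natl ler_piMl// lern1.
apply/card_le1_eqP => x y xP yP; apply/eqP/negPn/negP => /sep[n /eqP]; apply.
by move: xP yP => /familyP/(_ n)/eqP <- /familyP/(_ n)/eqP.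
Qed.

(** Gibbs' inequality between the uniform law on the family and the product of
    its mean letter frequencies [qb m] over the positions of each level [m]. *)
Lemma card_classes_le (A : finType) (M : finType) (B : M -> finType)
    (f : forall m, A -> B m) (N : nat) (lev : 'I_N -> M)
    (I : finType) (z : I -> 'I_N -> A) (v : A -> R) (alpha e : R) (h : M -> R) :
  (0 < #|I|)%N -> (forall m, exists n, lev n = m) ->
  (forall x y, x != y -> exists n, f (lev n) (z x n) != f (lev n) (z y n)) ->
  (forall x m, `|\sum_(n | lev n == m) (v (z x n) - alpha)| <=
     e * #|[pred n | lev n == m]|%:R) ->
  (forall m q, stochastic q -> `|mean v q - alpha| <= e ->
     shannon (image_law (f m) q) <= h m) ->
  ln #|I|%:R <= \sum_m #|[pred n | lev n == m]|%:R * h m.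
Proof.
move=> I0 levsurj sep avg hh.
pose l m : R := #|[pred n | lev n == m]|%:R.
have I0R : 0 < #|I|%:R :> R by rewrite ltr0n.
have l0 m : 0 < l m.
  by rewrite ltr0n; apply/card_gt0P; have [n <-] := levsurj m; exists n; rewrite inE.
pose cnt m a : R := \sum_x \sum_(n | lev n == m) (z x n == a)%:R.
pose qb m a : R := cnt m a / (#|I|%:R * l m).
have cntE m (u : A -> R) : \sum_a cnt m a * u a = \sum_x \sum_(n | lev n == m) u (z x n).
  under eq_bigr => a _ do rewrite mulr_suml.
  rewrite exchange_big; apply: eq_bigr => x _.
  under eq_bigr => a _ do rewrite mulr_suml.
  rewrite exchange_big; apply: eq_bigr => n _ /=.
  rewrite (bigD1 (z x n))//= eqxx mul1r big1 ?addr0// => a; rewrite eq_sym.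
  by move=> /negbTE->; rewrite mul0r.
have qbE m (u : A -> R) : \sum_a qb m a * u a =
    (\sum_x \sum_(n | lev n == m) u (z x n)) / (#|I|%:R * l m).
  by rewrite -cntE mulr_suml; apply: eq_bigr => a _; rewrite /qb mulrAC.
have Il0 m : 0 < #|I|%:R * l m by rewrite mulr_gt0.
have cnt_ge0 m a : 0 <= cnt m a by apply: sumr_ge0 => x _; exact: sumr_ge0.
have sqb m : stochastic (qb m).
  split=> [a|]; first by rewrite divr_ge0// ltW.
  have := qbE m (fun=> 1); rewrite (eq_bigr (qb m)) => [->|a _]; last exact: mulr1.
  have -> : \sum_(x : I) \sum_(n | lev n == m) (1 : R) = #|I|%:R * l m.
    by rewrite !sumr_const mulr_natl.
  by rewrite divff// gt_eqF.
have mqb m : `|mean v (qb m) - alpha| <= e.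
  have -> : mean v (qb m) - alpha =
      (\sum_x \sum_(n | lev n == m) (v (z x n) - alpha)) / (#|I|%:R * l m).
    rewrite -(qbE m (fun a => v a - alpha)); under [RHS]eq_bigr do rewrite mulrBr.
    by rewrite sumrB -mulr_suml (proj2 (sqb m)) mul1r.
  rewrite normrM normfV (gtr0_norm (Il0 m)) ler_pdivrMr//.
  apply: le_trans (ler_norm_sum _ _ _) _.
  apply: (@le_trans _ _ (\sum_(x : I) e * l m)); first by apply: ler_sum => x _; exact: avg.
  by rewrite sumr_const -[_ *+ _]mulr_natl mulrCA.
have qb_gt0 x n : 0 < qb (lev n) (z x n).
  rewrite divr_gt0// /cnt (bigD1 x)//= (bigD1 n)//= eqxx.
  by rewrite -addrA ltr_pwDl// addr_ge0// ?sumr_ge0// => y _; rewrite sumr_ge0.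
have il_gt0 x n : 0 < image_law (f (lev n)) (qb (lev n)) (f (lev n) (z x n)).
  apply: lt_le_trans (qb_gt0 x n) _.
  by rewrite /image_law (bigD1 (z x n))//= lerDl sumr_ge0// => a _; exact: (proj1 (sqb _)).
pose Q x := \prod_n image_law (f (lev n)) (qb (lev n)) (f (lev n) (z x n)).
have Q0 x : 0 < Q x by apply: prodr_gt0.
have sp : stochastic (fun _ : I => #|I|%:R^-1 : R).
  by split=> [x|]; rewrite ?invr_ge0// sumr_const -[_ *+ _]mulr_natl divff// gt_eqF.
have := @gibbs _ _ (fun=> #|I|%:R^-1) Q sp (fun x => ltW (Q0 x))
  (@class_mass_le1 A N (fun n => B (lev n)) (fun n => f (lev n)) (fun n => qb (lev n)) I z
    (fun n => sqb (lev n)) sep) (fun x _ => Q0 x).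
have -> : shannon (fun _ : I => #|I|%:R^-1) = ln #|I|%:R :> R.
  rewrite /shannon sumr_const -[_ *+ _]mulr_natl mulrA divff ?gt_eqF// mul1r.
  by rewrite lnV ?posrE// opprK.
move=> /le_trans; apply.
rewrite -mulr_sumr.
have -> : \sum_x ln (Q x) = \sum_m \sum_x \sum_(n | lev n == m)
   ln (image_law (f m) (qb m) (f m (z x n))).
  rewrite exchange_big; apply: eq_bigr => x _.
  rewrite ln_prod// (partition_big lev xpredT)//=; apply: eq_bigr => m _.
  by apply: eq_bigr => n /eqP <-.
rewrite mulr_sumr -sumrN; apply: ler_sum => m _.
apply: le_trans (_ : l m * shannon (image_law (f m) (qb m)) <= _); last first.
  by apply: ler_wpM2l; [exact: ltW | exact: hh].
rewrite /shannon sum_image_law (qbE m (fun a => ln (image_law (f m) (qb m) (f m a)))).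
set S := \sum_x _; have -> : l m * - (S / (#|I|%:R * l m)) = - (#|I|%:R^-1 * S).
  by field; rewrite (gt_eqF I0R) (gt_eqF (l0 m)).
exact: lexx.
Qed.

End entropy_bounds.

(** * Laws of finite-valued maps *)

Section laws.
Context (R : realType) (disp : measure_display) (X : measurableType disp).
Context (M : probability X R).
Implicit Types (C : finType) (B : set X).

Definition pr B : R := fine (M B).

Lemma prE B : measurable B -> M B = (pr B)%:E.
Proof. by move=> mB; rewrite fineK// fin_num_measure. Qed.

Lemma pr_ge0 B : 0 <= pr B.
Proof. by rewrite fine_ge0. Qed.

Lemma le_pr B B' : measurable B -> measurable B' -> B `<=` B' -> pr B <= pr B'.
Proof.
by move=> mB mB' BB'; rewrite -lee_fin -!prE// le_measure// inE.
Qed.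

Lemma prU B B' : measurable B -> measurable B' -> B `&` B' = set0 ->
  pr (B `|` B') = pr B + pr B'.
Proof.
move=> mB mB' BB'; apply: EFin_inj; rewrite EFinD -!prE//; last exact: measurableU.
exact: measureU.
Qed.

Lemma prU_le B B' : measurable B -> measurable B' -> pr (B `|` B') <= pr B + pr B'.
Proof.
move=> mB mB'; rewrite -lee_fin EFinD -!prE//; last exact: measurableU.
exact: measureU2.
Qed.

Lemma prT : pr setT = 1.
Proof. by rewrite /pr probability_setT. Qed.

Lemma pr_full J B : measurable J -> measurable B -> pr J = 1 ->
  pr B = pr (B `&` J).
Proof.
move=> mJ mB J1; apply/eqP; rewrite eq_le andbC; apply/andP; split.
  by apply: le_pr; [exact: measurableI | exact: mB | exact: subIsetl].
have JC : pr (~` J) = 0.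
  have : pr (J `|` ~` J) = pr J + pr (~` J).
    by apply: prU; rewrite ?setICr//; exact: measurableC.
  by rewrite setUv prT J1; lra.
rewrite -[leRHS]addr0 -JC; apply: le_trans (prU_le _ _).
- apply: le_pr => //; first by apply: measurableU; [exact: measurableI|exact: measurableC].
  by move=> x Bx; have [Jx|nJx] := pselect (J x); [left | right].
- exact: measurableI.
- exact: measurableC.
Qed.

Definition finite_map C (F : X -> C) : Prop :=
  forall c, measurable (F @^-1` [set c]).

Definition law C (F : X -> C) (c : C) : R := pr (F @^-1` [set c]).

Lemma measurable_finite_map C (F : X -> C) (P : C -> Prop) : finite_map F ->
  measurable (F @^-1` P).
Proof.
move=> mF; have -> : F @^-1` P = \bigcup_(c in P) (F @^-1` [set c]).
  by rewrite seteqP; split=> [x Px|x [c Pc /= ->//]]; exists (F x).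
by apply: fin_bigcup_measurable => // c _; exact: mF.
Qed.

Lemma pr_preimage C (F : X -> C) (P : pred C) : finite_map F ->
  measurable (F @^-1` [set c | P c]) /\
  pr (F @^-1` [set c | P c]) = \sum_(c | P c) law F c.
Proof.
move=> mF.
have H (s : seq C) : uniq s -> measurable [set x | F x \in s] /\
    pr [set x | F x \in s] = \sum_(c <- s) law F c.
  elim: s => [_|c s IHs /= /andP[cs us]].
    rewrite (_ : [set x | _] = set0) ?big_nil; last by rewrite seteqP; split=> x.
    by split; rewrite // /pr measure0.
  have [ms prs] := IHs us; rewrite big_cons -prs.
  rewrite (_ : [set x | _] = F @^-1` [set c] `|` [set x | F x \in s]); last first.
    rewrite seteqP; split=> x /=; rewrite in_cons.
      by move=> /orP[/eqP|]; [left|right].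
    by move=> [->|->]; rewrite ?eqxx ?orbT.
  split; first exact: measurableU.
  rewrite prU//; apply/seteqP; split=> x //= [Fx].
  by rewrite Fx (negbTE cs).
have [] := H (enum P) (enum_uniq _).
rewrite (_ : [set x | _] = F @^-1` [set c | P c]) ?big_enum//.
by rewrite seteqP; split=> x /=; rewrite mem_enum.
Qed.

Lemma finite_map_comp C C' (F : X -> C) (g : C -> C') :
  finite_map F -> finite_map (g \o F).
Proof. by move=> mF c'; exact: (measurable_finite_map (fun c => g c = c') mF). Qed.

Lemma law_comp C C' (F : X -> C) (g : C -> C') : finite_map F ->
  law (g \o F) = image_law g (law F).
Proof.
move=> mF; apply/funext => c'; rewrite /image_law.
have [_ <-] := pr_preimage (fun c => g c == c') mF.
by congr pr; rewrite seteqP; split=> x /= /eqP.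
Qed.

Lemma finite_map_pair C C' (F : X -> C) (G : X -> C') :
  finite_map F -> finite_map G -> finite_map (fun x => (F x, G x)).
Proof.
move=> mF mG [c c']; rewrite (_ : _ @^-1` _ = F @^-1` [set c] `&` G @^-1` [set c']).
  exact: measurableI.
by rewrite seteqP; split=> x /= [-> ->].
Qed.

Lemma finite_map_ffun (I C : finType) (F : I -> X -> C) :
  (forall i, finite_map (F i)) -> finite_map (fun x => [ffun i => F i x]).
Proof.
move=> mF c; rewrite (_ : _ @^-1` _ = \big[setI/setT]_i (F i @^-1` [set c i])).
  by apply: big_ind => // [B B' mB mB'|i _]; [exact: measurableI | exact: mF].
rewrite seteqP; split=> x /=.
  by move=> <-; elim/big_rec: _ => // i y _ yx; split=> //=; rewrite ffunE.
move=> h; apply/ffunP => i; rewrite ffunE.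
by move: h; rewrite (bigD1 i)//= => -[].
Qed.

Lemma stochastic_law C (F : X -> C) : finite_map F -> stochastic (law F).
Proof.
move=> mF; split=> [c|]; first exact: pr_ge0.
have [_ <-] := pr_preimage xpredT mF; rewrite -[RHS]prT.
by congr pr; rewrite seteqP.
Qed.

Lemma integral_finite_map C (F : X -> C) (u : C -> R) : finite_map F ->
  (\int[M]_x (u (F x))%:E)%E = (\sum_c law F c * u c)%:E.
Proof.
move=> mF.
pose ind c x : \bar R := (\1_(F @^-1` [set c]) x)%:E.
have int_ind c : M.-integrable setT (ind c).
  by apply: integrable_indic; rewrite ?ltey_eq ?fin_num_measure.
have -> : (fun x => (u (F x))%:E) = (fun x => (\sum_c (u c)%:E * ind c x)%E).
  apply/funext => x; rewrite (bigD1 (F x))//= {1}/ind indicE mem_set//= mule1.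
  rewrite big1 ?adde0// => c /eqP cF; rewrite /ind indicE memNset ?mule0//=.
  by move=> /esym.
rewrite integral_sum//; last by move=> c; exact: integrableZl.
rewrite -sumEFin; apply: eq_bigr => c _.
rewrite integralZl// integral_indic// setIT EFinM muleC; congr (_ * _)%E.
exact: prE.
Qed.

End laws.

(** * Cylinders *)

Section cylinders.
Context (T : finType) (E : neset T).
Notation A := (alphabet E).
Notation X := (seqspace A).

Definition agree (n : nat) (w w' : nat -> A) : Prop :=
  forall i, (i < n)%N -> w i = w' i.

Definition cylindric (n : nat) (B : set (nat -> A)) : Prop :=
  forall w w', agree n w w' -> B w -> B w'.

Lemma nbhs_cylinder (w : prod_topology (fun _ : nat => discrete_topology A))
    (B : set (nat -> A)) :
  nbhs w B <-> exists n, [set w' | agree n w w'] `<=` B.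
Proof.
split=> [wB|[n nB]].
  pose F : set_system (nat -> A) := [set C | exists n, [set w' | agree n w w'] `<=` C].
  have FF : Filter F.
    split; first by exists 0%N.
      move=> P Q [n nP] [m mQ]; exists (maxn n m) => w' ww'.
      by split; [apply: nP|apply: mQ] => i ?; apply: ww'; rewrite leq_max; apply/orP; [left|right].
    by move=> P Q PQ [n nP]; exists n; exact: subset_trans PQ.
  suff : F --> w by apply.
  apply/cvg_sup => i C [_ [[D oD <-] Dw] DC].
  exists i.+1 => w' ww'; apply: DC => /=; rewrite -ww'//.
apply: (@filterS _ (nbhs w) _ [set w' | forall i : 'I_n, w' i = w i]).
  by move=> w' /= h; apply: nB => i ilt; rewrite (h (Ordinal ilt)).
apply: (@filter_forall _ _ (fun (i : 'I_n) (w' : nat -> A) => w' i = w i) (nbhs w) (nbhs_filter w)) => i.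
have /(_ w) := @proj_continuous nat (fun=> discrete_topology A) i.
move=> /(_ [set w i]); apply; exact: discrete_set1.
Qed.

Lemma measurable_open (B : set X) :
  (forall w, B w -> exists n, [set w' | agree n w w'] `<=` B) -> measurable B.
Proof.
move=> oB; apply: sub_sigma_algebra; rewrite /= openE => w Bw.
by apply/nbhs_cylinder; exact: oB.
Qed.

Lemma measurable_cylindric (n : nat) (B : set X) : cylindric n B -> measurable B.
Proof. by move=> cB; apply: measurable_open => w Bw; exists n => w' ww'; exact: cB ww' Bw. Qed.

Lemma agree_le m n w w' : (m <= n)%N -> agree n w w' -> agree m w w'.
Proof. by move=> mn ww' i im; apply: ww'; exact: leq_trans im mn. Qed.

Lemma cylindric_le m n B : (m <= n)%N -> cylindric m B -> cylindric n B.
Proof. by move=> mn cB w w' ww'; apply: cB; exact: agree_le ww'. Qed.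

Lemma agree_sym n w w' : agree n w w' -> agree n w' w.
Proof. by move=> ww' i im; rewrite ww'. Qed.

Lemma cylindricC n B : cylindric n B -> cylindric n (~` B).
Proof. by move=> cB w w' /agree_sym ww' nB Bw'; apply: nB; exact: cB ww' Bw'. Qed.

Lemma open_bigcup_cylindric (B : set X) :
  open (B : set (prod_topology (fun _ : nat => discrete_topology A))) ->
  exists F : nat -> set X, [/\ forall n, cylindric n (F n),
    {homo F : n m / (n <= m)%N >-> (n <= m)%O} & B = \bigcup_n F n].
Proof.
move=> oB; exists (fun n => [set w | [set w' | agree n w w'] `<=` B]); split.
- move=> n w w' ww' nB w'' w'w''; apply: nB => i ilt /=.
  by rewrite ww'// w'w''.
- move=> m n mn; apply/subsetPset => w mB w' ww'; apply: mB; exact: agree_le ww'.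
- rewrite seteqP; split=> [w Bw|w [n _]]; last by apply.
  by move: oB; rewrite openE => /(_ _ Bw)/nbhs_cylinder[n nB]; exists n.
Qed.

Lemma shift_iterE k (w : X) i : iter k (@Defs.shift A) w i = w (i + k)%N.
Proof. by elim: k i => [|k IHk] i; rewrite ?addn0//= /Defs.shift IHk addSnnS. Qed.

Lemma finite_map_letter i : finite_map (fun w : X => w i).
Proof.
move=> a; apply: (@measurable_cylindric i.+1) => w w' ww' /= <-.
by rewrite ww'.
Qed.

Lemma measurable_to_seqspace (disp : measure_display) (Y : measurableType disp)
    (g : Y -> X) : (forall i, finite_map (fun y => g y i)) ->
  measurable_fun setT g.
Proof.
move=> mg _ B; rewrite setTI; move: B; apply: smallest_sub.
  split; first by rewrite preimage_set0.
    by move=> B mB; rewrite setTD preimage_setC; exact: measurableC.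
  by move=> F mF; rewrite preimage_bigcup; exact: bigcup_measurable.
move=> B /open_bigcup_cylindric[F [cF _ ->]] /=.
rewrite preimage_bigcup; apply: bigcup_measurable => n _.
have mG : finite_map (fun y => [ffun i : 'I_n => g y i]).
  by apply: finite_map_ffun => i; exact: mg.
pose P (c : {ffun 'I_n -> A}) := exists2 y, F n (g y) & c = [ffun i : 'I_n => g y i].
rewrite (_ : _ @^-1` _ = (fun y => [ffun i : 'I_n => g y i]) @^-1` P).
  exact: measurable_finite_map.
rewrite seteqP; split=> y /=; first by exists y.
move=> [y' Fy' /ffunP yy']; apply: cF Fy' => i ilt.
by have := yy' (Ordinal ilt); rewrite !ffunE.
Qed.

Lemma measurable_shift : measurable_fun setT (@Defs.shift A).
Proof. by apply: measurable_to_seqspace => i; exact: (finite_map_letter i.+1). Qed.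

End cylinders.

(** * Entropy of invariant measures *)

Section approximation.
Context (R : realType) (T : finType) (E : neset T).
Notation A := (alphabet E).
Notation X := (seqspace A).
Context (M : probability X R).

Definition symdiff (B C : set X) : set X := (B `\` C) `|` (C `\` B).

Lemma measurable_symdiff B C : measurable B -> measurable C ->
  measurable (symdiff B C).
Proof. by move=> mB mC; apply: measurableU; exact: measurableD. Qed.

Definition approximable (B : set X) : Prop := measurable B /\
  forall e, 0 < e -> exists n (C : set X), cylindric n C /\ pr M (symdiff B C) < e.

Lemma approximable_cylindric n (C : set X) : cylindric n C -> approximable C.
Proof.
move=> cC; split; first exact: measurable_cylindric cC.
by move=> e e0; exists n, C; rewrite /symdiff setDv setU0 /pr measure0.
Qed.

Lemma approximableC (B : set X) : approximable B -> approximable (~` B).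
Proof.
move=> [mB aB]; split; first exact: measurableC.
move=> e /aB[n [C [cC lt]]]; exists n, (~` C); split; first exact: cylindricC.
have -> // : symdiff (~` B) (~` C) = symdiff B C.
by rewrite /symdiff !setDE !setCK setUC; congr (_ `|` _); exact: setIC.
Qed.

Lemma approximableU (B B' : set X) :
  approximable B -> approximable B' -> approximable (B `|` B').
Proof.
move=> [mB aB] [mB' aB']; split; first exact: measurableU.
move=> e e0; have e2 : 0 < e / 2 by rewrite divr_gt0.
have [n [C [cC lt]]] := aB _ e2; have [n' [C' [cC' lt']]] := aB' _ e2.
exists (maxn n n'), (C `|` C'); split.
  move=> w w' ww' [Cw|Cw]; [left|right].
    by apply: cC Cw; apply: agree_le ww'; exact: leq_maxl.
  by apply: cC' Cw; apply: agree_le ww'; exact: leq_maxr.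
have mC := measurable_cylindric cC; have mC' := measurable_cylindric cC'.
apply: (@le_lt_trans _ _ (pr M (symdiff B C `|` symdiff B' C'))).
  apply: le_pr; first by apply: measurable_symdiff; exact: measurableU.
    by apply: measurableU; exact: measurable_symdiff.
  move=> w [[[Bw|Bw] /not_orP[nC nC']]|[[Cw|Cw] /not_orP[nB nB']]].
  - by left; left.
  - by right; left.
  - by left; right.
  - by right; right.
apply: le_lt_trans (prU_le _ _ _) _; try exact: measurable_symdiff.
by rewrite [e]splitr ltrD.
Qed.

Lemma approximable_increasing (F : nat -> set X) :
  (forall n, approximable (F n)) -> {homo F : n m / (n <= m)%N >-> (n <= m)%O} ->
  approximable (\bigcup_n F n).
Proof.
move=> aF Fle; have mF n := proj1 (aF n).
have mU : measurable (\bigcup_n F n) by exact: bigcup_measurable.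
split=> // e e0; have e2 : 0 < e / 2 by rewrite divr_gt0.
have [N HN] : exists N, pr M (\bigcup_n F n `\` F N) < e / 2.
  have : (M \o F) x @[x --> \oo] --> (pr M (\bigcup_n F n))%:E.
    by rewrite -prE//; exact: nondecreasing_cvg_mu.
  move=> /fine_cvg/cvgrPdist_lt/(_ _ e2)[N _ /(_ N (leqnn N))] /= lt.
  exists N; apply: le_lt_trans lt; rewrite -/(pr M _) -/(pr M (F N)).
  have : pr M (\bigcup_n F n) = pr M (F N) + pr M (\bigcup_n F n `\` F N).
    rewrite -prU//; last by rewrite setIDA setIC -setIDA setDv setI0.
      by congr pr; rewrite setDUK// => w Fw; exists N.
    exact: measurableD.
  by move=> ->; rewrite addrAC subrr add0r ler_norm.
have [_ /(_ _ e2)[n [C [cC lt]]]] := aF N.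
have mC := measurable_cylindric cC.
exists n, C; split=> //.
apply: (@le_lt_trans _ _ (pr M ((\bigcup_n F n `\` F N) `|` symdiff (F N) C))).
  apply: le_pr; first exact: measurable_symdiff.
    by apply: measurableU; [exact: measurableD | exact: measurable_symdiff].
  move=> w [[Uw nC]|[Cw nU]].
    by have [Fw|nFw] := pselect (F N w); [right; left | left].
  by right; right; split=> // Fw; apply: nU; exists N.
apply: le_lt_trans (prU_le _ _ _) _; first exact: measurableD.
  exact: measurable_symdiff.
by rewrite [e]splitr ltrD.
Qed.

Lemma measurable_approximable (B : set X) : measurable B -> approximable B.
Proof.
move: B; apply: smallest_sub.
  split; first by apply: (@approximable_cylindric 0).
    by move=> B aB; rewrite setTD; exact: approximableC.
  move=> F aF.
  have -> : \bigcup_k F k = \bigcup_n \big[setU/set0]_(k < n) F k.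
    rewrite seteqP; split=> w [k _].
      by move=> Fw; exists k.+1 => //; rewrite -bigcup_mkord; exists k => /=.
    by rewrite -bigcup_mkord => -[j _ Fw]; exists j.
  apply: approximable_increasing; last first.
    by move=> n m nm; apply/subsetPset; exact: subset_bigsetU.
  move=> n; elim/big_ind: _ => // [|B B']; last exact: approximableU.
  by apply: (@approximable_cylindric 0).
move=> B /open_bigcup_cylindric[F [cF Fle ->]].
by apply: approximable_increasing => // n; exact: approximable_cylindric (cF n).
Qed.

(** Each cell is approximated by a cylindric set; a label whose cylindric set
    contains the code is the right one off the union of the symmetric
    differences. *)
Lemma approx_finite_map k (f : X -> 'I_k) (e : R) : finite_map f -> 0 < e ->
  exists n (f' : X -> 'I_k), (forall w w', agree n w w' -> f' w = f' w') /\
    pr M [set w | f w != f' w] <= e.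
Proof.
move=> mf e0.
have ke0 : 0 < e / k.+1%:R by rewrite divr_gt0.
have /choice[n nP] (c : 'I_k) : exists n, exists C : set X, cylindric n C /\
    pr M (symdiff (f @^-1` [set c]) C) < e / k.+1%:R.
  by have [_ /(_ _ ke0)] := measurable_approximable (mf c).
have {nP} /choice[C CP] := nP.
pose N := (\max_(c < k) n c)%N.
have cC c : cylindric N (C c).
  by have [cc _] := CP c; apply: cylindric_le cc; exact: leq_bigmax.
pose f' (w : X) := odflt (f (fun=> point)) [pick c | `[< C c w >]].
have f'N w w' : agree N w w' -> f' w = f' w'.
  move=> ww'; rewrite /f'; congr odflt; apply: eq_pick => c /=.
  by apply/asboolP/asboolP; apply: (cC c) => //; exact: agree_sym.
have mf' : finite_map f'.
  move=> c; apply: (@measurable_cylindric _ _ N) => w w' ww' /= <-.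
  by apply/esym/f'N.
exists N, f'; split=> //.
have mS c : measurable (symdiff (f @^-1` [set c]) (C c)).
  apply: measurable_symdiff; first exact: mf.
  exact: measurable_cylindric (cC c).
have sub : [set w | f w != f' w] `<=` \big[setU/set0]_(c < k) symdiff (f @^-1` [set c]) (C c).
  move=> w /= ne; apply: contrapT => nS.
  have CE c : C c w <-> f w = c.
    apply: contrapT => nCE; apply: nS; rewrite (bigD1 c)//=; left.
    have [Cw|nCw] := pselect (C c w).
      by right; split=> // fw; apply: nCE.
    left; split=> //=; apply: contrapT => nfw; apply: nCE.
    by split.
  move: ne; rewrite /f'; case: pickP => [c /asboolP/CE -> |/(_ (f w))]; first by rewrite eqxx.
  by move=> /asboolP; case; apply/CE.
have bnd (s : seq 'I_k) : measurable (\big[setU/set0]_(c <- s) symdiff (f @^-1` [set c]) (C c)) /\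
    pr M (\big[setU/set0]_(c <- s) symdiff (f @^-1` [set c]) (C c)) <=
    (size s)%:R * (e / k.+1%:R).
  elim: s => [|c s [ms IHs]]; first by rewrite big_nil /pr measure0 mul0r.
  rewrite big_cons; split; first exact: measurableU.
  apply: le_trans (prU_le _ _ _) _ => //.
  by rewrite /= -natr1 mulrDl mul1r addrC lerD// ltW//; case: (CP c).
have := bnd (enum 'I_k); rewrite big_enum/= size_enum_ord => -[mb prb].
have mne : measurable [set w | f w != f' w].
  have [m _] := pr_preimage M (fun c : 'I_k * 'I_k => c.1 != c.2) (finite_map_pair mf mf').
  by congr measurable: m.
apply: le_trans (le_pr M mne mb sub) _; apply: le_trans prb _.
rewrite mulrCA ger_pMr// ler_pdivrMr// mul1r ler_nat//.
Qed.

Definition extend n (w : {ffun 'I_n -> A}) : X :=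
  fun i => if insub i is Some j then w j else point.

Lemma extend_agree n (w : X) : agree n w (extend [ffun i : 'I_n => w i]).
Proof. by move=> i ilt; rewrite /extend insubT ffunE. Qed.

Hypothesis M_inv : invariant_measure (@Defs.shift A) M.

Lemma finite_map_iter (C : finType) (F : X -> C) i : finite_map F ->
  finite_map (F \o iter i (@Defs.shift A)).
Proof.
move=> mF; elim: i => [//|i IHi] c.
have := @measurable_shift T E measurableT _ (IHi c); rewrite setTI.
by congr measurable; rewrite seteqP; split=> w /=; rewrite -iterSr.
Qed.

Lemma law_iter (C : finType) (F : X -> C) i : finite_map F ->
  law M (F \o iter i (@Defs.shift A)) = law M F.
Proof.
move=> mF; elim: i => [//|i IHi].
rewrite -IHi; apply/funext => c; rewrite /law /pr.
have <- := M_inv (finite_map_iter i mF c).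
congr (fine (M _)); rewrite seteqP; split=> w /=; by rewrite -iterSr.
Qed.

(** The Kolmogorov-Sinai bound.  The joint law of the [f]-itinerary and of the
    word read along it is compared, by Gibbs' inequality, with the law that
    draws the letters independently and lets the [f]-label be, at each step,
    the approximation [f'] with probability [1 - t]. *)
Lemma shannon_itinerary_le k (f : X -> 'I_k) n N (f' : X -> 'I_k) (t e : R) :
  finite_map f -> (forall w w', agree N w w' -> f' w = f' w') ->
  0 < t < 1 -> pr M [set w | f w != f' w] <= e ->
  shannon (law M (itinerary (@Defs.shift A) f n)) <=
    (n + N)%:R * shannon (law M (fun w : X => w 0%N)) +
    n%:R * (- ln (1 - t) - e * ln (t / k%:R)).
Proof.
move=> mf f'N /andP[t0 t1] fe.
have k0 : (0 < k)%N by case: (k) (f (fun=> point)) => // -[].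
have kR : 0 < k%:R :> R by rewrite ltr0n.
have t1' : 0 < 1 - t by rewrite subr_gt0.
have mf' : finite_map f'.
  move=> c; apply: (@measurable_cylindric _ _ N) => w w' ww' /= <-.
  by apply/esym/f'N.
have mletter := @finite_map_letter T E.
pose q := law M (fun w : X => w 0%N).
have sq : stochastic q by exact: stochastic_law.
pose W (w : X) := [ffun i : 'I_(n + N) => w (i : nat)] : {ffun 'I_(n + N) -> A}.
pose F (w : X) := itinerary (@Defs.shift A) f n w.
pose r (c c' : 'I_k) : R := if c == c' then 1 - t else t / k%:R.
have r0 c c' : 0 < r c c' by rewrite /r; case: ifP => _; rewrite ?divr_gt0.
have mW : finite_map W by apply: finite_map_ffun => i; exact: mletter.
have mF : finite_map F.
  by apply: finite_map_ffun => i; exact: finite_map_iter.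
have mJ : finite_map (fun w => (F w, W w)) by exact: finite_map_pair.
pose g (i : nat) (w : {ffun 'I_(n + N) -> A}) := f' (iter i (@Defs.shift A) (extend w)).
(* The product law of the comparison; it uses the letters at the positions below
   [n + N], which determine the values of [f'] along the first [n] shifts. *)
pose Q (x : {ffun 'I_n -> 'I_k} * {ffun 'I_(n + N) -> A}) : R :=
  (\prod_i r (x.1 i) (g i x.2)) * \prod_i q (x.2 i).
have gW (i : 'I_n) w : g i (W w) = f' (iter i (@Defs.shift A) w).
  apply: f'N => j jN; rewrite !shift_iterE.
  have /agree_sym := @extend_agree (n + N) w; apply.
  by have := ltn_ord i; lia.
have q_gt0 x : 0 < law M (fun w => (F w, W w)) x -> forall i, 0 < q (x.2 i).
  move=> x0 i; apply: lt_le_trans x0 _.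
  rewrite /q -(law_iter i (mletter 0%N)) /law; apply: le_pr => //.
    exact: finite_map_iter.
  by move=> w /= <-; rewrite shift_iterE ffunE.
have Q_sum : \sum_x Q x <= 1.
  rewrite -(pair_bigA _ (fun c w => Q (c, w)))/= exchange_big/=.
  apply: (@le_trans _ _ (\sum_(w : {ffun 'I_(n + N) -> A}) \prod_i q (w i))); last first.
    by rewrite -(bigA_distr_bigA (fun (_ : 'I_(n + N)) a => q a)) big1// => i _; exact: (proj2 sq).
  apply: ler_sum => w _; rewrite /Q/= -mulr_suml ler_piMl//.
    by apply: prodr_ge0 => i _; exact: (proj1 sq).
  rewrite -(bigA_distr_bigA (fun (i : 'I_n) c => r c (g i w))).
  apply: prodr_ile1 => i _; apply/andP; split.
    by apply: sumr_ge0 => c _; exact: ltW.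
  have tot : \sum_(c : 'I_k) t / k%:R = t.
    by rewrite sumr_const card_ord -[_ *+ _]mulr_natl mulrC divfK ?gt_eqF.
  rewrite (bigD1 (g i w))//= in tot; rewrite (bigD1 (g i w))//= {1}/r eqxx.
  have : \sum_(c | c != g i w) r c (g i w) <= \sum_(c | c != g i w) t / k%:R.
    by apply: ler_sum => c /negbTE cg; rewrite /r cg.
  by have := divr_gt0 t0 kR; lra.
have Q_ge0 x : 0 <= Q x.
  apply: mulr_ge0; apply: prodr_ge0 => i _; first exact: ltW.
  exact: (proj1 sq).
have sJ : stochastic (law M (fun w => (F w, W w))) by exact: stochastic_law.
have FJ : law M F = image_law fst (law M (fun w => (F w, W w))).
  by rewrite -(law_comp M fst mJ).
rewrite -/(F) FJ; apply: le_trans (shannon_image_law fst sJ) _.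
apply: le_trans (gibbs sJ Q_ge0 Q_sum _) _.
  move=> x x0; apply: mulr_gt0; apply: prodr_gt0 => // i _.
  exact: q_gt0 x0 i.
have split_ln x : law M (fun w => (F w, W w)) x * ln (Q x) =
   \sum_i law M (fun w => (F w, W w)) x * ln (r (x.1 i) (g i x.2)) +
   \sum_i law M (fun w => (F w, W w)) x * ln (q (x.2 i)).
  have [x0|x0] := ltP 0 (law M (fun w => (F w, W w)) x); last first.
    have -> : law M (fun w => (F w, W w)) x = 0.
      by apply/eqP; rewrite eq_le x0 (proj1 sJ).
    by rewrite !big1 ?addr0 ?mul0r// => *; rewrite mul0r.
  rewrite -!mulr_sumr -mulrDr; congr (_ * _).
  have q0 := q_gt0 _ x0.
  by rewrite /Q lnM ?ln_prod// posrE; apply: prodr_gt0 => i _.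
rewrite (eq_bigr _ (fun x _ => split_ln x)) big_split/= opprD addrC lerD//.
- rewrite exchange_big/= -sumrN.
  have E1 (i : 'I_(n + N)) : - \sum_x law M (fun w => (F w, W w)) x * ln (q (x.2 i)) = shannon q.
    rewrite -(sum_image_law (fun x : {ffun 'I_n -> 'I_k} * {ffun 'I_(n + N) -> A} => x.2 i) _ (fun a => ln (q a))).
    rewrite -(law_comp M (fun x : {ffun 'I_n -> 'I_k} * {ffun 'I_(n + N) -> A} => x.2 i) mJ).
    rewrite (_ : _ \o _ = (fun w : X => w 0%N) \o iter i (@Defs.shift A)).
      by rewrite (law_iter i (mletter 0%N)).
    by apply/funext => w /=; rewrite shift_iterE ffunE.
  by under eq_bigr do rewrite E1; rewrite sumr_const card_ord -[_ *+ _]mulr_natl.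
- rewrite exchange_big/= -sumrN.
  have mff : finite_map (fun w => (f w, f' w)) by exact: finite_map_pair.
  have E2 (i : 'I_n) : - \sum_x law M (fun w => (F w, W w)) x * ln (r (x.1 i) (g i x.2)) <=
     - ln (1 - t) - e * ln (t / k%:R).
    rewrite -(sum_image_law (fun x : {ffun 'I_n -> 'I_k} * {ffun 'I_(n + N) -> A} => (x.1 i, g i x.2)) _ (fun c : 'I_k * 'I_k => ln (r c.1 c.2))).
    rewrite -(law_comp M (fun x : {ffun 'I_n -> 'I_k} * {ffun 'I_(n + N) -> A} => (x.1 i, g i x.2)) mJ).
    rewrite (_ : _ \o _ = (fun w => (f w, f' w)) \o iter i (@Defs.shift A)); last first.
      by apply/funext => w /=; rewrite gW ffunE.
    rewrite (law_iter i mff) (bigID (fun c : 'I_k * 'I_k => c.1 != c.2))/= opprD addrC lerD//.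
      rewrite -sumrN.
      apply: (@le_trans _ _ (\sum_(c : 'I_k * 'I_k) law M (fun w => (f w, f' w)) c * - ln (1 - t))).
        rewrite [leRHS](bigID (fun c : 'I_k * 'I_k => c.1 != c.2))/= ler_wpDl//.
          apply: sumr_ge0 => c _; rewrite mulr_ge0 ?pr_ge0// oppr_ge0 ln_le0//.
          by rewrite gerBl ltW.
        by apply: ler_sum => c /negPn cc; rewrite /r cc mulrN.
      by rewrite -mulr_suml (proj2 (stochastic_law M mff)) mul1r.
    rewrite (eq_bigr (fun c => law M (fun w => (f w, f' w)) c * ln (t / k%:R))).
      rewrite -mulr_suml -mulrN -[leRHS]mulrN; apply: ler_wpM2r.
        rewrite oppr_ge0 ln_le0// ler_pdivrMr// mul1r (le_trans (ltW t1))//.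
        by rewrite ler1n.
      have [_ <-] := pr_preimage M (fun c : 'I_k * 'I_k => c.1 != c.2) mff.
      exact: fe.
    by move=> c /negbTE cc; rewrite /r cc.
  apply: le_trans (_ : \sum_(i < n) (- ln (1 - t) - e * ln (t / k%:R)) <= _).
    exact: ler_sum.
  by rewrite sumr_const card_ord -[_ *+ _]mulr_natl.
Qed.

End approximation.

Lemma exists_pushforward (R : realType) (d d' : measure_display)
    (X : measurableType d) (Y : measurableType d') (m : probability X R)
    (g : X -> Y) : measurable_fun setT g ->
  exists M : probability Y R, (M : set Y -> \bar R) = pushforward m g.
Proof.
move=> mg; pose gm : {mfun X >-> Y} := mfun_Sub (mem_set mg).
by exists (distribution m gm).
Qed.

(** With [f'] a good cylinder approximation of [f], the per-letter error of
    [shannon_itinerary_le] is as small as desired, and the [N] extra letters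
    contribute nothing in the limit. *)
Lemma ks_entropy_le (R : realType) (T : finType) (E : neset T)
    (M : probability (seqspace (alphabet E)) R) :
  invariant_measure (@Defs.shift _) M ->
  (ks_entropy M (@Defs.shift _) <=
    (shannon (law M (fun w : seqspace (alphabet E) => w 0%N)))%:E)%E.
Proof.
move=> M_inv; apply: ub_ereal_sup => _ [k [f [mf ->]]]; rewrite lee_fin.
set h := shannon _.
have h0 : 0 <= h.
  by apply/shannon_ge0/stochastic_law; exact: finite_map_letter.
have k0 : (0 < k)%N by case: (k) (f (fun=> point)) => // -[].
have kR : 0 < k%:R :> R by rewrite ltr0n.
rewrite /entropy_wrt; set u := fun n => _.
have [cu|/dvgP->//] := pselect (cvgn u).
apply/ler_addgt0Pr => d d0.
have d3 : 0 < d / 3 by rewrite divr_gt0.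
(* The three parts of the error - [- ln (1 - t)], the misclassified points, and
   the [N] extra letters - receive [d / 3] each. *)
pose t := 1 - expR (- (d / 3)).
have t0 : 0 < t by rewrite subr_gt0 expR_lt1 oppr_lt0.
have t1 : t < 1 by rewrite gtrBl expR_gt0.
have lnt : - ln (1 - t) = d / 3 by rewrite /t opprB addrC subrK expRK opprK.
pose s := 1 - ln (t / k%:R).
have tk : t / k%:R <= 1.
  by rewrite ler_pdivrMr// mul1r (le_trans (ltW t1))// ler1n.
have s0 : 0 < s by rewrite subr_gt0 (le_lt_trans (ln_le0 tk)).
pose e := d / 3 / s.
have e0 : 0 < e by rewrite divr_gt0.
have es : - (e * ln (t / k%:R)) <= d / 3.
  have <- : e * s = d / 3 by rewrite /e divfK// gt_eqF.
  by rewrite -mulrN ler_pM2l// /s lerDr.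
have [N [f' [f'N fe]]] := approx_finite_map M mf e0.
apply: limr_le => //.
have [n0 _ n0P] : \forall n \near \oo, N%:R * h / (d / 3) <= n%:R :> R.
  exact: nbhs_infty_ger.
exists (maxn 1 n0) => // n /=; rewrite geq_max => /andP[n_gt0 nn0].
have nR : 0 < n%:R :> R by rewrite ltr0n.
have le := @shannon_itinerary_le R T E M M_inv k f n N f' t e mf f'N.
have {}le := le (introT andP (conj t0 t1)) fe.
have := n0P n nn0; rewrite /= ler_pdivrMr// => Nh.
rewrite /u ler_pdivrMr//; apply: le_trans le _; rewrite lnt -/h natrD.
have : n%:R * (- (e * ln (t / k%:R))) <= n%:R * (d / 3) by rewrite ler_pM2l.
nra.
Qed.

(** * Bernoulli measures *)

Section interval_coding.
Context (R : realType) (T : finType) (E : neset T).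
Notation A := (alphabet E).
Notation X := (seqspace A).
Context (q : A -> R) (sq : stochastic q).

(** A point of the unit interval is coded by the consecutive intervals of lengths
    [q i] visited by its orbit under the map that expands each of them onto the
    unit interval: when the point is uniform, these letters are independent. *)
Let cumul (k : nat) : R := \sum_(j : A | (enum_rank j < k)%N) q j.
Let left_end (i : A) : R := cumul (enum_rank i).

Let q0 i : 0 <= q i. Proof. exact: (proj1 sq). Qed.

Let cumulS (i : A) : cumul (enum_rank i).+1 = left_end i + q i.
Proof.
rewrite /cumul (bigD1 i)//= addrC; congr (_ + _); apply: eq_bigl => j.
rewrite ltnS ltn_neqAle andbC; congr (_ && _).
by rewrite (inj_eq val_inj) (inj_eq enum_rank_inj).
Qed.

Let cumul_le k l : (k <= l)%N -> cumul k <= cumul l.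
Proof.
move=> kl; rewrite /cumul [leRHS](bigID (fun j : A => enum_rank j < k)%N)/=.
rewrite [X in _ <= X + _](eq_bigl (fun j : A => enum_rank j < k)%N) => [|j].
  by rewrite lerDl sumr_ge0.
by apply/andP/idP => [[]//|jk]; rewrite jk (leq_trans jk kl).
Qed.

Let cumul0 : cumul 0 = 0. Proof. by rewrite /cumul big_pred0. Qed.

Let cumul_card : cumul #|{: A}| = 1.
Proof. by rewrite -(proj2 sq); apply: eq_bigl => j; rewrite ltn_ord. Qed.

Let inside (i : A) (x : R) : bool := left_end i <= x < left_end i + q i.

Let insideP (x : R) : 0 <= x < 1 -> exists i, inside i x.
Proof.
move=> /andP[x0 x1].
have ex : exists k, x < cumul k by exists #|{: A}|; rewrite cumul_card.
case: (ex_minnP ex) => [[|k] xk mk]; first by move: xk; rewrite cumul0 ltNge x0.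
have kA : (k < #|{: A}|)%N by apply: mk; rewrite cumul_card.
exists (enum_val (Ordinal kA)); rewrite /inside -cumulS /left_end enum_valK/= xk andbT.
by rewrite leNgt; apply/negP => /mk; rewrite ltnn.
Qed.

Let inside_inj (x : R) i j : inside i x -> inside j x -> i = j.
Proof.
wlog ij : i j / (enum_rank i <= enum_rank j)%N.
  by move=> W; case/orP: (leq_total (enum_rank i) (enum_rank j)) => /W // H *; exact/esym/H.
move=> /andP[_ xi] /andP[xj _]; apply/enum_rank_inj/val_inj/eqP.
move: ij; rewrite leq_eqVlt => /orP[//|ij].
have := cumul_le ij; rewrite cumulS => /(lt_le_trans xi)/lt_le_trans/(_ xj).
by rewrite ltxx.
Qed.

Let dgt (x : R) : A := odflt point [pick i | inside i x].

Let dgtE x i : inside i x -> dgt x = i.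
Proof.
move=> ix; rewrite /dgt; case: pickP => [j jx|/(_ i)]; last by rewrite ix.
exact: inside_inj jx ix.
Qed.

Let blowup (x : R) : R := (x - left_end (dgt x)) / q (dgt x).

Let dgt_cyl n (u : nat -> A) : exists l, [/\ 0 <= l, l + \prod_(i < n) q (u i) <= 1 &
  [set x : R | 0 <= x < 1 /\ forall i, (i < n)%N -> dgt (iter i blowup x) = u i] =
  `[l, l + \prod_(i < n) q (u i)[%classic].
Proof.
elim: n u => [|n IHn] u.
  exists 0; rewrite big_ord0 add0r; split=> //.
  by rewrite seteqP; split=> x /=; rewrite in_itv/= => // -[].
have [l [l0 l1 lE]] := IHn (fun i => u i.+1).
rewrite big_ord_recl/=; set P := \prod_(i < n) _ in l1 lE *.
have P0 : 0 <= P by apply: prodr_ge0.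
have le0 : 0 <= left_end (u 0%N) by apply: sumr_ge0.
have le1 : left_end (u 0%N) + q (u 0%N) <= 1.
  by rewrite -cumulS -cumul_card cumul_le.
have step x : (0 <= x < 1 /\ forall i, (i < n.+1)%N -> dgt (iter i blowup x) = u i) <->
    inside (u 0%N) x /\ l <= (x - left_end (u 0%N)) / q (u 0%N) < l + P.
  split=> [[x01 xu]|[xin xl]].
    have [i ix] := insideP x01; have := xu 0%N isT; rewrite /= (dgtE ix) => iu.
    rewrite {i}iu in ix; split=> //.
    have : [set x : R | 0 <= x < 1 /\ forall i, (i < n)%N -> dgt (iter i blowup x) = u i.+1] (blowup x).
      split=> [|i ilt]; last by rewrite -iterSr; apply: xu.
      rewrite /blowup (dgtE ix); case/andP: ix => ix1 ix2.
      have qu : 0 < q (u 0%N) by have := le_lt_trans ix1 ix2; rewrite ltrDl.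
      by rewrite divr_ge0 ?subr_ge0// ltr_pdivrMr// mul1r ltrBlDl.
    by rewrite lE /= in_itv/= /blowup (dgtE ix).
  case/andP: (xin) => ix1 ix2; split.
    by rewrite (le_trans le0 ix1) (lt_le_trans ix2 le1).
  move=> [|i] ilt; first exact: dgtE.
  rewrite iterSr; have : `[l, l + P[%classic (blowup x).
    by rewrite /= in_itv/= /blowup (dgtE xin).
  by rewrite -lE => -[_]; apply.
have [qu|qu] := eqVneq (q (u 0%N)) 0.
  exists (left_end (u 0%N)); rewrite qu mul0r addr0; split=> //.
    by move: le1; rewrite qu addr0.
  rewrite seteqP; split=> x /=.
    by move=> /step[/andP[h1]]; rewrite qu addr0 ltNge h1.
  by rewrite in_itv/= => /andP[h1]; rewrite ltNge h1.
have {}qu : 0 < q (u 0%N) by rewrite lt_neqAle eq_sym qu q0.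
exists (left_end (u 0%N) + q (u 0%N) * l); split.
- by rewrite addr_ge0// mulr_ge0.
- rewrite -addrA -mulrDr; apply: le_trans le1; rewrite lerD2l ger_pMr//.
rewrite seteqP; split=> x /=.
  move=> /step[_]; rewrite in_itv/= ler_pdivlMr// ltr_pdivrMr//; lra.
rewrite in_itv/= => /andP[h1 h2]; apply/step.
have a1 : 0 <= q (u 0%N) * l by rewrite mulr_ge0.
have a2 : q (u 0%N) * (l + P) <= q (u 0%N) by rewrite ger_pMr.
split; first by rewrite /inside; apply/andP; split; lra.
by rewrite ler_pdivlMr// ltr_pdivrMr//; apply/andP; split; lra.
Qed.

Let finite_map_inside i : finite_map (fun x : R => inside i x).
Proof.
have mi : measurable [set x | inside i x].
  have -> : [set x | inside i x] = `[left_end i, left_end i + q i[%classic.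
    by apply/seteqP; split=> x /=; rewrite in_itv.
  exact: measurable_itv.
case.
  have -> : (fun x : R => inside i x) @^-1` [set true] = [set x | inside i x] by [].
  exact: mi.
have -> : (fun x : R => inside i x) @^-1` [set false] = ~` [set x | inside i x].
  by apply/seteqP; split=> x /= => [->|/negP/negbTE].
exact: measurableC.
Qed.

Let finite_map_dgt : finite_map dgt.
Proof.
pose phi (c : {ffun A -> bool}) : A := odflt point [pick i | c i].
rewrite (_ : dgt = phi \o fun x => [ffun i => inside i x]).
  apply: finite_map_comp.
  exact: (@finite_map_ffun _ _ _ _ inside finite_map_inside).
apply/funext => x; rewrite /dgt /phi/=; congr odflt; apply: eq_pick => i.
by rewrite /= ffunE.
Qed.

Let measurable_blowup : measurable_fun setT blowup.
Proof.
move=> _ B mB; rewrite setTI.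
rewrite (_ : _ @^-1` _ = \bigcup_(c in [set: A])
    (dgt @^-1` [set c] `&` (fun x => (x - left_end c) / q c) @^-1` B)).
  apply: fin_bigcup_measurable => // c _; apply: measurableI; first exact: finite_map_dgt.
  rewrite -[X in measurable X]setTI; apply: (_ : measurable_fun setT _) => //.
  by apply: measurable_realfun.measurable_funM => //; apply: measurable_realfun.measurable_funB.
rewrite seteqP; split=> x /=; first by move=> Bx; exists (dgt x).
by move=> [c _ [/= <-]].
Qed.

Let coded (x : R) : X := fun i => dgt (iter i blowup x).

Let measurable_iter i : measurable_fun setT (iter i blowup).
Proof.
elim: i => [|i IHi]; first exact: measurable_id.
exact: (measurableT_comp measurable_blowup IHi).
Qed.

Let measurable_coded : measurable_fun setT coded.
Proof.
apply: measurable_to_seqspace => i c.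
have := measurable_iter i measurableT (finite_map_dgt c); rewrite setTI.
by [].
Qed.

Lemma exists_bernoulli : exists M : probability X R, forall n (u : nat -> A),
  pr M [set w | agree n w u] = \prod_(i < n) q (u i).
Proof.
pose U := [the probability _ R of uniform_prob (@ltr01 R)].
have [M ME] := exists_pushforward U measurable_coded.
have UI (l p : R) : 0 <= l -> 0 <= p -> l + p <= 1 -> U `[l, l + p[%classic = p%:E.
  move=> l0 p0 lp; rewrite /U/= /uniform_prob.
  rewrite (eq_integral (fun=> 1%E)).
    rewrite integral_cst//= mul1e lebesgue_measure_itv/= lte_fin.
    rewrite ltrDl; case: ltP => [_|p0']; first by rewrite -EFinB addrAC subrr add0r.
    by congr (_%:E); apply/eqP; rewrite eq_le p0 p0'.
  move=> x; rewrite inE/= in_itv/= /uniform_pdf => /andP[lx xp].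
  by rewrite (le_trans l0 lx) (le_trans (ltW xp) lp) subr0 invr1.
exists M => n u.
have mC : measurable [set w : X | agree n w u].
  by apply: (@measurable_cylindric _ _ n) => w w' ww' wu i ilt; rewrite -ww'// wu.
have [l [l0 l1 lE]] := dgt_cyl n u.
have -> : pr M [set w | agree n w u] = pr U (coded @^-1` [set w | agree n w u]).
  by rewrite /pr ME.
have mJ : measurable (`[0, 1[%classic : set R) by [].
have mB : measurable (coded @^-1` [set w | agree n w u]).
  by have := measurable_coded measurableT mC; rewrite setTI.
have J1 : U `[0, 1[%classic = 1%E by have := UI 0 1; rewrite add0r; apply.
have -> : pr U (coded @^-1` [set w | agree n w u]) =
    pr U (coded @^-1` [set w | agree n w u] `&` `[0, 1[%classic).
  by apply: pr_full; [exact: mJ | exact: mB | rewrite /pr J1].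
rewrite (_ : _ `&` _ = `[l, l + \prod_(i < n) q (u i)[%classic).
  by rewrite /pr UI// prodr_ge0.
rewrite -lE seteqP; split=> x /=; rewrite in_itv/=.
  by move=> [xu x01]; split.
by move=> [x01 xu]; split.
Qed.

End interval_coding.

Section product_entropy.
Context (R : realType).

Lemma shannon_product (C : finType) (q : C -> R) n : stochastic q ->
  shannon (fun c : {ffun 'I_n -> C} => \prod_i q (c i)) = n%:R * shannon q.
Proof.
move=> [q0 q1].
pose prod_q (c : {ffun 'I_n -> C}) := \prod_i q (c i).
have termE (c : {ffun 'I_n -> C}) : prod_q c * ln (prod_q c) = \sum_i prod_q c * ln (q (c i)).
  have [/existsP[i /eqP ci]|/existsPn nz] := boolP [exists i, q (c i) == 0].
    have -> : prod_q c = 0 by rewrite /prod_q (bigD1 i)//= ci mul0r.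
    by rewrite mul0r big1// => *; rewrite mul0r.
  rewrite -mulr_sumr {2}/prod_q ln_prod// => i _.
  by rewrite lt_neqAle eq_sym nz q0.
have marg (i : 'I_n) : \sum_c prod_q c * ln (q (c i)) = \sum_a q a * ln (q a).
  pose F (j : 'I_n) a := q a * (if j == i then ln (q a) else 1).
  have := @bigA_distr_bigA R 0 1 *%R +%R _ _ F; rewrite (bigD1 i)//= [X in _ * X]big1 => [|j /negbTE ji].
    rewrite mulr1 /F eqxx => ->; apply: eq_bigr => c _.
    rewrite big_split/=; congr (_ * _).
    by rewrite (bigD1 i)//= eqxx big1 ?mulr1// => j /negbTE ->.
  by rewrite /F ji -[RHS]q1; apply: eq_bigr => a _; rewrite mulr1.
rewrite /shannon (eq_bigr _ (fun c _ => termE c)) exchange_big/=.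
under eq_bigr do rewrite marg.
by rewrite sumr_const card_ord -[_ *+ _]mulr_natl mulrN.
Qed.

Lemma shannon_image_inj (C B : finType) (h : C -> B) (q : C -> R) :
  injective h -> shannon (image_law h q) = shannon q.
Proof.
move=> hI; rewrite /shannon sum_image_law; congr (- _); apply: eq_bigr => c _.
congr (_ * ln _); rewrite /image_law (bigD1 c)//= big1 ?addr0// => c'.
by move=> /andP[/eqP/hI ->]; rewrite eqxx.
Qed.

End product_entropy.

Lemma pushforward_invariant (R : realType) (d d' : measure_display)
    (X : measurableType d) (Y : measurableType d') (m : probability X R)
    (M : probability Y R) (g : X -> Y) (SX : X -> X) (SY : Y -> Y) :
  measurable_fun setT g -> measurable_fun setT SY -> (forall x, g (SX x) = SY (g x)) ->
  (M : set Y -> \bar R) = pushforward m g ->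
  invariant_measure SX m -> invariant_measure SY M.
Proof.
move=> mg mSY gS ME inv B mB; rewrite /pushforward ME /pushforward.
have mB' : measurable (g @^-1` B) by have := mg measurableT _ mB; rewrite setTI.
rewrite -[RHS](inv _ mB') /pushforward; congr (m _).
by apply/seteqP; split=> x /=; rewrite gS.
Qed.

Section bernoulli_measures.
Context (R : realType) (T : finType) (E : neset T).
Notation A := (alphabet E).
Notation X := (seqspace A).
Implicit Types (M : probability X R) (q : A -> R).

Definition bernoulli_law q M : Prop := forall n (u : nat -> A),
  pr M [set w | agree n w u] = \prod_(i < n) q (u i).

Definition word n (w : X) : {ffun 'I_n -> A} := [ffun i : 'I_n => w i].

Lemma finite_map_word n : finite_map (word n).
Proof. by apply: finite_map_ffun => i; exact: finite_map_letter. Qed.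

Lemma word_preimage n (c : {ffun 'I_n -> A}) :
  word n @^-1` [set c] = [set w | agree n w (extend c)].
Proof.
apply/seteqP; split=> w /=.
  by move=> <- i ilt; rewrite /extend insubT ffunE.
by move=> h; apply/ffunP => i; rewrite ffunE h// /extend valK.
Qed.

Lemma law_word q M n (c : {ffun 'I_n -> A}) : bernoulli_law q M ->
  law M (word n) c = \prod_i q (c i).
Proof.
move=> bM; rewrite /law word_preimage bM; apply: eq_bigr => i _.
by rewrite /extend valK.
Qed.

Lemma law_letter0 q M : bernoulli_law q M -> law M (fun w : X => w 0%N) = q.
Proof.
move=> bM; apply/funext => a; have := bM 1%N (fun=> a); rewrite big_ord1 => <-.
by congr pr; apply/seteqP; split=> w /= h; [case|exact: h].
Qed.

Lemma eq_on_cylinders M M' :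
  (forall n u, pr M [set w | agree n w u] = pr M' [set w | agree n w u]) ->
  forall B, measurable B -> M B = M' B.
Proof.
move=> eqM.
have mG : @measurable _ X = <<s [set B : set X | exists n, cylindric n B] >>.
  rewrite eqEsubset; split.
    apply: smallest_sub; first exact: smallest_sigma_algebra.
    move=> B /open_bigcup_cylindric[F [cF _ ->]].
    have [_ _] := @smallest_sigma_algebra X setT [set B : set X | exists n, cylindric n B].
    by apply => n; apply: sub_sigma_algebra; exists n.
  apply: smallest_sub; first exact: sigma_algebra_measurable.
  by move=> B [n cB]; exact: measurable_cylindric cB.
apply: (@measure_unique _ R X _ (fun=> setT) mG) => //.
- move=> B C [n cB] [m cC]; exists (maxn n m) => w w' ww' [Bw Cw]; split.
    by apply: cB Bw; apply: agree_le ww'; exact: leq_maxl.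
  by apply: cC Cw; apply: agree_le ww'; exact: leq_maxr.
- by move=> _; exists 0%N.
- by apply/seteqP; split=> // w _; exists 0%N.
- move=> B [n cB].
  have mB := measurable_cylindric cB.
  suff : pr M B = pr M' B by move=> eq; apply: etrans (prE M mB) _; rewrite eq; exact/esym/prE.
  pose P (c : {ffun 'I_n -> A}) : bool := `[< B (extend c) >].
  have -> : B = word n @^-1` [set c | P c].
    apply/seteqP; split=> w /= Bw; first by apply/asboolP; apply: cB Bw; exact: extend_agree.
    by move/asboolP: Bw; apply: cB; apply: agree_sym; exact: extend_agree.
  have [_ ->] := @pr_preimage _ _ _ M _ (@word n) P (@finite_map_word n).
  have [_ ->] := @pr_preimage _ _ _ M' _ (@word n) P (@finite_map_word n).
  by apply: eq_bigr => c _; rewrite /law word_preimage.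
- by move=> _; apply: le_lt_trans (probability_le1 _ _) _; rewrite ?ltry.
Qed.

Lemma bernoulli_invariant q M : stochastic q -> bernoulli_law q M ->
  invariant_measure (@Defs.shift A) M.
Proof.
move=> sq bM.
have [M' M'E] := exists_pushforward M (@measurable_shift T E).
move=> B mB; rewrite -M'E; apply: eq_on_cylinders => // n u.
pose P (c : {ffun 'I_n.+1 -> A}) := [forall i : 'I_n, c (lift ord0 i) == u i].
have -> : pr M' [set w | agree n w u] = pr M (word n.+1 @^-1` [set c | P c]).
  rewrite /pr M'E /pushforward; congr (fine (M _)); apply/seteqP; split=> w /= wu.
    by apply/forallP => i; rewrite ffunE/= -wu.
  move=> i ilt; have /forallP/(_ (Ordinal ilt)) := wu.
  by rewrite ffunE/= => /eqP.
have [_ ->] := @pr_preimage _ _ _ M _ (@word n.+1) P (@finite_map_word n.+1).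
rewrite bM; under eq_bigr do rewrite (law_word _ bM).
pose Q (i : 'I_n.+1) a := if unlift ord0 i is Some j then a == u j else true.
have Q0 : \sum_(a | Q ord0 a) q a = 1.
  by rewrite -(proj2 sq); apply: eq_bigl => a; rewrite /Q unlift_none.
have QS (i : 'I_n) : \sum_(a | Q (lift ord0 i) a) q a = q (u i).
  by rewrite /Q liftK (big_pred1 (u i)).
transitivity (\prod_(i < n.+1) \sum_(a | Q i a) q a); last first.
  by rewrite big_ord_recl Q0 mul1r; apply: eq_bigr => i _; rewrite QS.
rewrite (@big_distr_big_dep R 0 1 *%R +%R _ _ (point : A) xpredT Q (fun=> q)).
apply: eq_bigl => c; apply/forallP/familyP => [h i|h i].
  rewrite unfold_in /= /Q; case: unliftP => [j ->|->]//; exact: h.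
by have := h (lift ord0 i); rewrite unfold_in /= /Q liftK.
Qed.

Lemma bernoulli_pushforward (T' : finType) (E' : neset T') q M
    (g : A -> alphabet E') (M' : probability (seqspace (alphabet E')) R) :
  stochastic q -> bernoulli_law q M ->
  (M' : set _ -> \bar R) = pushforward M (fun w : X => (fun n => g (w n)) : seqspace (alphabet E')) ->
  forall n (u : nat -> alphabet E'), pr M' [set w | agree n w u] =
    \prod_(i < n) image_law g q (u i).
Proof.
move=> sq bM M'E n u.
pose P (c : {ffun 'I_n -> A}) := [forall i : 'I_n, g (c i) == u i].
have -> : pr M' [set w | agree n w u] = pr M (word n @^-1` [set c | P c]).
  rewrite /pr M'E /pushforward; congr (fine (M _)); apply/seteqP; split=> w /= wu.
    by apply/forallP => i; rewrite ffunE/= -wu.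
  move=> i ilt; have /forallP/(_ (Ordinal ilt)) := wu.
  by rewrite ffunE/= => /eqP.
have [_ ->] := @pr_preimage _ _ _ M _ (@word n) P (@finite_map_word n).
under eq_bigr do rewrite (law_word _ bM).
have -> := @big_distr_big_dep R 0 1 *%R +%R _ _ (point : A) xpredT
  (fun (i : 'I_n) a => g a == u i) (fun=> q).
apply: eq_bigl => c; apply/forallP/familyP => h i; first exact: h.
by have := h i; rewrite unfold_in.
Qed.

(** The entropy of the one-letter partition is already that of the letter law. *)
Lemma ks_entropy_bernoulli_ge q M : stochastic q -> bernoulli_law q M ->
  ((shannon q)%:E <= ks_entropy M (@Defs.shift A))%E.
Proof.
move=> sq bM; apply: ereal_sup_ubound.
pose f (w : X) : 'I_#|{: A}| := enum_rank (w 0%N).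
exists #|{: A}|, f; split.
  by apply: (@finite_map_comp _ _ _ _ (fun w : X => w 0%N) enum_rank); exact: finite_map_letter.
congr (_%:E); rewrite /entropy_wrt; apply/esym/cvg_lim => //.
apply: cvg_near_cst; exists 1%N => // n /= n0.
have nR : n%:R != 0 :> R by rewrite pnatr_eq0 -lt0n.
have -> : partition_entropy M (itinerary (@Defs.shift A) f n) =
    shannon (law M (itinerary (@Defs.shift A) f n)) by [].
pose h (c : {ffun 'I_n -> A}) : {ffun 'I_n -> 'I_#|{: A}|} := [ffun i => enum_rank (c i)].
have -> : itinerary (@Defs.shift A) f n = h \o word n.
  by apply/funext => w; apply/ffunP => i; rewrite !ffunE /f shift_iterE.
rewrite (@law_comp _ _ _ M _ _ (@word n) h (@finite_map_word n)) shannon_image_inj; last first.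
  move=> c c' /ffunP cc'; apply/ffunP => i; have := cc' i; rewrite !ffunE.
  exact: enum_rank_inj.
have -> : law M (word n) = (fun c => \prod_i q (c i)).
  by apply/funext => c; exact: law_word.
by rewrite shannon_product// mulrAC divff// mul1r.
Qed.

End bernoulli_measures.

(** * The conditional variational principle *)

Section variational_principle.
Context (R : realType) (d : nat) (a : 'I_d -> nat) (D : neset (digit a)).
Notation A := (alphabet D).
Context (v : A -> R) (alpha : R).

Definition tail_letter (m : nat) (i : A) : tail a m := Defs.eta m (sval i).

Definition on_slice (q : A -> R) : Prop := stochastic q /\ mean v q = alpha.

Definition slice_entropies (m : nat) : set R :=
  [set shannon (image_law (tail_letter m) q) | q in on_slice].

Definition max_entropy (m : nat) : R := sup (slice_entropies m).

Lemma has_ubound_slice_entropies m : has_ubound (slice_entropies m).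
Proof.
exists (ln #|{: tail a m}|%:R) => _ [q [sq _] <-].
exact/shannon_le_lncard/stochastic_image_law.
Qed.

Lemma max_entropy_ub m q : on_slice q ->
  shannon (image_law (tail_letter m) q) <= max_entropy m.
Proof.
by move=> sq; apply: (ub_le_sup (has_ubound_slice_entropies m)); exists q.
Qed.

Lemma max_entropy_adherent m e : (exists q, on_slice q) -> 0 < e ->
  exists2 q, on_slice q & max_entropy m - e < shannon (image_law (tail_letter m) q).
Proof.
move=> [q0 q0s] e0.
have hs : has_sup (slice_entropies m).
  split; last exact: has_ubound_slice_entropies.
  by exists (shannon (image_law (tail_letter m) q0)); exists q0.
by have [_ [q qs <-] lt] := sup_adherent e0 hs; exists q.
Qed.

Lemma max_entropy_ge0 m : (exists q, on_slice q) -> 0 <= max_entropy m.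
Proof.
move=> [q qs]; apply: le_trans (max_entropy_ub m qs).
by apply/shannon_ge0/stochastic_image_law; case: qs.
Qed.

Lemma max_entropy_decr m : (exists q, on_slice q) -> max_entropy m.+1 <= max_entropy m.
Proof.
move=> ex; apply/ler_addgt0Pr => e e0.
have [q qs] := max_entropy_adherent m.+1 ex e0; rewrite ltrBlDr => /ltW/le_trans; apply.
rewrite lerD2r; apply: le_trans (max_entropy_ub m qs).
pose g (t : tail a m) : tail a m.+1 :=
  [ffun q : {q : 'I_d | (m.+1 <= q)%N} => t (exist _ (val q) (ltnW (valP q)))].
have -> : image_law (tail_letter m.+1) q = image_law g (image_law (tail_letter m) q).
  apply/funext => t; rewrite image_law_comp; apply: eq_bigl => i.
  congr (_ == t); apply/ffunP => r; rewrite !ffunE /=.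
  by [].
by apply/shannon_image_law/stochastic_image_law; case: qs.
Qed.

Context (f : Sigma D -> R) (fE : forall w, f w = v (w 0%N)).

Lemma averages_slice : averages f alpha -> exists q, on_slice q.
Proof.
move=> [m [_ fa]]; exists (law m (fun w : Sigma D => w 0%N)); split.
  by apply: stochastic_law; exact: finite_map_letter.
apply: EFin_inj; rewrite -fa; apply/esym.
under eq_integral do rewrite fE.
by rewrite (integral_finite_map m v (finite_map_letter 0)).
Qed.

Definition chi_letter (m : nat) (i : A) : alphabet (imneset (@Defs.eta d a m) D) :=
  exist (fun t => t \in nesetval (imneset (@Defs.eta d a m) D))
    (Defs.eta m (sval i)) (imset_f (@Defs.eta d a m) (svalP i)).

Lemma measurable_chi m : measurable_fun setT (@chi d a D m).
Proof.
apply: measurable_to_seqspace => i.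
exact: (@finite_map_comp _ _ _ _ (fun w : Sigma D => w i) (chi_letter m) (finite_map_letter i)).
Qed.

Lemma shannon_chi_letter m (q : A -> R) :
  shannon (image_law (chi_letter m) q) = shannon (image_law (tail_letter m) q).
Proof.
have -> : image_law (tail_letter m) q = image_law sval (image_law (chi_letter m) q).
  by apply/funext => t; rewrite image_law_comp.
rewrite [RHS]shannon_image_inj// => -[t tP] [t' t'P] /= tt'; subst t'.
by congr exist; exact: bool_irrelevance.
Qed.

(** Among the invariant measures with a given letter law, the Bernoulli measure
    maximises the entropy of every projection. *)
Lemma H_max_entropy m : averages f alpha -> H_ m f alpha = (max_entropy m)%:E.
Proof.
move=> av; have ex := averages_slice av.
apply/eqP; rewrite eq_le; apply/andP; split.
  apply: ub_ereal_sup => _ [M [Minv Mf ->]].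
  have [M' M'E] := exists_pushforward M (@measurable_chi m).
  have M'inv : invariant_measure (@Defs.shift _) M'.
    apply: (pushforward_invariant (@measurable_chi m) _ _ M'E Minv) => //.
    exact: measurable_shift.
  rewrite -M'E; apply: le_trans (ks_entropy_le M'inv) _; rewrite lee_fin.
  pose q := law M (fun w : Sigma D => w 0%N).
  have qs : on_slice q.
    split; first by apply: stochastic_law; exact: finite_map_letter.
    apply: EFin_inj; rewrite -Mf; apply/esym.
    under eq_integral do rewrite fE.
    by rewrite (integral_finite_map M v (finite_map_letter 0)).
  apply: le_trans (max_entropy_ub m qs); rewrite -shannon_chi_letter.
  rewrite -(@law_comp _ _ _ M _ _ (fun w : Sigma D => w 0%N) (chi_letter m) (finite_map_letter 0)).
  rewrite le_eqVlt; apply/orP; left; apply/eqP; congr shannon.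
  by apply/funext => t; rewrite /law /pr M'E.
apply/lee_addgt0Pr => e e0.
have [q qs] := max_entropy_adherent m ex e0.
rewrite ltrBlDr => lt.
have [M bM] := exists_bernoulli (proj1 qs).
have [M' M'E] := exists_pushforward M (@measurable_chi m).
have bM' := bernoulli_pushforward (g := chi_letter m) (proj1 qs) bM M'E.
apply: (@le_trans _ _ ((shannon (image_law (chi_letter m) q))%:E + e%:E)%E).
  by rewrite -EFinD lee_fin shannon_chi_letter ltW.
rewrite leeD2r//.
apply: le_trans (ks_entropy_bernoulli_ge (stochastic_image_law _ (proj1 qs)) bM') _.
apply: ereal_sup_ubound; exists M; split; last by rewrite M'E.
  exact: (bernoulli_invariant (proj1 qs) bM).
under eq_integral do rewrite fE.
rewrite (integral_finite_map M v (finite_map_letter 0)) (law_letter0 bM).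
by rewrite -(proj2 qs).
Qed.

End variational_principle.

(** * The coding map *)

Section expansions.
Context (R : realType) (b : nat) (b_ge2 : (2 <= b)%N).
Implicit Types u : nat -> nat.

Definition partial_expansion u (N : nat) : R :=
  \sum_(0 <= n < N) (u n)%:R / b%:R ^+ n.+1.

Definition expansion u : R := limn (partial_expansion u).

Lemma base_gt0 : 0 < b%:R :> R.
Proof. by rewrite ltr0n (leq_trans _ b_ge2). Qed.

Lemma geometric_tail (e : nat -> R) L N : (forall n, `|e n| <= b%:R - 1) ->
  (L <= N)%N ->
  `|\sum_(L <= n < N) e n / b%:R ^+ n.+1| <= b%:R ^- L - b%:R ^- N.
Proof.
move=> eb LN; have b0 := base_gt0.
rewrite -(subnKC LN); elim: (N - L)%N => [|k IHk].
  by rewrite addn0 big_geq// normr0 subrr.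
rewrite addnS big_nat_recr ?leq_addr//=.
apply: le_trans (ler_normD _ _) _.
set n := (L + k)%N in IHk *.
have bn : 0 < b%:R ^+ n.+1 :> R by rewrite exprn_gt0.
have : `|e n / b%:R ^+ n.+1| <= b%:R ^- n - b%:R ^- n.+1.
  rewrite normrM normfV (gtr0_norm bn) ler_pdivrMr// mulrBl mulVf ?gt_eqF//.
  by rewrite exprS [b%:R * _]mulrC mulrA mulVf ?gt_eqF ?exprn_gt0// mul1r.
lra.
Qed.

Lemma geometric_tail_le (e : nat -> R) L N : (forall n, `|e n| <= b%:R - 1) ->
  `|\sum_(L <= n < N) e n / b%:R ^+ n.+1| <= b%:R ^- L.
Proof.
move=> eb; have [LN|NL] := leqP L N; last first.
  by rewrite big_geq ?(ltnW NL)// normr0 invr_ge0 exprn_ge0// ler0n.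
apply: le_trans (geometric_tail eb LN) _.
by rewrite gerBl invr_ge0 exprn_ge0// ler0n.
Qed.

Lemma digit_le u : (forall n, (u n < b)%N) -> forall n, `|(u n)%:R| <= b%:R - 1 :> R.
Proof.
move=> ub n; rewrite ger0_norm// -(natrB _ (ltnW b_ge2)) ler_nat.
by rewrite leq_subRL ?(ltnW b_ge2)// add1n.
Qed.

Lemma is_cvg_expansion u : (forall n, (u n < b)%N) -> cvgn (partial_expansion u).
Proof.
move=> ub; apply: nondecreasing_is_cvgn.
  apply/nondecreasing_seqP => n; rewrite /partial_expansion big_nat_recr//= lerDl.
  by rewrite divr_ge0// exprn_ge0.
exists 1 => _ [N _ <-]; apply: le_trans (ler_norm _) _.
by have := geometric_tail_le 0 N (digit_le ub); rewrite expr0 invr1.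
Qed.

Lemma digit_sub_le u u' : (forall n, (u n < b)%N) -> (forall n, (u' n < b)%N) ->
  forall n, `|(u n)%:R - (u' n)%:R| <= b%:R - 1 :> R.
Proof.
move=> ub ub' n; have h := digit_le ub n; have h' := digit_le ub' n.
rewrite ger0_norm// in h; rewrite ger0_norm// in h'; rewrite ler_norml.
by have := ler0n R (u n); have := ler0n R (u' n); move=> *; apply/andP; split; lra.
Qed.

Lemma cvg_expansion_sub u u' : (forall n, (u n < b)%N) -> (forall n, (u' n < b)%N) ->
  \sum_(0 <= n < N) ((u n)%:R - (u' n)%:R) / b%:R ^+ n.+1 @[N --> \oo] -->
  expansion u - expansion u'.
Proof.
move=> ub ub'; rewrite (_ : (fun N => _) = partial_expansion u \- partial_expansion u').
  by apply: cvgB; exact: is_cvg_expansion.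
apply/funext => N; rewrite /= /partial_expansion -sumrB.
by apply: eq_bigr => n _; rewrite mulrBl.
Qed.

Lemma expansion_close u u' L : (forall n, (u n < b)%N) -> (forall n, (u' n < b)%N) ->
  (forall n, (n < L)%N -> u n = u' n) ->
  `|expansion u - expansion u'| <= b%:R ^- L.
Proof.
move=> ub ub' uu'; have cv : `|\sum_(0 <= n < N) ((u n)%:R - (u' n)%:R) / b%:R ^+ n.+1| @[N --> \oo] -->
    `|expansion u - expansion u'|.
  by apply: cvg_norm; exact: cvg_expansion_sub.
apply: (cvgr_to_le cv).
near=> N; have LN : (L <= N)%N by near: N; exists L.
rewrite (big_cat_nat (leq0n L) LN)//= big1_seq ?add0r; first exact: geometric_tail_le (digit_sub_le ub ub').
by move=> n /andP[_]; rewrite mem_index_iota => /andP[_ nL]; rewrite uu'// subrr mul0r.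
Unshelve. all: by end_near.
Qed.

(** A gap of at least [2] between the first distinct digits cannot be bridged by
    the later digits, whose total contribution is at most one unit. *)
Lemma expansion_far u u' n : (forall n, (u n < b)%N) -> (forall n, (u' n < b)%N) ->
  (forall i, (i < n)%N -> u i = u' i) -> 2 <= `|(u n)%:R - (u' n)%:R| :> R ->
  b%:R ^- n.+1 <= `|expansion u - expansion u'|.
Proof.
move=> ub ub' uu' gap; have cv : `|\sum_(0 <= n < N) ((u n)%:R - (u' n)%:R) / b%:R ^+ n.+1| @[N --> \oo] -->
    `|expansion u - expansion u'|.
  by apply: cvg_norm; exact: cvg_expansion_sub.
apply: (cvgr_to_ge cv).
near=> N; have nN : (n.+1 <= N)%N by near: N; exists n.+1.
have b0 := base_gt0; have bn : 0 < b%:R ^- n.+1 :> R by rewrite invr_gt0 exprn_gt0.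
rewrite (big_cat_nat (leq0n n.+1) nN)//= big_nat_recr//= big1_seq ?add0r; last first.
  by move=> i /andP[_]; rewrite mem_index_iota => /andP[_ nL]; rewrite uu'// subrr mul0r.
have := geometric_tail_le n.+1 N (digit_sub_le ub ub').
set t := \sum_(_ <= _ < _) _ => ht.
have : 2 * b%:R ^- n.+1 <= `|((u n)%:R - (u' n)%:R) / b%:R ^+ n.+1| :> R.
  by rewrite normrM (gtr0_norm bn) ler_pM2r.
set s := (((u n)%:R - (u' n)%:R) / _) => hs; have := lerB_normD s t; lra.
Unshelve. all: by end_near.
Qed.

End expansions.

Section euclidean_distance.
Context (R : realType) (n : nat).
Implicit Types x y : 'rV[R]_n.

Lemma coord_le_edist x y j : `|x ord0 j - y ord0 j| <= Defs.edist x y.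
Proof.
rewrite -sqrtr_sqr /Defs.edist; apply: ler_wsqrtr.
by rewrite (bigD1 j)//= lerDl sumr_ge0// => i _; exact: sqr_ge0.
Qed.

Lemma edist_le_sum x y : Defs.edist x y <= \sum_j `|x ord0 j - y ord0 j|.
Proof.
have s0 : 0 <= \sum_j `|x ord0 j - y ord0 j| by apply: sumr_ge0.
rewrite /Defs.edist -[leRHS]ger0_norm// -sqrtr_sqr; apply: ler_wsqrtr.
rewrite expr2 mulr_suml; apply: ler_sum => j _.
rewrite -(real_normK (num_real _)) expr2 ler_wpM2l// (bigD1 j)//= lerDl.
by apply: sumr_ge0.
Qed.

End euclidean_distance.

Section approximate_squares.
Context (R : realType) (d : nat) (a : 'I_d.+1 -> nat).
Hypothesis a_ge2 : forall q, (2 <= a q)%N.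
Context (D : neset (digit a)).
Notation A := (alphabet D).
Implicit Types (w : Sigma D) (L : 'I_d.+1 -> nat).

(** The codes [w] and [w'] give points of the same approximate square, of side
    [a q ^- L q] in the direction [q]. *)
Definition same_square L w w' : Prop :=
  forall q n, (n < L q)%N -> sval (w n) q = sval (w' n) q.

Lemma codingE w j : coding D R w ord0 j = expansion R (a j) (fun n => sval (w n) j).
Proof. by rewrite mxE. Qed.

Lemma coding_close L w w' q : same_square L w w' ->
  `|coding D R w ord0 q - coding D R w' ord0 q| <= (a q)%:R ^- L q.
Proof.
move=> ww'; rewrite !codingE; apply: expansion_close => // n nL.
by rewrite ww'.
Qed.

(** At the first position where the codes differ inside the square, the very
    strong separation condition applies to the last differing coordinate [q],
    in which the codes agree before that position because [L] is monotone. *)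
Lemma coding_far L w w' : very_strong_separation D ->
  {homo L : q r / (q <= r)%N >-> (q <= r)%N} -> ~ same_square L w w' ->
  exists q, (a q)%:R ^- L q <= `|coding D R w ord0 q - coding D R w' ord0 q|.
Proof.
move=> vssc L_mono nsame.
pose diff n := [exists q, (n < L q)%N && (sval (w n) q != sval (w' n) q)].
have ex : exists n, diff n.
  apply: contrapT => nex; apply: nsame => q n nL; apply/eqP/negPn/negP => ne.
  by apply: nex; exists n; apply/existsP; exists q; rewrite nL.
case: (ex_minnP ex) => n /existsP[q0 /andP[nLq0 ne0]] minn.
have [q ne qmax] := @arg_maxnP _ q0 (fun q => sval (w n) q != sval (w' n) q)
  (fun q => nat_of_ord q) ne0.
have nLq : (n < L q)%N by apply: leq_trans nLq0 (L_mono _ _ (qmax _ ne0)).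
exists q; rewrite !codingE.
apply: (@le_trans _ _ ((a q)%:R ^- n.+1)).
  have aq0 : 0 < (a q)%:R :> R by exact: base_gt0.
  rewrite lef_pV2 ?posrE ?exprn_gt0// ler_weXn2l// ler1n.
  exact: leq_trans (a_ge2 q).
apply: expansion_far => //.
  move=> i ilt; apply/eqP/negPn/negP => nei.
  have : diff i by apply/existsP; exists q; rewrite (ltn_trans ilt nLq).
  by move=> /minn; rewrite leqNgt ilt.
have gap : 1 < `|(sval (w n) q : nat)%:Z - (sval (w' n) q : nat)%:Z|.
  apply: (vssc _ _ (svalP (w n)) (svalP (w' n)) q ne) => r qr.
  by apply/eqP/negPn/negP => /qmax /=; rewrite leqNgt qr.
have {gap} : 2 <= `|(sval (w n) q : nat)%:Z - (sval (w' n) q : nat)%:Z|.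
  by move: gap; lia.
by rewrite -(ler_int R) intr_norm rmorphB/=.
Qed.

End approximate_squares.

(** * Approximate squares *)

Section scales.
Context (R : realType) (d : nat) (a : 'I_d.+1 -> nat).
Hypothesis a_decr : forall q r : 'I_d.+1, (q < r)%N -> (a r < a q)%N.
Hypothesis a_ge2 : forall q, (2 <= a q)%N.

Definition log_base (q : 'I_d.+1) : R := ln (a q)%:R.

Lemma log_base_gt0 q : 0 < log_base q.
Proof. by rewrite ln_gt0// ltr1n. Qed.

Lemma log_base_decr (q r : 'I_d.+1) : (q <= r)%N -> log_base r <= log_base q.
Proof.
rewrite leq_eqVlt => /orP[/eqP/val_inj->//|/a_decr lt].
by rewrite ler_ln ?posrE ?ltr0n ?(leq_trans _ (a_ge2 _))// ler_nat ltnW.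
Qed.

(** [a q ^- scale rho q] is, up to a factor [a q], the radius [exp (- rho)]. *)
Definition scale (rho : R) (q : 'I_d.+1) : nat := Num.truncn (rho / log_base q).

Lemma scale_le rho q : 0 <= rho -> (scale rho q)%:R * log_base q <= rho.
Proof.
move=> rho0; rewrite -ler_pdivlMr ?log_base_gt0//.
have := truncn_itv (_ : 0 <= rho / log_base q).
by rewrite divr_ge0 ?(ltW (log_base_gt0 q))// => /(_ isT)/andP[].
Qed.

Lemma scale_gt rho q : rho < (scale rho q)%:R * log_base q + log_base q.
Proof.
have : rho / log_base q < (scale rho q).+1%:R := truncnS_gt _.
by rewrite ltr_pdivrMr ?log_base_gt0// -natr1 mulrDl mul1r.
Qed.

Lemma scale_mono rho : 0 <= rho ->
  {homo scale rho : q r / (q <= r)%N >-> (q <= r)%N}.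
Proof.
move=> rho0 q r qr; apply: le_truncn; apply: ler_wpM2l => //.
by rewrite lef_pV2 ?posrE ?log_base_gt0// log_base_decr.
Qed.

Lemma scale_mul rho n q : rho = n%:R * log_base q -> scale rho q = n.
Proof. by move=> ->; rewrite /scale mulfK ?natrK// gt_eqF// log_base_gt0. Qed.

Lemma base_exprVn q n : (a q)%:R ^- n = expR (- (n%:R * log_base q)) :> R.
Proof.
rewrite expRN expRM_natl lnK// posrE ltr0n.
exact: leq_trans (a_ge2 q).
Qed.

Lemma scale_side_ge rho q : 0 <= rho -> expR (- rho) <= (a q)%:R ^- scale rho q.
Proof. by move=> rho0; rewrite base_exprVn ler_expR lerN2 scale_le. Qed.

Lemma scale_side_le rho q : (a q)%:R ^- scale rho q <= (a q)%:R * expR (- rho).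
Proof.
have a0 : 0 < (a q)%:R :> R by rewrite ltr0n (leq_trans _ (a_ge2 q)).
rewrite base_exprVn -[(a q)%:R in leRHS]lnK// -expRD ler_expR.
by have := scale_gt rho q; rewrite /log_base; lra.
Qed.

(** When the scales [L] increase with the coordinate, the coordinates prescribed
    at the position [n] by an approximate square are those of index at least
    [level L n]. *)
Definition level (L : 'I_d.+1 -> nat) (n : nat) : nat :=
  \max_(q : 'I_d.+1 | (L q <= n)%N) q.+1.

Lemma level_le (L : 'I_d.+1 -> nat) (n : nat) (q : 'I_d.+1) :
  {homo L : q r / (q <= r)%N >-> (q <= r)%N} -> (level L n <= q)%N = (n < L q)%N.
Proof.
move=> L_mono; apply/idP/idP => [|nL].
  rewrite [(n < _)%N]ltnNge; apply: contraL => Ln; rewrite -ltnNge.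
  exact: (@leq_bigmax_cond _ (fun r : 'I_d.+1 => L r <= n)%N (fun r => r.+1) q).
apply/bigmax_leqP => r Lr; rewrite ltnNge; apply/negP => /L_mono qr.
by have := leq_trans nL (leq_trans qr Lr); rewrite ltnn.
Qed.

Lemma level_ub L n : (level L n <= d.+1)%N.
Proof. by apply/bigmax_leqP => q _; exact: ltn_ord. Qed.

Context (D : neset (digit a)).
Notation A := (alphabet D).

Lemma tail_letter_eqP m (i i' : A) :
  tail_letter m i = tail_letter m i' <-> forall q : 'I_d.+1, (m <= q)%N -> sval i q = sval i' q.
Proof.
split=> [/ffunP h q mq|h].
  by have := h (exist _ q mq); rewrite !ffunE.
by apply/ffunP => q; rewrite !ffunE; exact/h/(valP q).
Qed.

Lemma same_squareP (L : 'I_d.+1 -> nat) (w w' : Sigma D) :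
  {homo L : q r / (q <= r)%N >-> (q <= r)%N} ->
  same_square L w w' <-> forall n, (n < L ord_max)%N ->
    tail_letter (level L n) (w n) = tail_letter (level L n) (w' n).
Proof.
move=> L_mono; split=> [h n nL|h q n nL].
  by apply/tail_letter_eqP => q; rewrite level_le// => nq; exact: h.
have nN : (n < L ord_max)%N by apply: leq_trans nL (L_mono q ord_max (leq_ord q)).
by have /tail_letter_eqP := h n nN; apply; rewrite level_le.
Qed.

(** The letters are independent, and the square constrains each of them separately,
    through its tail at the level of its position. *)
Lemma square_mass (p : A -> R) (nu : probability (Sigma D) R)
    (L : 'I_d.+1 -> nat) (w : Sigma D) : bernoulli_law p nu ->
  {homo L : q r / (q <= r)%N >-> (q <= r)%N} ->
  measurable [set w' | same_square L w w'] /\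
  pr nu [set w' | same_square L w w'] = \prod_(n < L ord_max)
    image_law (tail_letter (level L n)) p (tail_letter (level L n) (w n)).
Proof.
move=> bnu L_mono.
pose N := L ord_max.
pose P (c : {ffun 'I_N -> A}) :=
  [forall i : 'I_N, tail_letter (level L i) (c i) == tail_letter (level L i) (w i)].
have -> : [set w' | same_square L w w'] = @word _ D N @^-1` [set c | P c].
  apply/seteqP; split=> w' /=.
    by move=> /same_squareP h; apply/forallP => i; rewrite ffunE h.
  move=> /forallP h; apply/same_squareP => // n nN.
  by have := h (Ordinal nN); rewrite ffunE => /eqP.
have [mP ->] := @pr_preimage _ _ _ nu _ (@word _ D N) P (@finite_map_word _ D N).
split=> //; under eq_bigr do rewrite (law_word _ bnu).
rewrite /image_law.
rewrite (@big_distr_big_dep R 0 1 *%R +%R _ _ (point : A) xpredT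
  (fun (i : 'I_N) j => tail_letter (level L i) j == tail_letter (level L i) (w i)) (fun=> p)).
apply: eq_bigl => c; apply/forallP/familyP => h i; first exact: h.
by have := h i; rewrite unfold_in.
Qed.

End scales.

(** * Local dimensions as Birkhoff averages *)

Lemma measurable_edist_coding (R : realType) (d : nat) (a : 'I_d.+1 -> nat)
    (a_ge2 : forall q, (2 <= a q)%N) (D : neset (digit a)) (x : 'rV[R]_d.+1) :
  measurable_fun [set: Sigma D] (fun w => Defs.edist x (coding D R w)).
Proof.
have mcoord j : measurable_fun [set: Sigma D] (fun w => coding D R w ord0 j).
  apply: (@measurable_realfun.measurable_fun_cvg _ (Sigma D) R setT
    (fun N (w : Sigma D) => partial_expansion R (a j) (fun n => sval (w n) j) N)).
    move=> N; have mW := @finite_map_word _ D N.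
    pose g (c : {ffun 'I_N -> alphabet D}) : R :=
      \sum_(n < N) (sval (c n) j : nat)%:R / (a j)%:R ^+ n.+1.
    have -> : (fun w : Sigma D => partial_expansion R (a j) (fun n => sval (w n) j) N) =
        g \o @word _ D N.
      apply/funext => w; rewrite /= /partial_expansion big_mkord /g.
      by apply: eq_bigr => n _; rewrite ffunE.
    move=> _ B mB; rewrite setTI.
    exact: (measurable_finite_map (fun c => B (g c)) mW).
  move=> w _; rewrite /= codingE.
  exact: (is_cvg_expansion (a_ge2 j) (fun n => ltn_ord (sval (w n) j))).
have msum : measurable_fun [set: Sigma D]
    (fun w => \sum_j (x ord0 j - coding D R w ord0 j) ^+ 2).
  apply: measurable_sum => j.
  apply: measurable_realfun.measurable_funX.
  by apply: measurable_realfun.measurable_funB.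
rewrite /Defs.edist; apply: (measurableT_comp _ msum).
by apply: measurable_realfun.continuous_measurable_fun; exact: sqrt_continuous.
Qed.

Section local_dimension.
Context (R : realType) (d : nat) (a : 'I_d.+1 -> nat).
Hypothesis a_decr : forall q r : 'I_d.+1, (q < r)%N -> (a r < a q)%N.
Hypothesis a_ge2 : forall q, (2 <= a q)%N.
Context (D : neset (digit a)).
Hypothesis vssc : very_strong_separation D.
Notation A := (alphabet D).
Context (p : A -> R).
Hypothesis p_prob : probability_vector p.
Context (nu : probability (Sigma D) R).
Hypothesis nu_bern : bernoulli_law p nu.
Context (k : 'I_d.+1).
Hypothesis p_onedim : one_dimensional p k.
Notation la := (@log_base R d a).

Definition log_marg (m : nat) (i : A) : R := ln (marg p (Defs.eta m (sval i))).

Lemma marg_gt0 m (i : A) : 0 < marg p (Defs.eta m (sval i)).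
Proof.
have [p0 _] := p_prob; rewrite /marg (bigD1 i)//=.
by rewrite ltr_pwDl// sumr_ge0// => j _; exact: ltW.
Qed.

Lemma log_marg_last (i : A) : log_marg d.+1 i = 0.
Proof.
have [_ p1] := p_prob; rewrite /log_marg.
suff -> : marg p (Defs.eta d.+1 (sval i)) = 1 by rewrite ln1.
rewrite -p1; apply: eq_bigl => j; apply/eqP/ffunP => q; have := valP q.
by rewrite leqNgt ltn_ord.
Qed.

Lemma log_base_P (q : 'I_d.+1) (w : Sigma D) :
  la q * P_ p q w = log_marg q.+1 (w 0%N) - log_marg q (w 0%N).
Proof.
have l0 : ln (a q)%:R != 0 :> R by rewrite gt_eqF// log_base_gt0.
rewrite /P_ /log_base; case: ifPn => qd.
  by rewrite mulrC divfK// ln_div ?posrE ?marg_gt0// opprB.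
have qE : q.+1 = d.+1 by apply/eqP; rewrite eqn_leq ltn_ord ltnNge.
by rewrite qE log_marg_last sub0r mulrC divfK.
Qed.

Lemma log_marg_sum m (w : Sigma D) : (m <= d.+1)%N ->
  - log_marg m (w 0%N) = \sum_(q : 'I_d.+1 | (m <= q)%N) la q * P_ p q w.
Proof.
move=> md; under eq_bigr do rewrite log_base_P.
have := telescope_sumr (fun q => log_marg q (w 0%N)) md.
by rewrite log_marg_last sub0r => <-; rewrite big_geq_mkord.
Qed.

Lemma square_log_mass (L : 'I_d.+1 -> nat) (w : Sigma D) :
  {homo L : q r / (q <= r)%N >-> (q <= r)%N} ->
  - ln (pr nu [set w' | same_square L w w']) =
  \sum_q la q * \sum_(n < L q) P_ p q (fun=> w n).
Proof.
move=> L_mono; have [_ ->] := square_mass w nu_bern L_mono.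
rewrite ln_prod => [|n _]; last exact: marg_gt0.
rewrite -sumrN.
have E1 (n : 'I_(L ord_max)) : true ->
    - ln (image_law (tail_letter (level L n)) p (tail_letter (level L n) (w n))) =
    \sum_(q | (n < L q)%N) la q * P_ p q (fun=> w n).
  move=> _; have := log_marg_sum (fun=> w n) (level_ub L n).
  rewrite /log_marg /= => ->; apply: eq_bigl => q.
  by rewrite level_le.
rewrite (eq_bigr _ E1) (exchange_big_dep xpredT)//=; apply: eq_bigr => q _.
rewrite mulr_sumr; have LN : (L q <= L ord_max)%N := L_mono q ord_max (leq_ord q).
by rewrite (big_ord_widen _ (fun n => la q * P_ p q (fun=> w n)) LN).
Qed.

Lemma P_constant (j : 'I_d.+1) (w : Sigma D) : j != k ->
  P_ p j w = constant_value (P_ p j).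
Proof.
move=> jk; suff [c cE] : exists c, forall w, P_ p j w = c.
  have : exists c, [set c | forall w, P_ p j w = c] c by exists c.
  by move=> /(xgetPex 0) /(_ w).
have [h1 h2] := p_onedim; have [jd|jd] := boolP (j.+1 < d.+1)%N.
  by exists (- ln ((neta D j.+1)%:R / (neta D j)%:R) / ln (a j)%:R) => w'; rewrite /P_ jd h1.
have jE : (j : nat) = d by apply/eqP; rewrite eqn_leq -ltnS ltn_ord; move: jd; rewrite ltnS -leqNgt.
have kd : k.+1 != d.+1.
  by apply: contra jk => /eqP[kj]; apply/eqP/val_inj; rewrite /= jE kj.
exists (- ln (neta D d)%:R^-1 / ln (a j)%:R) => w'.
by rewrite /P_ (negbTE jd) jE (h2 kd)//;
  exact: (imset_f (@Defs.eta _ a d) (svalP (w' 0%N))).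
Qed.

Definition letter_value (i : A) : R := Ptilde p k (fun=> i).
Notation v := letter_value.

Lemma PtildeE (w : Sigma D) : Ptilde p k w = v (w 0%N).
Proof. by []. Qed.

(** In all directions other than [k] the exponents are constant, so the mass of
    an approximate square depends on its code through a single Birkhoff sum. *)
Lemma mass_birkhoff : exists2 C, 0 <= C & forall (rho : R) (w : Sigma D), 0 <= rho ->
  `|- ln (pr nu [set w' | same_square (scale a rho) w w']) -
     la k * \sum_(n < scale a rho k) v (w n)| <= C.
Proof.
pose c j := constant_value (P_ p j).
exists (\sum_(j | j != k) `|c j| * (la j + la k)).
  by apply: sumr_ge0 => j _; rewrite mulr_ge0// addr_ge0// ltW// log_base_gt0.
move=> rho w rho0; rewrite square_log_mass; last exact: scale_mono.
have vE n : v (w n) = P_ p k (fun=> w n) + \sum_(j | j != k) c j by [].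
under [X in _ - la k * X]eq_bigr do rewrite vE.
rewrite big_split/= (bigD1 k)//= sumr_const card_ord -[_ *+ _]mulr_natl.
rewrite (eq_bigr (fun j => la j * ((scale a rho j)%:R * c j))) => [|j jk]; last first.
  rewrite (eq_bigr (fun=> c j)); last by move=> n _; exact: P_constant.
  by rewrite sumr_const card_ord -[_ *+ _]mulr_natl.
rewrite mulrDr opprD addrACA subrr add0r !mulr_sumr -sumrB.
apply: le_trans (ler_norm_sum _ _ _) _; apply: ler_sum => j _.
have -> : la j * ((scale a rho j)%:R * c j) - la k * ((scale a rho k)%:R * c j) =
   c j * ((scale a rho j)%:R * la j - (scale a rho k)%:R * la k) by ring.
rewrite normrM ler_wpM2l//.
have := scale_le a_ge2 j rho0; have := scale_le a_ge2 k rho0.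
have := scale_gt a_ge2 rho j; have := scale_gt a_ge2 rho k.
have := log_base_gt0 R a_ge2 j; have := log_base_gt0 R a_ge2 k.
by move=> *; rewrite ler_norml; apply/andP; split; lra.
Qed.

Notation mu := (bernoulli_image nu).

Lemma measurable_ball_code x r :
  measurable ((coding D R : Sigma D -> _) @^-1` (eball x r)).
Proof.
have := @measurable_edist_coding R d a a_ge2 D x measurableT _ (@measurable_itv R `]-oo, r]).
rewrite setTI; congr measurable; apply/seteqP; split=> w /=; by rewrite in_itv.
Qed.

Lemma square_mass_gt0 (L : 'I_d.+1 -> nat) (w : Sigma D) : {homo L : q r / (q <= r)%N >-> (q <= r)%N} ->
  0 < pr nu [set w' | same_square L w w'].
Proof.
move=> L_mono; have [_ ->] := square_mass w nu_bern L_mono.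
by apply: prodr_gt0 => n _; exact: marg_gt0.
Qed.

(** A square smaller by this shift of the scale has diameter at most [exp (- rho)],
    the sum of its sides being at most [\sum_q a q] times the radius. *)
Definition diam_shift : R := ln (\sum_q (a q)%:R).

Let sum_base_ge1 : 1 <= \sum_q (a q)%:R :> R.
Proof.
apply: (@le_trans _ _ (a ord0)%:R); first by rewrite ler1n (leq_trans _ (a_ge2 _)).
by rewrite (bigD1 ord0)//= lerDl sumr_ge0.
Qed.

Lemma diam_shift_ge0 : 0 <= diam_shift.
Proof. exact: ln_ge0. Qed.

Lemma edist_same_square (rho : R) (w w' : Sigma D) :
  same_square (scale a (rho + diam_shift)) w w' ->
  Defs.edist (coding D R w) (coding D R w') <= expR (- rho).
Proof.
move=> ww'; apply: le_trans (edist_le_sum _ _) _.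
apply: (@le_trans _ _ (\sum_q (a q)%:R * expR (- (rho + diam_shift)))).
  apply: ler_sum => q _; apply: le_trans (coding_close R a_ge2 q ww') _.
  exact: scale_side_le.
have sa0 : 0 < \sum_q (a q)%:R :> R := lt_le_trans ltr01 sum_base_ge1.
have eC : expR diam_shift = \sum_q (a q)%:R by rewrite lnK.
rewrite -mulr_suml opprD expRD [expR (- diam_shift)]expRN eC.
by rewrite mulrCA divff ?mulr1// gt_eqF.
Qed.

(** By [coding_far], a code outside the square of [w] of scale [rho - 1] gives a
    point at distance at least the side of that square; conversely a square of
    scale slightly larger than [rho] has diameter at most [exp (- rho)]. *)
Lemma ball_mass : exists2 C, 0 <= C & forall (rho : R) (w : Sigma D), 1 <= rho ->
  - ln (pr nu [set w' | same_square (scale a (rho - 1)) w w']) <=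
  - ln (fine (mu (eball (coding D R w) (expR (- rho))))) <=
  - ln (pr nu [set w' | same_square (scale a (rho + C)) w w']).
Proof.
pose C := diam_shift; have C0 : 0 <= C := diam_shift_ge0.
exists C => // rho w rho1.
have rho0 : 0 <= rho - 1 by rewrite subr_ge0.
have rhoC : 0 <= rho + C by rewrite addr_ge0// (le_trans ler01).
have -> : fine (mu (eball (coding D R w) (expR (- rho)))) =
  pr nu ((coding D R : Sigma D -> _) @^-1` eball (coding D R w) (expR (- rho))) by [].
have mB := measurable_ball_code (coding D R w) (expR (- rho)).
have mono1 := scale_mono a_decr a_ge2 rho0.
have monoC := scale_mono a_decr a_ge2 rhoC.
have [m1 _] := square_mass w nu_bern mono1.
have [m2 _] := square_mass w nu_bern monoC.
have g2 := square_mass_gt0 w monoC.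
have sub2 : [set w' | same_square (scale a (rho + C)) w w'] `<=`
   (coding D R : Sigma D -> _) @^-1` eball (coding D R w) (expR (- rho)).
  by move=> w' /edist_same_square.
have le2 := le_pr nu m2 mB sub2.
have gB := lt_le_trans g2 le2.
apply/andP; split; last by rewrite lerN2 ler_ln ?posrE.
rewrite lerN2 ler_ln ?posrE//; last exact: square_mass_gt0 mono1.
apply: le_pr => // w' /= ball; apply: contrapT => ns.
have [q far] := coding_far R a_ge2 vssc mono1 ns.
have := le_trans (scale_side_ge a_ge2 q rho0) far.
move=> /le_trans/(_ (coord_le_edist _ _ _))/le_trans/(_ ball).
by rewrite ler_expR lerN2 lerBrDr gerDl ler10.
Qed.

End local_dimension.

Definition birkhoff_limit (R : realType) (B : Type) (v : B -> R) (alpha : R)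
    (w : nat -> B) : Prop := forall e, 0 < e ->
  exists N, forall n, (N <= n)%N -> `|\sum_(i < n) v (w i) - n%:R * alpha| <= n%:R * e.

Section linear_growth.
Context (R : realType) (alpha : R).

(** The limit defining the local dimension, read with [rho = - ln r] and without
    the quotient, so that the logarithmic masses of balls and of approximate
    squares can be compared at shifted arguments. *)
Definition grows_linearly (f : R -> R) : Prop := forall e, 0 < e ->
  exists rho1, forall rho, rho1 <= rho -> `|f rho - alpha * rho| <= e * rho.

Lemma grows_linearly_squeeze (f g : R -> R) (s t rho0 : R) : 0 <= s -> 0 <= t ->
  (forall rho, rho0 <= rho -> f (rho - s) <= g rho <= f (rho + t)) ->
  grows_linearly f -> grows_linearly g.
Proof.
move=> s0 t0 fg lf e0 e0_gt0.
have [e e_gt0 ->] : exists2 e, 0 < e & e0 = e + e.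
  by exists (e0 / 2); rewrite ?divr_gt0// -splitr.
have [rho1 f1] := lf _ e_gt0.
pose K := `|alpha| * (s + t) + e * (s + t).
exists (`|rho0| + `|rho1| + s + K / e) => rho hrho.
have K0 : 0 <= K / e.
  by rewrite divr_ge0 ?(ltW e_gt0)// addr_ge0// mulr_ge0// ?addr_ge0// ltW.
have n0 := ler_norm rho0; have n1 := ler_norm rho1.
have p0 := normr_ge0 rho0; have p1 := normr_ge0 rho1.
have KE : K <= e * rho.
  by rewrite [leRHS]mulrC -ler_pdivrMr//; lra.
have /andP[h1 h2] := fg rho (ltac:(lra)).
have := f1 (rho - s) (ltac:(lra)); have := f1 (rho + t) (ltac:(lra)).
rewrite !ler_norml => /andP[_ a2] /andP[a1 _].
have as_ : alpha * t <= `|alpha| * t by rewrite ler_wpM2r// ler_norm.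
have at_ : alpha * s <= `|alpha| * s by rewrite ler_wpM2r// ler_norm.
have ss : 0 <= `|alpha| * s by rewrite mulr_ge0.
have tt : 0 <= `|alpha| * t by rewrite mulr_ge0.
have es : 0 <= e * s by rewrite mulr_ge0// ltW.
have et : 0 <= e * t by rewrite mulr_ge0// ltW.
move: a1 a2 KE; rewrite /K !mulrBr !mulrDr !mulrDl => a1 a2 KE.
by apply/andP; split; lra.
Qed.

End linear_growth.

Section local_dimension_birkhoff.
Context (R : realType) (d : nat) (a : 'I_d.+1 -> nat).
Hypothesis a_decr : forall q r : 'I_d.+1, (q < r)%N -> (a r < a q)%N.
Hypothesis a_ge2 : forall q, (2 <= a q)%N.
Context (D : neset (digit a)).
Hypothesis vssc : very_strong_separation D.
Notation A := (alphabet D).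
Context (p : A -> R).
Hypothesis p_prob : probability_vector p.
Context (nu : probability (Sigma D) R).
Hypothesis nu_bern : bernoulli_law p nu.
Context (k : 'I_d.+1).
Hypothesis p_onedim : one_dimensional p k.
Notation la := (@log_base R d a).
Notation v := (letter_value p k).
Notation mu := (bernoulli_image nu).

Let G (w : Sigma D) (rho : R) : R := - ln (pr nu [set w' | same_square (scale a rho) w w']).
Let g (w : Sigma D) (rho : R) : R :=
  - ln (fine (mu (eball (coding D R w) (expR (- rho))))).

Let near_right (Q : R -> Prop) : (\forall r \near (0 : R)^'+, Q r) ->
  exists2 e, 0 < e & forall r, 0 < r < e -> Q r.
Proof.
move=> /nbhs_ballP[e /= e0 H]; exists e => // r /andP[r0 re]; apply: H => //=.
by rewrite /ball/= sub0r normrN gtr0_norm.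
Qed.

Lemma growth_of_birkhoff alpha w : birkhoff_limit v alpha w ->
  grows_linearly alpha (G w).
Proof.
move=> bw e e0; have e2 : 0 < e / 2 by rewrite divr_gt0.
have [C C0 CP] := mass_birkhoff a_decr a_ge2 p_prob nu_bern p_onedim.
have [N NP] := bw _ e2; have lk := log_base_gt0 R a_ge2 k.
exists (`|N%:R * la k| + (C + la k * `|alpha|) / (e / 2)) => rho hrho.
have K0 : 0 <= (C + la k * `|alpha|) / (e / 2).
  by rewrite divr_ge0 ?(ltW e2)// addr_ge0// mulr_ge0// ltW.
have rho0 : 0 <= rho by apply: le_trans hrho; rewrite addr_ge0.
have KE : C + la k * `|alpha| <= e / 2 * rho.
  rewrite [leRHS]mulrC -ler_pdivrMr//; apply: le_trans hrho.
  by rewrite lerDr.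
set n := scale a rho k.
have Nn : (N <= n)%N.
  rewrite /n /scale truncn_ge_nat ?divr_ge0 ?(ltW lk)// ler_pdivlMr//.
  by apply: le_trans (ler_norm _) _; apply: le_trans hrho; rewrite lerDl.
have h1 := CP rho w rho0; rewrite -/n -/(G w rho) in h1.
have h2 := NP n Nn.
have nle : n%:R * la k <= rho by exact: scale_le.
have ngt : rho < n%:R * la k + la k by exact: scale_gt.
set S := \sum_(i < n) _ in h1 h2.
have {h2} h2 : `|la k * S - la k * (n%:R * alpha)| <= rho * (e / 2).
  rewrite -mulrBr normrM gtr0_norm//.
  apply: (@le_trans _ _ (la k * (n%:R * (e / 2)))); first by rewrite ler_pM2l.
  have -> : la k * (n%:R * (e / 2)) = n%:R * la k * (e / 2) by ring.
  by apply: ler_wpM2r => //; exact: ltW.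
have h3 : `|la k * (n%:R * alpha) - alpha * rho| <= la k * `|alpha|.
  have -> : la k * (n%:R * alpha) - alpha * rho = - (rho - n%:R * la k) * alpha by ring.
  rewrite normrM normrN ler_wpM2r// ger0_norm; lra.
have -> : G w rho - alpha * rho = (G w rho - la k * S) +
  (la k * S - la k * (n%:R * alpha)) + (la k * (n%:R * alpha) - alpha * rho) by ring.
apply: le_trans (ler_normD _ _) _.
have := ler_normD (G w rho - la k * S) (la k * S - la k * (n%:R * alpha)).
have eE : e * rho = e / 2 * rho + rho * (e / 2) by rewrite [in LHS](splitr e); ring.
rewrite eE; lra.
Qed.

Lemma birkhoff_of_growth alpha w : grows_linearly alpha (G w) ->
  birkhoff_limit v alpha w.
Proof.
move=> lG e e0; have e2 : 0 < e / 2 by rewrite divr_gt0.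
have [C C0 CP] := mass_birkhoff a_decr a_ge2 p_prob nu_bern p_onedim.
have lk := log_base_gt0 R a_ge2 k.
have [rho1 rP] := lG _ e2.
exists (Num.truncn (`|rho1 / la k| + C / (la k * (e / 2)))).+1 => n hn.
have {hn} hn : `|rho1 / la k| + C / (la k * (e / 2)) <= n%:R.
  by apply: ltW; apply: lt_le_trans (truncnS_gt _) _; rewrite ler_nat.
have lke : 0 < la k * (e / 2) by rewrite mulr_gt0.
have rho0 : 0 <= n%:R * la k by rewrite mulr_ge0// ltW.
have := CP (n%:R * la k) w rho0.
rewrite (scale_mul a_ge2 (erefl (n%:R * la k))) -/(G w _) => h1.
have h2 : `|G w (n%:R * la k) - alpha * (n%:R * la k)| <= e / 2 * (n%:R * la k).
  apply: rP; rewrite -ler_pdivrMr//; apply: le_trans (ler_norm _) _.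
  by apply: le_trans hn; rewrite lerDl divr_ge0// ltW.
have h3 : C <= n%:R * (la k * (e / 2)).
  rewrite -ler_pdivrMr//; apply: le_trans hn.
  by rewrite lerDr.
set S := \sum_(i < n) _ in h1 *.
rewrite -(ler_pM2l lk) -[X in X * `|_|](gtr0_norm lk) -normrM.
have -> : la k * (S - n%:R * alpha) = - (G w (n%:R * la k) - la k * S) +
  (G w (n%:R * la k) - alpha * (n%:R * la k)) by ring.
apply: le_trans (ler_normD _ _) _; rewrite normrN.
have -> : la k * (n%:R * e) = n%:R * (la k * (e / 2)) + e / 2 * (n%:R * la k).
  by rewrite [in LHS](splitr e); ring.
exact: lerD (le_trans h1 h3) h2.
Qed.

Lemma local_dim_of_birkhoff alpha w : birkhoff_limit v alpha w ->
  local_dim_set (sponge D R) mu alpha (coding D R w).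
Proof.
move=> /growth_of_birkhoff lG; split; first by exists w.
have [C C0 CP] := ball_mass a_decr a_ge2 vssc p_prob nu_bern.
have lg : grows_linearly alpha (g w).
  exact: (grows_linearly_squeeze ler01 C0 (fun rho rho1 => CP rho w rho1) lG).
apply/cvgrPdist_le => e e0; have [rho1 rP] := lg _ e0.
near=> r.
have r0 : 0 < r by near: r; exact: nbhs_right_gt.
have rlt : r < expR (- (`|rho1| + 1)) by near: r; apply: nbhs_right_lt; exact: expR_gt0.
have lr : `|rho1| + 1 < - ln r.
  by rewrite ltrNr -ltr_expR lnK ?posrE.
have rho0 : 0 < - ln r by apply: le_lt_trans lr; rewrite addr_ge0.
have := rP (- ln r); rewrite /g opprK lnK ?posrE// => h.
have {}h := h (le_trans (ler_norm _) (ltW (le_lt_trans _ lr))).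
have lne : ln r != 0 by rewrite -oppr_eq0 gt_eqF.
have -> : alpha - ln (fine (mu (eball (coding D R w) r))) / ln r =
  - (- ln (fine (mu (eball (coding D R w) r))) - alpha * - ln r) / - ln r by field.
rewrite normrM normrN normfV (gtr0_norm rho0) ler_pdivrMr//; apply: h.
by rewrite lerDl.
Unshelve. all: by end_near.
Qed.

Lemma birkhoff_of_local_dim alpha x :
  local_dim_set (sponge D R) mu alpha x ->
  exists2 w, x = coding D R w & birkhoff_limit v alpha w.
Proof.
move=> [[w _ <-] cv]; exists w => //.
have [C C0 CP] := ball_mass a_decr a_ge2 vssc p_prob nu_bern.
have lg : grows_linearly alpha (g w).
  move=> e e0; move/cvgrPdist_le: cv => /(_ _ e0)/near_right[r0 r00 rP].
  exists (`|ln r0| + 1) => rho hrho.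
  have rho0 : 0 < rho by apply: lt_le_trans hrho; rewrite ltr_pwDr.
  have := rP (expR (- rho)); rewrite expR_gt0/= expRK => h.
  have {}h : `|alpha - ln (fine (mu (eball (coding D R w) (expR (- rho))))) / - rho| <= e.
    apply: h; rewrite -[r0]lnK ?posrE// ltr_expR.
    by have := ler_norm (- ln r0); rewrite normrN; lra.
  have rne : rho != 0 by rewrite gt_eqF.
  have -> : g w rho - alpha * rho = - (alpha -
    ln (fine (mu (eball (coding D R w) (expR (- rho))))) / - rho) * rho.
    by rewrite /g; field.
  by rewrite normrM normrN (gtr0_norm rho0) ler_pM2r.
apply: birkhoff_of_growth.
apply: (grows_linearly_squeeze C0 ler01 _ lg (rho0 := C + 1)) => rho hrho.
have /andP[_ h1] := CP (rho - C) w (ltac:(lra)).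
have /andP[h2 _] := CP (rho + 1) w (ltac:(lra)).
rewrite subrK in h1; rewrite addrK in h2.
by apply/andP; split.
Qed.

End local_dimension_birkhoff.

(** * Counting approximate squares *)

Section counting.
Context (R : realType) (d : nat) (a : 'I_d.+1 -> nat).
Hypothesis a_decr : forall q r : 'I_d.+1, (q < r)%N -> (a r < a q)%N.
Hypothesis a_ge2 : forall q, (2 <= a q)%N.
Context (D : neset (digit a)).
Notation A := (alphabet D).
Context (v : A -> R) (alpha : R).
Hypothesis slice_ex : exists q, on_slice v alpha q.
Notation la := (@log_base R d a).
Notation H := (max_entropy v alpha).

Definition inv_log (m : nat) : R := (la (inord m))^-1.

Definition inv_log_prev (m : nat) : R := if m is m'.+1 then inv_log m' else 0.

(** The length, per unit of [rho], of the range of positions where an approximate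
    square prescribes exactly the coordinates of index at least [m]. *)
Definition inv_log_gap (m : nat) : R := inv_log m - inv_log_prev m.

Definition dimension_value : R := \sum_(m < d.+1) inv_log_gap m * H m.

Lemma inv_log_gt0 m : 0 < inv_log m.
Proof. by rewrite invr_gt0 log_base_gt0. Qed.

Lemma inv_log_gap_gt0 m : (m <= d)%N -> 0 < inv_log_gap m.
Proof.
rewrite /inv_log_gap /inv_log_prev; case: m => [_|m md]; first by rewrite subr0 inv_log_gt0.
rewrite subr_gt0 ltf_pV2 ?posrE ?log_base_gt0// /log_base.
rewrite ltr_ln ?posrE ?ltr0n ?(leq_trans _ (a_ge2 _))// ltr_nat.
by apply: a_decr; rewrite !inordK//; exact: leqW.
Qed.

Lemma sum_inv_log_gap q : \sum_(m < q.+1) inv_log_gap m = inv_log q.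
Proof.
rewrite -(big_mkord xpredT inv_log_gap) big_nat_recl//= /inv_log_gap/= subr0.
by rewrite (telescope_sumr inv_log) ?subrKC.
Qed.

Lemma dimension_value_ge0 : 0 <= dimension_value.
Proof.
apply: sumr_ge0 => m _; rewrite mulr_ge0 ?max_entropy_ge0// ltW// inv_log_gap_gt0//.
by rewrite -ltnS.
Qed.

Definition side (rho : R) (m : nat) : nat := scale a rho (inord m).

Definition side_prev (rho : R) (m : nat) : nat := if m is m'.+1 then side rho m' else 0%N.

Lemma side_le rho m : 0 <= rho -> (side rho m)%:R <= rho * inv_log m.
Proof. by move=> rho0; rewrite ler_pdivlMr ?log_base_gt0// scale_le. Qed.

Lemma side_gt rho m : rho * inv_log m - 1 < (side rho m)%:R.
Proof.
rewrite ltrBlDr ltr_pdivrMr ?log_base_gt0// mulrDl mul1r; exact: scale_gt.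
Qed.

Lemma side_mono rho m n : 0 <= rho -> (m <= n <= d)%N -> (side rho m <= side rho n)%N.
Proof.
move=> rho0 /andP[mn nd]; apply: scale_mono => //.
by rewrite !inordK// ltnS// (leq_trans mn nd).
Qed.

Lemma level_eq rho m n : 0 <= rho -> (m <= d)%N ->
  (level (scale a rho) n == m) = (side_prev rho m <= n < side rho m)%N.
Proof.
move=> rho0 md; have mono := scale_mono a_decr a_ge2 rho0.
have lE j : (j <= d)%N -> (level (scale a rho) n <= j)%N = (n < side rho j)%N.
  by move=> jd; rewrite -(level_le n (inord j) mono) inordK.
rewrite eqn_leq (lE m md) andbC; congr (_ && _).
case: m md => [|m] md /=; first by rewrite !leq0n.
by rewrite ltnNge (lE m (ltnW md)) -leqNgt.
Qed.

Lemma sum_level rho m (F : nat -> R) : 0 <= rho -> (m <= d)%N ->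
  \sum_(n < side rho d | level (scale a rho) n == m) F n =
  \sum_(n < side rho m) F n - \sum_(n < side_prev rho m) F n.
Proof.
move=> rho0 md.
rewrite (eq_bigl (fun n : 'I__ => side_prev rho m <= n < side rho m)%N) => [|n]; last first.
  exact: level_eq.
have prev_le : (side_prev rho m <= side rho m)%N.
  by case: m md => //= m md; apply: side_mono => //; rewrite leqnSn.
have le_d : (side rho m <= side rho d)%N by apply: side_mono; rewrite // md leqnn.
rewrite -!(big_mkord xpredT F) (big_cat_nat (leq0n _) prev_le)/= addrAC subrr add0r.
rewrite (big_nat_widen _ _ _ _ _ le_d) big_geq_mkord.
by apply: eq_bigl => n; rewrite andbC.
Qed.

Lemma card_level rho m : 0 <= rho -> (m <= d)%N ->
  #|[pred n : 'I_(side rho d) | level (scale a rho) n == m]|%:R =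
  (side rho m)%:R - (side_prev rho m)%:R :> R.
Proof.
move=> rho0 md; have := sum_level (fun=> 1) rho0 md.
by rewrite !sumr_const !card_ord.
Qed.

(** The words read on each range of positions have means close to [alpha],
    hence frequencies whose projected entropy is nearly at most [H m]. *)
Lemma card_squares_le e0 : 0 < e0 -> exists2 e, 0 < e & forall N, exists rho1,
  forall rho, rho1 <= rho -> forall (I : finType) (z : I -> Sigma D),
  (forall x n, (N <= n)%N -> `|\sum_(i < n) v (z x i) - n%:R * alpha| <= n%:R * e) ->
  (forall x y, x != y -> ~ same_square (scale a rho) (z x) (z y)) ->
  #|I|%:R <= expR (rho * (dimension_value + e0)).
Proof.
move=> e0_gt0; pose e1 := e0 / (2 * inv_log d).
have e1_gt0 : 0 < e1 by rewrite divr_gt0// mulr_gt0// inv_log_gt0.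
have /choice[T TP] m : exists t, 0 < t /\ forall q, stochastic q ->
    `|mean v q - alpha| <= t ->
    shannon (image_law (@tail_letter _ _ D m) q) <= H m + e1.
  have [|t t0 tP] := @shannon_near_slice _ _ _ (@tail_letter _ _ D m) v alpha (H m) e1 _ e1_gt0.
    by move=> q sq mq; exact: max_entropy_ub.
  by exists t.
have T_gt0 m := proj1 (TP m).
have fin_min (F : nat -> R) : (forall m, (m <= d)%N -> 0 < F m) ->
    exists2 t, 0 < t & forall m, (m <= d)%N -> t <= F m.
  elim: (d) => [|n IHn] F0; first by exists (F 0%N); rewrite ?F0// => m; rewrite leqn0 => /eqP->.
  have [|t t0 tP] := IHn; first by move=> m mn; apply: F0; exact: leqW.
  exists (Num.min t (F n.+1)); first by rewrite lt_min t0 F0.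
  by move=> m; rewrite leq_eqVlt => /orP[/eqP->|/tP le]; rewrite ge_min ?lexx ?orbT// le.
have [t t_gt0 tP] := fin_min T (fun m _ => T_gt0 m).
have [g g_gt0 gP] := fin_min _ inv_log_gap_gt0.
have cd := inv_log_gt0 d.
(* The sum over a range is a difference of two initial sums, with error at most
   [2 * rho * inv_log d * e]; this is at most [t] times the length of the range,
   which is at least [rho * (g / 2)]. *)
pose e := t * (g / 2) / (2 * inv_log d).
have e_gt0 : 0 < e.
  by apply: divr_gt0; apply: mulr_gt0 => //; exact: divr_gt0.
exists e => // N.
pose K := \sum_(m < d.+1) (H m + e1).
have H1 m : 0 <= H m + e1 by rewrite addr_ge0 ?max_entropy_ge0// ltW.
have K0 : 0 <= K by apply: sumr_ge0.
have cmin m : (m <= d)%N -> g <= inv_log m.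
  move=> md; apply: le_trans (gP m md) _; rewrite /inv_log_gap gerBl.
  by case: m {md} => // m; exact/ltW/inv_log_gt0.
(* The three terms make the initial ranges longer than [N], make the gaps between
   scales absorb the rounding, and absorb the constant [K]. *)
pose rho1 := (N%:R + 1) / g + 2 / g + K / (e0 / 2).
have rho1_0 : 0 <= rho1.
  apply: addr_ge0; first apply: addr_ge0.
  - by rewrite divr_ge0 ?addr_ge0// ltW.
  - by rewrite divr_ge0// ltW.
  - by rewrite divr_ge0// divr_ge0// ltW.
exists rho1 => rho hrho I z avg sep.
have rho0 : 0 <= rho := le_trans rho1_0 hrho.
have [I0|I0] := posnP #|I|; first by rewrite I0 expR_ge0.
have g0 := ltW g_gt0.
have r1_ge0 : 0 <= (N%:R + 1) / g by rewrite divr_ge0// addr_ge0.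
have r2_ge0 : 0 <= 2 / g by rewrite divr_ge0.
have r3_ge0 : 0 <= K / (e0 / 2) by rewrite divr_ge0// divr_ge0// ltW.
have q1 : (N%:R + 1) / g <= rho by move: hrho; rewrite /rho1; lra.
have q2 : 2 / g <= rho by move: hrho; rewrite /rho1; lra.
have q3 : K / (e0 / 2) <= rho by move: hrho; rewrite /rho1; lra.
have rg1 : N%:R + 1 <= rho * g by rewrite -ler_pdivrMr.
have rg2 : 2 <= rho * g by rewrite -ler_pdivrMr.
have sideN m : (m <= d)%N -> (N <= side rho m)%N.
  move=> md; rewrite -(ler_nat R); apply: ltW; apply: le_lt_trans (side_gt rho m).
  have : rho * g <= rho * inv_log m by rewrite ler_wpM2l// cmin.
  lra.
have block_ge m : (m <= d)%N -> rho * (g / 2) <= (side rho m)%:R - (side_prev rho m)%:R.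
  move=> md; have h1 := side_gt rho m.
  have h2 : (side_prev rho m)%:R <= rho * inv_log_prev m.
    by case: m {md h1} => [|m]; rewrite ?mulr0//; exact: side_le.
  have := ler_wpM2l rho0 (gP m md); rewrite /inv_log_gap mulrBr.
  lra.
have block_le m : (m <= d)%N ->
    (side rho m)%:R - (side_prev rho m)%:R <= rho * inv_log_gap m + 1.
  move=> md; have h1 := side_le m rho0.
  have h2 : rho * inv_log_prev m - 1 <= (side_prev rho m)%:R.
    case: m {md h1} => [|m] /=; first by rewrite mulr0 sub0r lerN10.
    by rewrite ltW// side_gt.
  by rewrite /inv_log_gap mulrBr; lra.
pose lev (n : 'I_(side rho d)) : 'I_d.+1 := inord (level (scale a rho) n).
have ordd : inord d = ord_max :> 'I_d.+1 by apply/val_inj; rewrite /= inordK.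
have mono := scale_mono a_decr a_ge2 rho0.
have levE n : lev n = level (scale a rho) n :> nat.
  rewrite inordK// ltnS -[d in leqRHS]/(nat_of_ord (@ord_max d)) level_le//.
  by rewrite -ordd; exact: ltn_ord.
have lev_eq n (m : 'I_d.+1) : (lev n == m) = (level (scale a rho) n == m).
  by rewrite -levE.
have md (m : 'I_d.+1) : (m <= d)%N by rewrite -ltnS.
have cardE (m : 'I_d.+1) : #|[pred n | lev n == m]|%:R =
    (side rho m)%:R - (side_prev rho m)%:R :> R.
  by rewrite -card_level//; congr (_%:R); apply: eq_card => n; rewrite !inE lev_eq.
have := @card_classes_le R A 'I_d.+1 (fun m => tail a m) (fun m => @tail_letter _ _ D m)
  (side rho d) lev I (fun x n => z x n) v alpha t (fun m => H m + e1) I0 _ _ _ _.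
move=> cle.
have {cle} lnI : ln #|I|%:R <= \sum_(m < d.+1) #|[pred n | lev n == m]|%:R * (H m + e1).
  apply: cle.
  - move=> m; have : (0 < #|[pred n | lev n == m]|)%N.
      rewrite -(ltr_nat R) cardE; apply: lt_le_trans (block_ge m (md m)).
      by rewrite mulr_gt0 ?divr_gt0//; nra.
    by move=> /card_gt0P[n]; rewrite inE => /eqP <-; exists n.
  - move=> x y /sep ns; apply: contrapT => h; apply: ns.
    apply/same_squareP => // n nL; apply/eqP/negPn/negP => ne; apply: h.
    have nL' : (n < side rho d)%N by rewrite /side ordd.
    by exists (Ordinal nL'); move: ne; rewrite -(levE (Ordinal nL')).
  - move=> x m; rewrite (eq_bigl _ _ (fun n => lev_eq n m)) cardE.
    rewrite (sum_level (fun n => v (z x n) - alpha) rho0 (md m)).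
    have Sb n : (N <= n)%N || (n == 0%N) ->
        `|\sum_(i < n) (v (z x i) - alpha)| <= n%:R * e.
      rewrite sumrB sumr_const card_ord -[_ *+ _]mulr_natl.
      case/orP => [Nn|/eqP->]; first exact: avg.
      by rewrite big_ord0 !mul0r subrr normr0.
    have prevN : (N <= side_prev rho m)%N || (side_prev rho m == 0%N).
      case: (nat_of_ord m) (md m) => [|m'] /= m'd; first by rewrite orbT.
      by rewrite sideN// ltnW.
    apply: le_trans (ler_normB _ _) _.
    apply: (@le_trans _ _ ((side rho m)%:R * e + (side_prev rho m)%:R * e)).
      by apply: lerD; apply: Sb; rewrite ?prevN// sideN.
    have le1 : (side_prev rho m)%:R <= (side rho m)%:R :> R.
      by rewrite -subr_ge0; apply: le_trans (block_ge m (md m)); rewrite mulr_ge0// divr_ge0.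
    have le2 : (side rho m)%:R <= rho * inv_log d.
      apply: le_trans (side_le d rho0); rewrite ler_nat side_mono// md leqnn//.
    apply: (@le_trans _ _ (t * (rho * (g / 2)))).
      have -> : t * (rho * (g / 2)) = (rho * inv_log d) * e + (rho * inv_log d) * e.
        by rewrite /e; field; rewrite gt_eqF.
      by apply: lerD; rewrite ler_wpM2r ?(ltW e_gt0)// (le_trans le1).
    by rewrite ler_wpM2l ?(ltW t_gt0)// block_ge.
  - by move=> m q sq mq; apply: (proj2 (TP m)) => //; exact: le_trans mq (tP _ (md m)).
rewrite -[leLHS]lnK ?posrE ?ltr0n// ler_expR; apply: le_trans lnI _.
apply: (@le_trans _ _ (\sum_(m < d.+1) (rho * inv_log_gap m + 1) * (H m + e1))).
  by apply: ler_sum => m _; rewrite ler_wpM2r// cardE block_le.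
under eq_bigr do rewrite mulrDl mul1r.
rewrite big_split/= -/K.
have -> : \sum_(m < d.+1) rho * inv_log_gap m * (H m + e1) =
    rho * (dimension_value + e0 / 2).
  under eq_bigr do rewrite mulrDr.
  rewrite big_split/= -mulr_suml -mulr_sumr sum_inv_log_gap mulrDr; congr (_ + _).
    by rewrite /dimension_value mulr_sumr; apply: eq_bigr => m _; rewrite mulrA.
  by rewrite /e1; field; rewrite gt_eqF.
rewrite [in leRHS](splitr e0) addrA !mulrDr lerD2l.
by rewrite -ler_pdivrMr ?divr_gt0// mulrC.
Qed.

End counting.

(** * Packing measures and box counting *)

Section packing.
Context (R : realType) (n : nat).
Implicit Types (F E : set 'rV[R]_n) (s : R).

Lemma esum_le_seq (I : set nat) (f : nat -> R) (b : R) :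
  (forall l : seq nat, uniq l -> (forall i, i \in l -> I i) ->
    \sum_(i <- l) f i <= b) ->
  ((\esum_(i in I) (f i)%:E)%E <= b%:E)%E.
Proof.
move=> h; apply: ub_ereal_sup => _ [J [fJ JI] <-].
rewrite fsbig_finite//= sumEFin lee_fin; apply: h.
  exact: finmap.fset_uniq.
move=> i iJ; apply: JI; apply: set_mem.
by rewrite -(in_fset_set fJ).
Qed.

Lemma packing_sup_ge0 s delta E : (0 <= packing_sup s delta E)%E.
Proof.
apply: ereal_sup_ubound; exists set0, (fun=> 0), (fun=> 0); split.
  by split=> // i j [].
by rewrite esum_set0.
Qed.

Lemma packing_premeasure_ge0 s E : (0 <= packing_premeasure s E)%E.
Proof. by apply: le_ereal_inf_tmp => _ [delta _ <-]; exact: packing_sup_ge0. Qed.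

Lemma geometric_sum_le (b : R) N M : 0 < b < 1 ->
  \sum_(N <= m < M) b ^+ m <= b ^+ N / (1 - b).
Proof.
move=> /andP[b0 b1]; have b1' : 0 < 1 - b by rewrite subr_gt0.
have [NM|MN] := leqP N M; last first.
  by rewrite big_geq ?(ltnW MN)// divr_ge0 ?exprn_ge0// ltW.
suff : \sum_(N <= m < M) b ^+ m = (b ^+ N - b ^+ M) / (1 - b).
  by move=> ->; rewrite ler_pM2r ?invr_gt0// gerBl exprn_ge0// ltW.
rewrite -(subnKC NM); elim: (M - N)%N => [|k IHk].
  by rewrite addn0 big_geq// subrr mul0r.
rewrite addnS big_nat_recr ?leq_addr//= IHk exprS.
by field; rewrite gt_eqF.
Qed.

(** A packing by balls of radius about [exp (- m)] has a centre in each ball, and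
    no centre in another ball: a bound on the size of separated families at
    every small scale makes the packing sums converge. *)
Lemma packing_premeasure_eq0 F s s1 K N1 : 0 <= s -> s1 < s -> 0 < K ->
  (forall m, (N1 <= m)%N -> forall (I : finType) (c : I -> 'rV[R]_n),
    (forall x, F (c x)) ->
    (forall x y, x != y -> expR (- (m%:R + 1)) < Defs.edist (c x) (c y)) ->
    #|I|%:R <= K * expR (m%:R * s1)) ->
  packing_premeasure s F = 0%E.
Proof.
move=> s0 s1s K0 count; apply/eqP; rewrite eq_le packing_premeasure_ge0 andbT.
apply/lee_addgt0Pr => eta eta0; rewrite add0e.
pose t := s - s1; have t0 : 0 < t by rewrite subr_gt0.
pose b := expR (- t); have b0 : 0 < b := expR_gt0 _.
have b1 : b < 1 by rewrite expR_lt1 oppr_lt0.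
pose K2 := K * 2 `^ s; have K20 : 0 < K2 by rewrite mulr_gt0// powR_gt0.
have bE m : b ^+ m = expR (- (m%:R * t)) by rewrite /b -expRM_natl mulrN.
pose y := - ln (eta * (1 - b) / K2).
have ey0 : 0 < eta * (1 - b) / K2 by rewrite divr_gt0// mulr_gt0// subr_gt0.
pose N0 := maxn N1 (Num.truncn (`|y| / t)).+1.
have small : K2 * (b ^+ N0 / (1 - b)) <= eta.
  suff : b ^+ N0 <= eta * (1 - b) / K2.
    by rewrite ler_pdivlMr// mulrC mulrA ler_pdivrMr ?subr_gt0.
  rewrite bE -[leRHS]lnK ?posrE// ler_expR lerNl -/y.
  apply: le_trans (ler_norm _) _; rewrite -ler_pdivrMr//.
  apply: ltW; apply: lt_le_trans (truncnS_gt _) _; rewrite ler_nat.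
  exact: leq_maxr.
apply: (@le_trans _ _ (packing_sup s (expR (- N0%:R)) F)).
  by apply: ereal_inf_lbound; exists (expR (- N0%:R)) => //=; exact: expR_gt0.
apply: ub_ereal_sup => _ [I [c [r [[IF disj] ->]]]].
apply: esum_le_seq => l ul lI.
pose lv i := Num.truncn (- ln (r i)).
have rP i : i \in l -> [/\ 0 < r i, (N0 <= lv i)%N, r i <= expR (- (lv i)%:R) &
    expR (- ((lv i)%:R + 1)) < r i].
  move=> il; have [_ /andP[r0 rN]] := IF i (lI i il).
  have rE : r i = expR (ln (r i)) by rewrite lnK.
  have N0l : N0%:R <= - ln (r i) by rewrite lerNr -ler_expR -rE.
  have l0 : 0 <= - ln (r i) by apply: le_trans N0l.
  have /andP[h1 h2] := truncn_itv l0; split=> //.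
  - by rewrite truncn_ge_nat.
  - by rewrite [leLHS]rE ler_expR lerNr.
  - by rewrite [ltRHS]rE ltr_expR ltrNl natr1.
pose M := \max_(i <- l) lv i.
have lvM i : i \in l -> (lv i < M.+1)%N.
  by move=> il; rewrite ltnS; exact: leq_bigmax_seq.
have level_sum (m : 'I_M.+1) : \sum_(i <- l | inord (lv i) == m) (2 * r i) `^ s <=
    if (N0 <= m)%N then K2 * b ^+ m else 0.
  have lvE i : i \in l -> inord (lv i) == m -> lv i = m.
    by move=> il /eqP <-; rewrite inordK// lvM.
  case: ifPn => [N0m|nN0m]; last first.
    rewrite big_seq_cond big1// => i /andP[il /(lvE _ il) lvm].
    by have [_ + _ _] := rP _ il; rewrite lvm (negbTE nN0m).
  pose l' := [seq i <- l | inord (lv i) == m].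
  have l'P i : i \in l' -> i \in l /\ lv i = m.
    by rewrite mem_filter => /andP[im il]; split=> //; exact: lvE.
  have ul' : uniq l' by rewrite filter_uniq.
  have cnt : (size l')%:R <= K * expR (m%:R * s1).
    have := count m (leq_trans (leq_maxl _ _) N0m) 'I_(size l') (fun x => c (nth 0%N l' x)).
    rewrite card_ord; apply.
      by move=> x; have [il _] := l'P _ (mem_nth 0%N (ltn_ord x)); have [] := IF _ (lI _ il).
    move=> x x' xx'; have [il lvx] := l'P _ (mem_nth 0%N (ltn_ord x)).
    have [il' _] := l'P _ (mem_nth 0%N (ltn_ord x')).
    have [_ _ _ rgt] := rP _ il; rewrite -lvx; apply: lt_le_trans rgt _.
    rewrite leNgt; apply/negP => lt.
    have ne : nth 0%N l' x != nth 0%N l' x' by rewrite nth_uniq.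
    move/eqP: ne; apply; apply: disj (lI _ il) (lI _ il') _.
    exists (c (nth 0%N l' x')); split=> /=; first by rewrite /eball/= ltW.
    have [_ /andP[r0 _]] := IF _ (lI _ il').
    rewrite /eball/= /Defs.edist big1 ?sqrtr0 ?ltW// => j _.
    by rewrite subrr expr0n.
  rewrite -big_filter -/l'.
  apply: (@le_trans _ _ (\sum_(i <- l') (2 * expR (- m%:R)) `^ s)).
    rewrite !(big_seq_cond xpredT); apply: ler_sum => i /andP[il' _].
    have [il lvi] := l'P _ il'; have [r0 _ + _] := rP _ il; rewrite lvi => rle.
    apply: ge0_ler_powR => //; rewrite ?nnegrE ?mulr_ge0 ?expR_ge0 ?(ltW r0)//.
    by rewrite ler_pM2l.
  rewrite big_const_seq count_predT iter_addr_0 -[_ *+ _]mulr_natl.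
  rewrite powRM ?expR_ge0// -expRM.
  apply: (@le_trans _ _ (K * expR (m%:R * s1) * (2 `^ s * expR (- m%:R * s)))).
    by rewrite ler_wpM2r// mulr_ge0 ?powR_ge0 ?expR_ge0.
  rewrite bE /K2 le_eqVlt; apply/orP; left; apply/eqP.
  rewrite [LHS](_ : _ = K * 2 `^ s * (expR (m%:R * s1) * expR (- m%:R * s))); last by ring.
  by rewrite -expRD; congr (_ * expR _); rewrite /t; ring.
rewrite (partition_big (fun i => inord (lv i) : 'I_M.+1) xpredT)//=.
apply: le_trans (ler_sum _ (fun m _ => level_sum m)) _.
rewrite -big_mkcond -(big_geq_mkord _ _ xpredT (fun m => K2 * b ^+ m)).
rewrite -mulr_sumr; apply: le_trans small.
by rewrite ler_pM2l// geometric_sum_le// b0 b1.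
Qed.

Lemma packing_measure_eq0 E s (F : nat -> set 'rV[R]_n) :
  E `<=` \bigcup_i F i -> (forall i, packing_premeasure s (F i) = 0%E) ->
  packing_measure s E = 0%E.
Proof.
move=> EF F0; apply/eqP; rewrite eq_le; apply/andP; split.
  apply: ereal_inf_lbound; exists F; split=> //.
  by rewrite eseries0.
apply: le_ereal_inf_tmp => _ [G [_ ->]]; apply: nneseries_ge0 => i _ _.
exact: packing_premeasure_ge0.
Qed.

Lemma packing_dim_le E s0 : 0 <= s0 ->
  (forall s, s0 < s -> packing_measure s E = 0%E) -> (packing_dim E <= s0%:E)%E.
Proof.
move=> s0_ge0 h; apply/lee_addgt0Pr => e e0; apply: ereal_inf_lbound.
exists (s0 + e) => //; split; first by rewrite addr_ge0// ltW.
by apply: h; rewrite ltrDl.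
Qed.

End packing.

Section upper_bound.
Context (R : realType) (d : nat) (a : 'I_d.+1 -> nat).
Hypothesis a_decr : forall q r : 'I_d.+1, (q < r)%N -> (a r < a q)%N.
Hypothesis a_ge2 : forall q, (2 <= a q)%N.
Context (D : neset (digit a)).
Notation A := (alphabet D).
Context (v : A -> R) (alpha : R).
Hypothesis slice_ex : exists q, on_slice v alpha q.
Notation dimS := (dimension_value v alpha).

(** The rate of convergence of the averages depends on the point: the count
    applies to the points with a given rate at one tolerance, countably many
    sets of which cover [E]. *)
Lemma packing_dim_ub (E : set 'rV[R]_d.+1) :
  (forall x, E x -> exists2 w : Sigma D, x = coding D R w & birkhoff_limit v alpha w) ->
  (packing_dim E <= dimS%:E)%E.
Proof.
move=> EP; have dim0 := dimension_value_ge0 a_decr a_ge2 slice_ex.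
apply: packing_dim_le => // s dims.
pose e0 := (s - dimS) / 2; have e0_gt0 : 0 < e0 by rewrite divr_gt0// subr_gt0.
have [e e_gt0 eP] := card_squares_le a_decr a_ge2 slice_ex e0_gt0.
pose F N : set 'rV[R]_d.+1 := [set x | exists2 w : Sigma D, x = coding D R w &
  forall n, (N <= n)%N -> `|\sum_(i < n) v (w i) - n%:R * alpha| <= n%:R * e].
apply: (@packing_measure_eq0 _ _ _ _ F).
  by move=> x /EP[w -> /(_ e e_gt0)[N NP]]; exists N => //; exists w.
move=> N; have [rho1 cnt] := eP N.
pose C := 1 + diam_shift R a.
apply: (@packing_premeasure_eq0 _ _ _ s (dimS + e0) (expR (C * (dimS + e0)))
  (Num.truncn `|rho1|).+1).
- exact: le_trans dim0 (ltW dims).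
- by rewrite /e0; lra.
- exact: expR_gt0.
move=> m hm I c cF sep.
have /choice[z zP] x : exists w : Sigma D, c x = coding D R w /\
    forall n, (N <= n)%N -> `|\sum_(i < n) v (w i) - n%:R * alpha| <= n%:R * e.
  by have [w cw wP] := cF x; exists w.
have := cnt (m%:R + C) _ I z (fun x => proj2 (zP x)) _.
rewrite -expRD -mulrDl [C + _]addrC; apply.
  apply: le_trans (ler_norm _) _; apply: ltW; apply: lt_le_trans (truncnS_gt _) _.
  apply: (@le_trans _ _ m%:R); first by rewrite ler_nat.
  by rewrite lerDl addr_ge0// diam_shift_ge0.
move=> x y xy same; have := sep x y xy; apply/negP; rewrite -leNgt.
rewrite (proj1 (zP x)) (proj1 (zP y)).
by apply: (edist_same_square a_ge2); rewrite -addrA.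
Qed.

End upper_bound.

(** * Blocks of increasing lengths *)

Definition block_start (j : nat) : nat := \sum_(i < j) i.

Lemma block_startS j : block_start j.+1 = (block_start j + j)%N.
Proof. by rewrite /block_start big_ord_recr. Qed.

Lemma block_start_mono i j : (i <= j)%N -> (block_start i <= block_start j)%N.
Proof.
move=> /subnKC <-; elim: (j - i)%N => [|k IHk]; first by rewrite addn0.
by rewrite addnS block_startS (leq_trans IHk)// leq_addr.
Qed.

Lemma block_start_double j : ((block_start j).*2 = j * j.-1)%N.
Proof.
elim: j => [|j IHj]; first by rewrite /block_start big_ord0.
by rewrite block_startS doubleD IHj/=; case: j {IHj} => //= j; nia.
Qed.

Lemma block_index n : exists J, (block_start J <= n < block_start J.+1)%N.
Proof.
have ex : exists J, (n < block_start J.+1)%N.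
  by exists n.+1; rewrite block_startS addnS ltnS leq_addl.
case: (ex_minnP ex) => -[|J] lt min; exists 0%N + exists J.+1; rewrite lt andbT.
  by rewrite /block_start big_ord0.
by rewrite leqNgt; apply/negP => /min; rewrite ltnn.
Qed.

Lemma block_index_unique J j i :
  (block_start J <= block_start j + i < block_start J.+1)%N -> (i < j)%N -> J = j.
Proof.
move=> /andP[h1 h2] ij; apply/eqP; case: ltngtP => // lt.
  by have := block_start_mono lt; lia.
by have := block_start_mono lt; rewrite block_startS; lia.
Qed.

Lemma sum_blocks (V : nmodType) (F : nat -> V) J :
  \sum_(i < block_start J) F i = \sum_(j < J) \sum_(i < j) F (block_start j + i)%N.
Proof.
elim: J => [|J IHJ]; first by rewrite /block_start !big_ord0.
by rewrite block_startS big_split_ord/= IHJ big_ord_recr.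
Qed.

Lemma block_index_small (R : realType) (t : R) J n : 0 < t ->
  (block_start J <= n)%N -> J%:R <= t * n%:R + (1 + 2 / t).
Proof.
move=> t0 Jn; have tv : 0 < 2 / t by rewrite divr_gt0.
have nR : (block_start J)%:R <= n%:R :> R by rewrite ler_nat.
have [Jle|Jgt] := leP J%:R (1 + 2 / t).
  by rewrite ler_wpDl// mulr_ge0// ltW.
rewrite ler_wpDr// ?addr_ge0 ?(ltW tv)//.
apply: (@le_trans _ _ (t * (block_start J)%:R)); last by rewrite ler_wpM2l// ltW.
case: J Jgt Jn nR => [|J]; first by move=> h; have := lt_trans (ltr_pwDl ltr01 (ltW tv)) h; rewrite ltxx.
rewrite -[J.+1%:R]natr1 => Jgt _ _.
have := congr1 (fun k => k%:R : R) (block_start_double J.+1).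
rewrite -mul2n !natrM/= -[J.+1%:R]natr1 => bE.
have J2 : 2 / t < J%:R by lra.
move: J2; rewrite ltr_pdivrMr// => J2.
have -> : (block_start J.+1)%:R = (J%:R + 1) * J%:R / 2 :> R by rewrite -bE; field.
have J0 : 0 <= J%:R :> R by [].
nra.
Qed.

Section block_set.
Context (R : realType) (T : finType) (E : neset T).
Notation A := (alphabet E).
Context (v : A -> R) (alpha : R) (C : R).
Implicit Types w u : nat -> A.

Definition block_error w j : R := \sum_(i < j) (v (w (block_start j + i)%N) - alpha).

(** The conditions on different blocks are independent, so that the words of
    distinct blocks can be chosen freely; each of them depends on finitely many
    letters, so that these codes form a closed set. *)
Definition balanced w : Prop := forall j, `|block_error w j| <= C.

(** At time [n] only [O(sqrt n)] blocks have been met, each with a bounded error. *)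
Lemma birkhoff_balanced w : balanced w -> birkhoff_limit v alpha w.
Proof.
move=> bw e e0.
have C0 : 0 <= C := le_trans (normr_ge0 _) (bw 0%N).
pose C2 := `|alpha| + \sum_a `|v a|.
have C20 : 0 <= C2 by rewrite addr_ge0// sumr_ge0.
have vC n : `|v (w n) - alpha| <= C2.
  apply: le_trans (ler_normB _ _) _; rewrite addrC lerD2l.
  by rewrite (bigD1 (w n))//= lerDl sumr_ge0.
pose M := C + C2 + 1; have M0 : 0 < M by rewrite ltr_wpDl// addr_ge0.
pose t := e / (2 * M); have t0 : 0 < t by rewrite divr_gt0// mulr_gt0.
exists (Num.truncn (M * (1 + 2 / t) / (e / 2))).+1 => n hn.
have {hn} hn : M * (1 + 2 / t) <= n%:R * (e / 2).
  rewrite -ler_pdivrMr ?divr_gt0//; apply: ltW.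
  by apply: lt_le_trans (truncnS_gt _) _; rewrite ler_nat.
have [J /andP[Jn nJ]] := block_index n.
have sE : \sum_(i < n) v (w i) - n%:R * alpha = \sum_(i < n) (v (w i) - alpha).
  by rewrite sumrB sumr_const card_ord -[alpha *+ _]mulr_natl.
have nE : n = (block_start J + (n - block_start J))%N by rewrite subnKC.
rewrite sE.
have -> : \sum_(i < n) (v (w i) - alpha) =
    \sum_(i < block_start J + (n - block_start J)) (v (w i) - alpha) by rewrite -nE.
rewrite big_split_ord/= (sum_blocks (fun i => v (w i) - alpha)).
apply: le_trans (ler_normD _ _) _.
have h1 : `|\sum_(j < J) \sum_(i < j) (v (w (block_start j + i)%N) - alpha)| <= J%:R * C.
  apply: le_trans (ler_norm_sum _ _ _) _.
  apply: (@le_trans _ _ (\sum_(j < J) C)); first by apply: ler_sum => j _; exact: bw.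
  by rewrite sumr_const card_ord -[_ *+ _]mulr_natl.
have h2 : `|\sum_(i < n - block_start J) (v (w (block_start J + i)%N) - alpha)| <= J%:R * C2.
  apply: le_trans (ler_norm_sum _ _ _) _.
  apply: (@le_trans _ _ (\sum_(i < n - block_start J) C2)); first exact: ler_sum.
  rewrite sumr_const card_ord -[_ *+ _]mulr_natl ler_wpM2r// ler_nat.
  by rewrite block_startS in nJ; lia.
apply: le_trans (lerD h1 h2) _; rewrite -mulrDr.
have h3 := block_index_small t0 Jn.
apply: (@le_trans _ _ (J%:R * M)); first by rewrite ler_wpM2l// lerDl.
apply: (@le_trans _ _ ((t * n%:R + (1 + 2 / t)) * M)); first by rewrite ler_wpM2r// ltW.
rewrite mulrDl [_ * M in X in _ + X]mulrC.
have -> : t * n%:R * M = n%:R * (e / 2) by rewrite /t; field; rewrite gt_eqF.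
have -> : n%:R * e = n%:R * (e / 2) + n%:R * (e / 2) by rewrite -mulrDr -splitr.
by rewrite lerD2l.
Qed.

Definition splice w j u : nat -> A := fun n =>
  if (block_start j <= n < block_start j.+1)%N then u (n - block_start j)%N else w n.

Lemma splice_in w j u i : (i < j)%N -> splice w j u (block_start j + i)%N = u i.
Proof. by move=> ij; rewrite /splice leq_addr block_startS ltn_add2l ij addKn. Qed.

Lemma splice_out w j u j' i : j' != j -> (i < j')%N ->
  splice w j u (block_start j' + i)%N = w (block_start j' + i)%N.
Proof.
move=> jj' ij'; rewrite /splice; case: ifP => // /block_index_unique/(_ ij') jE.
by rewrite jE eqxx in jj'.
Qed.

Lemma splice_agree w j u n : (n <= block_start j)%N -> agree n w (splice w j u).
Proof.
move=> nj i ilt; rewrite /splice; case: ifP => // /andP[h _].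
by have := leq_trans ilt (leq_trans nj h); rewrite ltnn.
Qed.

Lemma balanced_splice w j u : balanced w ->
  `|\sum_(i < j) (v (u i) - alpha)| <= C -> balanced (splice w j u).
Proof.
move=> bw bu j'; rewrite /block_error; have [->|ne] := eqVneq j' j.
  by under eq_bigr => i _ do rewrite splice_in//.
by under eq_bigr => i _ do rewrite splice_out//; exact: bw.
Qed.

Lemma exists_balanced :
  (forall j, exists u : nat -> A, `|\sum_(i < j) (v (u i) - alpha)| <= C) ->
  exists w, balanced w.
Proof.
move=> /choice[u uP]; have [J JP] := choice block_index.
exists (fun n => u (J n) (n - block_start (J n))%N) => j.
rewrite /block_error (eq_bigr (fun i : 'I_j => v (u j i) - alpha)) => [|i _].
  exact: uP.
by rewrite (block_index_unique (JP _))// addKn.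
Qed.

Lemma balanced_closed w : (forall n, exists2 w', balanced w' & agree n w' w) -> balanced w.
Proof.
move=> h j; have [w' bw' ww'] := h (block_start j.+1).
have -> // : block_error w j = block_error w' j.
apply: eq_bigr => i _; rewrite ww'// block_startS ltn_add2l; exact: ltn_ord.
Qed.

(** Baire's theorem for the closed set of balanced codes: some [F i] is dense in
    the cylinder of the first [n0] letters of [w0]. *)
Lemma baire_balanced (F : nat -> set (nat -> A)) : (exists w, balanced w) ->
  (forall w, balanced w -> exists i, F i w) ->
  exists i w0 n0, balanced w0 /\ forall w, balanced w -> agree n0 w0 w ->
    forall n, exists w', [/\ balanced w', agree n w w' & F i w'].
Proof.
move=> [wI bwI] cov; apply: contrapT => nope.
have step (i : nat) (s : (nat -> A) * nat) : exists s' : (nat -> A) * nat, balanced s.1 ->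
    [/\ balanced s'.1, agree s.2 s.1 s'.1, (s.2 < s'.2)%N &
      forall w', balanced w' -> agree s'.2 s'.1 w' -> ~ F i w'].
  have [bs|nbs] := pselect (balanced s.1); last by exists s.
  apply: contrapT => nex; apply: nope; exists i, s.1, s.2; split=> // w bw ag n.
  apply: contrapT => nw'; apply: nex; exists (w, maxn n s.2.+1) => _; split=> //=.
    exact: leq_maxr.
  move=> w' bw' ww' Fw'; apply: nw'; exists w'; split=> //.
  by apply: agree_le ww'; exact: leq_maxl.
have [f fP] := choice (fun i : nat * ((nat -> A) * nat) => step i.1 i.2).
(* [s i] is a balanced code with the length of a cylinder; the next cylinder is
   longer and avoids [F i]. *)
pose s := fix s (i : nat) : (nat -> A) * nat := if i is i'.+1 then f (i', s i') else (wI, 0%N).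
have bs i : balanced (s i).1.
  by elim: i => //= i IHi; have [] := fP (i, s i) IHi.
have sS i := fP (i, s i) (bs i).
have ge i : (i <= (s i).2)%N.
  by elim: i => // i IHi; have [_ _ lt _] := sS i; exact: leq_ltn_trans IHi lt.
have nondecr i k : ((s i).2 <= (s (i + k)%N).2)%N.
  elim: k => [|k IHk]; first by rewrite addn0.
  by rewrite addnS; have [_ _ lt _] := sS (i + k)%N; exact: leq_trans IHk (ltnW lt).
have ag i k : agree (s i).2 (s i).1 (s (i + k)%N).1.
  elim: k => [|k IHk]; first by rewrite addn0.
  move=> n nlt; rewrite IHk// addnS; have [_ h _ _] := sS (i + k)%N.
  by apply: h; exact: leq_trans nlt (nondecr i k).
pose w n := (s n.+1).1 n.
have agw i : agree (s i).2 (s i).1 w.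
  move=> n nlt; rewrite /w; have [le|lt] := leqP i n.+1.
    by have := ag i (n.+1 - i)%N n nlt; rewrite (subnKC le).
  by have := ag n.+1 (i - n.+1)%N n (ge n.+1); rewrite (subnKC (ltnW lt)) => ->.
have bw : balanced w.
  apply: balanced_closed => n; exists (s n).1 => //.
  by apply: agree_le (agw n); exact: ge.
have [i Fiw] := cov w bw; have [_ _ _ av] := sS i.
exact: av w bw (agw i.+1) Fiw.
Qed.

End block_set.

(** * The lower bound *)

Section lower_bound.
Context (R : realType) (d : nat) (a : 'I_d.+1 -> nat).
Hypothesis a_decr : forall q r : 'I_d.+1, (q < r)%N -> (a r < a q)%N.
Hypothesis a_ge2 : forall q, (2 <= a q)%N.
Context (D : neset (digit a)).
Notation A := (alphabet D).
Context (v : A -> R) (alpha : R).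
Hypothesis slice_ex : exists q, on_slice v alpha q.
Notation H := (max_entropy v alpha).
Notation dimS := (dimension_value v alpha).
Notation lvl rho := (level (@scale R d a rho)).

Definition word_error : R := #|{: A}|%:R * \sum_i `|v i|.

(** The freedom available in a block of length [j] at whose positions the
    coordinates of index at least [m] matter. *)
Definition many_words (c : R) (m j : nat) (e : R) : Prop :=
  exists (I : finType) (u : I -> nat -> A),
  [/\ forall x, `|\sum_(i < j) (v (u x i) - alpha)| <= c,
      forall x y, x != y -> exists2 i, (i < j)%N & tail_letter m (u x i) != tail_letter m (u y i) &
      expR (j%:R * (H m - e)) <= #|I|%:R].

Lemma exists_many_words e : 0 < e ->
  exists j0, forall j, (j0 <= j)%N -> forall m, (m <= d)%N -> many_words word_error m j e.
Proof.
move=> e0; have e2 : 0 < e / 2 by rewrite divr_gt0.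
have /choice[j0 j0P] m : exists j0, forall j, (j0 <= j)%N -> many_words word_error m j e.
  have [q [sq mq] qH] := max_entropy_adherent m slice_ex e2.
  have [j0 jP] := block_words (@tail_letter _ _ D m) v sq e2.
  exists j0 => j /jP[I [u [u1 u2 u3]]]; exists I, u; split=> //; first by rewrite -mq.
  apply: le_trans u3; rewrite ler_expR ler_wpM2l//.
  by have := splitr e; lra.
exists (\max_(m < d.+1) j0 m) => j jj0 m md; apply: j0P.
by apply: leq_trans jj0; exact: (leq_bigmax (Ordinal (md : (m < d.+1)%N))).
Qed.

(** Splicing independently chosen words into the blocks satisfying [P] multiplies
    the numbers of choices. *)
Lemma balanced_family (C e : R) (P : pred nat) (ml : nat -> nat) (w0 : nat -> A) n0 :
  (forall j, P j -> many_words C (ml j) j e) -> (forall j, P j -> (n0 <= block_start j)%N) ->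
  balanced v alpha C w0 -> forall J, exists (I : finType) (z : I -> nat -> A),
  [/\ forall x, balanced v alpha C (z x), forall x, agree n0 w0 (z x),
      forall x y, x != y -> exists j i, [/\ (j < J)%N, P j, (i < j)%N &
        tail_letter (ml j) (z x (block_start j + i)%N) !=
        tail_letter (ml j) (z y (block_start j + i)%N)] &
      expR (\sum_(j < J | P j) j%:R * (H (ml j) - e)) <= #|I|%:R].
Proof.
move=> mw Pn0 bw0; elim=> [|J [I [z [zb za zs zc]]]].
  exists unit, (fun=> w0); split=> //.
  by rewrite big_ord0 expR0 card_unit.
have [PJ|nPJ] := boolP (P J); last first.
  exists I, z; split=> //.
    by move=> x y /zs[j [i [jJ Pj ij ne]]]; exists j, i; split=> //; exact: leqW.
  by rewrite big_mkcond big_ord_recr/= (negbTE nPJ) addr0 -big_mkcond.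
have [I' [u [u1 u2 u3]]] := mw J PJ.
exists (I * I')%type, (fun x => splice (z x.1) J (u x.2)); split.
- by move=> x; exact: balanced_splice.
- move=> x i ilt; rewrite (za x.1)//.
  by apply: (splice_agree (z x.1) (u x.2) (Pn0 J PJ)).
- move=> [x x'] [y y'] /=; rewrite xpair_eqE negb_and.
  have [<-{y} /= x'y'|xy _] := eqVneq x y.
    have [i iJ ne] := u2 _ _ x'y'; exists J, i; split=> //.
    by rewrite !splice_in.
  have [j [i [jJ Pj ij ne]]] := zs _ _ xy; exists j, i; split=> //; first exact: leqW.
  by rewrite !splice_out// ltn_eqF.
- rewrite big_mkcond big_ord_recr/= PJ -big_mkcond expRD card_prod natrM.
  by apply: ler_pM => //; exact: expR_ge0.
Qed.

(** The entropies decrease with the level; by summation by parts, the dimension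
    value weighs each drop by the length of the range of positions where it has
    not occurred yet. *)
Definition drop (q : nat) : R := H q - (if (q < d)%N then H q.+1 else 0).

Lemma drop_ge0 q : 0 <= drop q.
Proof.
rewrite /drop; case: ifP => _; rewrite ?subr0 ?subr_ge0.
  exact: max_entropy_decr.
exact: max_entropy_ge0.
Qed.

Lemma sum_drop m : (m <= d)%N -> \sum_(q < d.+1 | (m <= q)%N) drop q = H m.
Proof.
move=> md; pose F q := if (q <= d)%N then H q else 0.
rewrite -(big_geq_mkord _ _ xpredT drop).
rewrite (eq_big_nat _ _ (F2 := fun q => - (F q.+1 - F q))) => [|q /andP[_ qd]]; last first.
  have qd' : (q <= d)%N by rewrite -ltnS.
  by rewrite /drop /F qd' opprB.
by rewrite sumrN (telescope_sumr F (leqW md)) /F ltnn md sub0r opprK.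
Qed.

Lemma dimension_value_drop : dimS = \sum_(q < d.+1) inv_log R a q * drop q.
Proof.
rewrite /dimension_value.
have E1 (m : 'I_d.+1) : true -> inv_log_gap R a m * H m =
    \sum_(q < d.+1 | (m <= q)%N) inv_log_gap R a m * drop q.
  by move=> _; rewrite -(sum_drop (_ : m <= d)%N) ?mulr_sumr// -ltnS.
rewrite (eq_bigr _ E1) (exchange_big_dep xpredT)//=; apply: eq_bigr => q _.
rewrite -mulr_suml -sum_inv_log_gap; congr (_ * _).
rewrite [RHS](big_ord_widen _ (inv_log_gap R a) (ltn_ord q)).
by apply: eq_bigl => m.
Qed.

(** Only the complete blocks before the last prescribed position are filled. Such
    a block gets the level of its last position, the largest of its levels: two
    words with distinct projections at that level then differ in a coordinate
    that the approximate square prescribes. *)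
Definition used_block (rho : R) j1 j : bool :=
  (j1 <= j)%N && (block_start j.+1 <= side a rho d)%N.

Definition block_level (rho : R) j : nat := lvl rho (block_start j.+1).-1.

Lemma block_level_le rho j q : 0 <= rho -> (0 < j)%N -> (q <= d)%N ->
  (block_level rho j <= q)%N = (block_start j.+1 <= side a rho q)%N.
Proof.
move=> rho0 j0 qd; have mono := scale_mono a_decr a_ge2 rho0.
have := level_le (block_start j.+1).-1 (inord q) mono; rewrite inordK// => ->.
by rewrite /side prednK// block_startS addn_gt0 j0 orbT.
Qed.

(** The last block meeting a range is the only incomplete one. *)
Lemma used_blocks_ge rho j1 q t : 0 <= rho -> (q <= d)%N -> 0 < t ->
  (side a rho q)%:R * (1 - t) - (1 + 2 / t) - (block_start j1)%:R <=
  \sum_(j < (side a rho d).+1 | used_block rho j1 j && (block_start j.+1 <= side a rho q)%N)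
    j%:R :> R.
Proof.
move=> rho0 qd t0; set L := side a rho q.
have [J /andP[JL LJ]] := block_index L.
have Ld : (L <= side a rho d)%N by apply: side_mono; rewrite // qd leqnn.
have JLd : (J <= (side a rho d).+1)%N.
  case: J JL {LJ} => // J JL; rewrite ltnS; apply: leq_trans Ld; apply: leq_trans JL.
  by rewrite block_startS leq_addl.
apply: (@le_trans _ _ (\sum_(j1 <= j < J) j%:R)).
  have h : (block_start J)%:R - (block_start j1)%:R <= \sum_(j1 <= j < J) j%:R :> R.
    have [j1J|/ltnW Jj1] := leqP j1 J; last first.
      by rewrite big_geq// subr_le0 ler_nat block_start_mono.
    rewrite lerBlDl /block_start -!(big_mkord xpredT id) !natr_sum.
    by rewrite (big_cat_nat (leq0n _) j1J)/=.
  have := block_index_small t0 JL; have : L%:R < (block_start J)%:R + J%:R :> R.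
    by rewrite -natrD -block_startS ltr_nat.
  by move: h; lra.
rewrite (big_nat_widen _ _ _ _ _ JLd) big_geq_mkord.
rewrite big_mkcond [leRHS]big_mkcond; apply: ler_sum => j _.
case: ifP => [/andP[jJ j1j]|_]; last by case: ifP.
rewrite /used_block j1j /=.
have jL : (block_start j.+1 <= L)%N by apply: leq_trans JL; exact: block_start_mono.
by rewrite jL (leq_trans jL Ld).
Qed.

Lemma used_blocks_le rho j1 :
  \sum_(j < (side a rho d).+1 | used_block rho j1 j) j%:R <= (side a rho d)%:R :> R.
Proof.
have [J /andP[JL LJ]] := block_index (side a rho d).
have JLd : (J <= (side a rho d).+1)%N.
  case: J JL {LJ} => // J JL; rewrite ltnS; apply: leq_trans JL.
  by rewrite block_startS leq_addl.
apply: (@le_trans _ _ (block_start J)%:R); last by rewrite ler_nat.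
rewrite /block_start natr_sum (big_ord_widen _ (fun j => j%:R) JLd).
rewrite big_mkcond [leRHS]big_mkcond; apply: ler_sum => j _.
case: ifP => [/andP[_ jL]|_]; last by case: ifP.
case: ltnP => // Jj; have := leq_trans LJ (block_start_mono (_ : J.+1 <= j.+1)%N).
by move=> /(_ Jj)/leq_trans/(_ jL); rewrite ltnn.
Qed.

(** The filled blocks cover each range of positions up to a small proportion of
    its end, so that the choices in them give the exponent [rho * dimS] up to a
    small proportion. *)
Lemma exponent_ge e' : 0 < e' -> exists2 e : R, 0 < e & forall j1, (0 < j1)%N ->
  exists rho1 : R, forall rho, rho1 <= rho -> 0 <= rho /\
    rho * (dimS - e') <= \sum_(j < (side a rho d).+1 | used_block rho j1 j)
      j%:R * (H (block_level rho j) - e).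
Proof.
move=> e'0; have cd := inv_log_gt0 R a_ge2 d.
have dim0 := dimension_value_ge0 a_decr a_ge2 slice_ex.
pose e := e' / (4 * inv_log R a d); have e_gt0 : 0 < e by rewrite divr_gt0// mulr_gt0.
exists e => // j1 j1_gt0.
(* The choice of [M] gives [t <= 1] and [t * dimS <= e' / 4]. *)
pose M := 4 * (dimS + 1) + e'.
have M0 : 0 < M by rewrite ltr_wpDl// mulr_ge0// addr_ge0.
pose t := e' / M; have t0 : 0 < t by rewrite divr_gt0.
have t1 : t <= 1 by rewrite ler_pdivrMr// mul1r lerDr mulr_ge0// addr_ge0.
have tdim : t * dimS <= e' / 4.
  rewrite /t mulrAC ler_pdivrMr// /M.
  have : 0 <= e' * dimS by rewrite mulr_ge0// ltW.
  have := sqr_ge0 e'; have -> : e' / 4 * (4 * (dimS + 1) + e') = e' * dimS + e' + e' ^+ 2 / 4 by field.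
  lra.
pose K := \sum_(q < d.+1) drop q * (1 - t + (1 + 2 / t) + (block_start j1)%:R).
exists (`|K| / (e' / 2)) => rho hrho.
have rho0 : 0 <= rho by apply: le_trans hrho; rewrite divr_ge0// divr_ge0// ltW.
split=> //.
have Krho : K <= rho * (e' / 2).
  by apply: le_trans (ler_norm _) _; rewrite -ler_pdivrMr// divr_gt0.
under eq_bigr do rewrite mulrBr; rewrite sumrB -mulr_suml.
have eterm : (\sum_(j < (side a rho d).+1 | used_block rho j1 j) j%:R) * e <= rho * (e' / 4).
  apply: (@le_trans _ _ (rho * inv_log R a d * e)).
    by rewrite ler_wpM2r ?(ltW e_gt0)// (le_trans (used_blocks_le _ _))// side_le.
  by rewrite /e le_eqVlt; apply/orP; left; apply/eqP; field; rewrite gt_eqF.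
suff main : rho * dimS * (1 - t) - K <= \sum_(j < (side a rho d).+1 | used_block rho j1 j)
    j%:R * H (block_level rho j).
  have h : rho * (t * dimS) <= rho * (e' / 4) by rewrite ler_wpM2l.
  move: main h eterm Krho; rewrite !mulrBr mulr1 -[rho * dimS * t]mulrA [dimS * t]mulrC.
  have -> : rho * e' = rho * (e' / 4) + rho * (e' / 4) + rho * (e' / 2) by field.
  lra.
have E1 (j : 'I_(side a rho d).+1) : used_block rho j1 j -> j%:R * H (block_level rho j) =
    \sum_(q < d.+1 | (block_start j.+1 <= side a rho q)%N) j%:R * drop q.
  move=> /andP[j1j jd]; have j_gt0 : (0 < j)%N := leq_trans j1_gt0 j1j.
  rewrite -mulr_sumr -(@sum_drop (block_level rho j)); last by rewrite block_level_le.
  by congr (_ * _); apply: eq_bigl => q; rewrite block_level_le// -ltnS.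
rewrite (eq_bigr _ E1) (exchange_big_dep xpredT)//=.
have -> : rho * dimS * (1 - t) - K = \sum_(q < d.+1)
   drop q * (rho * inv_log R a q * (1 - t) - (1 - t + (1 + 2 / t) + (block_start j1)%:R)).
  rewrite /K mulrAC dimension_value_drop mulr_sumr -sumrB.
  by apply: eq_bigr => q _; ring.
apply: ler_sum => q _; rewrite -mulr_suml [leRHS]mulrC ler_wpM2l ?drop_ge0//.
have qd : (q <= d)%N by rewrite -ltnS.
apply: le_trans (used_blocks_ge j1 rho0 qd t0).
have : (rho * inv_log R a q - 1) * (1 - t) <= (side a rho q)%:R * (1 - t).
  by rewrite ler_wpM2r ?subr_ge0// ltW// side_gt.
lra.
Qed.

End lower_bound.

Section packing_lower_bound.
Context (R : realType) (d : nat) (a : 'I_d.+1 -> nat).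
Hypothesis a_decr : forall q r : 'I_d.+1, (q < r)%N -> (a r < a q)%N.
Hypothesis a_ge2 : forall q, (2 <= a q)%N.
Context (D : neset (digit a)).
Hypothesis vssc : very_strong_separation D.
Notation A := (alphabet D).
Context (v : A -> R) (alpha : R).
Hypothesis slice_ex : exists q, on_slice v alpha q.
Notation H := (max_entropy v alpha).
Notation dimS := (dimension_value v alpha).
Implicit Types s rho : R.

(** The blocks of index less than [j0], too short for the entropy estimates, are
    left unconstrained by taking [C] larger than any of their errors; no block
    meeting the first [n0] positions is filled. *)
Lemma separated_balanced s : s < dimS ->
  exists C, (exists w, balanced v alpha C w) /\
    forall w0 n0, balanced v alpha C w0 -> exists rho1, forall rho, rho1 <= rho ->
    0 <= rho /\ exists (I : finType) (z : I -> nat -> A),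
      [/\ forall x, balanced v alpha C (z x), forall x, agree n0 w0 (z x),
          forall x y, x != y -> ~ same_square (@scale R d a rho) (z x) (z y) &
          expR ((rho + 1) * s) <= #|I|%:R].
Proof.
move=> s_lt; pose e' := (dimS - s) / 2.
have e'0 : 0 < e' by rewrite divr_gt0// subr_gt0.
have [e e0 eP] := exponent_ge a_decr a_ge2 slice_ex e'0.
have [j0 mw] := exists_many_words slice_ex e0.
pose B := \sum_i `|v i| + `|alpha|.
have B0 : 0 <= B by rewrite addr_ge0// sumr_ge0.
pose C := word_error v + j0%:R * B.
have mwC j m : (j0 <= j)%N -> (m <= d)%N -> many_words v alpha C m j e.
  move=> j0j md; have [I [u [u1 u2 u3]]] := mw j j0j m md.
  exists I, u; split=> // x; apply: le_trans (u1 x) _.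
  by rewrite lerDl mulr_ge0.
exists C; split.
  apply: exists_balanced => j; have [j0j|jj0] := leqP j0 j.
    have [I [u [u1 _ u3]]] := mwC j 0%N j0j (leq0n _).
    have : (0 < #|I|)%N by rewrite -(ltr_nat R); exact: lt_le_trans (expR_gt0 _) u3.
    by move=> /card_gt0P[x _]; exists (u x).
  exists (fun=> point : A); apply: le_trans (ler_norm_sum _ _ _) _.
  apply: (@le_trans _ _ (\sum_(i < j) B)).
    apply: ler_sum => i _; apply: le_trans (ler_normB _ _) _.
    by rewrite lerD2r (bigD1 (point : A))//= lerDl sumr_ge0.
  rewrite sumr_const card_ord -[B *+ _]mulr_natl /C.
  rewrite ler_wpDl ?mulr_ge0 ?sumr_ge0//.
  by rewrite ler_wpM2r// ler_nat ltnW.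
move=> w0 n0 bw0; pose j1 := maxn j0 n0.+1.
have j1_gt0 : (0 < j1)%N by rewrite leq_max orbT.
have [rho1 rP] := eP j1 j1_gt0.
exists (Num.max rho1 (s / e')) => rho; rewrite ge_max => /andP[h1 h2].
have [rho0 exp] := rP rho h1; split=> //.
have jd j : used_block a rho j1 j -> [/\ (j0 <= j)%N, (n0 < j)%N,
    (block_start j.+1 <= side a rho d)%N & (0 < j)%N].
  rewrite /used_block geq_max => /andP[/andP[h3 h4] h5]; split=> //.
  exact: leq_ltn_trans h4.
have [||I [z [zb za zs zc]]] := balanced_family (C := C) (e := e)
    (P := used_block a rho j1) (ml := block_level a rho) (n0 := n0) _ _ bw0 (side a rho d).+1.
- by move=> j /jd[j0j _ hd j_gt0]; apply: mwC => //; rewrite block_level_le.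
- move=> [|j] /jd[_ n0j _ _] //.
  by rewrite block_startS -ltnS (leq_trans n0j)// ltnS leq_addl.
exists I, z; split=> //.
- move=> x y xy same; have [j [i [_ /jd[_ _ _ j_gt0] ij /eqP]]] := zs _ _ xy; apply.
  apply/tail_letter_eqP => q; have qd : (q <= d)%N by rewrite -ltnS.
  rewrite block_level_le// /side inord_val => hq.
  by apply: same; apply: leq_trans hq; rewrite block_startS ltn_add2l.
- apply: le_trans zc; rewrite ler_expR; apply: le_trans exp.
  move: h2; rewrite ler_pdivrMr// => h2.
  have -> : dimS - e' = s + e' by rewrite /e'; field.
  by rewrite mulrDl mul1r mulrDr lerD2l.
Qed.

(** Points of distinct approximate squares of side [exp (- rho)] are centres of
    disjoint balls of radius [exp (- (rho + 1)) / 2]. *)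
Lemma packing_premeasure_ge1 (F : set 'rV[R]_d.+1) s :
  (forall rho1, exists2 rho, rho1 <= rho & 0 <= rho /\
    exists (I : finType) (z : I -> Sigma D), [/\ forall x, F (coding D R (z x)),
      forall x y, x != y -> ~ same_square (@scale R d a rho) (z x) (z y) &
      expR ((rho + 1) * s) <= #|I|%:R]) ->
  (1 <= packing_premeasure s F)%E.
Proof.
move=> fam; apply: le_ereal_inf_tmp => _ [delta /= delta0 <-].
have [rho hrho [rho0 [I [z [zF zs zc]]]]] := fam (- ln delta).
have /card_gt0P[x0 _] : (0 < #|I|)%N.
  by rewrite -(ltr_nat R); exact: lt_le_trans (expR_gt0 _) zc.
pose r := expR (- (rho + 1)) / 2; have r0 : 0 < r by rewrite divr_gt0// expR_gt0.
have r2 : 2 * r = expR (- (rho + 1)) by rewrite /r; field.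
have r_lt : 2 * r < expR (- rho) by rewrite r2 ltr_expR ltrN2 ltrDl.
pose c i := coding D R (z (nth x0 (enum I) i)).
apply: (@le_trans _ _ (\esum_(i in `I_#|I|) ((2 * r) `^ s)%:E)%E); last first.
  apply: ereal_sup_ubound; exists `I_#|I|, c, (fun=> r); split=> //; split.
    move=> i _; split; first exact: zF.
    rewrite r0 -[leRHS]lnK ?posrE//; apply: (@le_trans _ _ (2 * r)).
      by rewrite ler_peMl ?ler1n// ltW.
    by apply: le_trans (ltW r_lt) _; rewrite ler_expR lerNl.
  move=> i j /= iI jI [y [/=]]; rewrite /eball/= => yi yj.
  apply/eqP/negPn/negP => ij.
  have ne : nth x0 (enum I) i != nth x0 (enum I) j by rewrite nth_uniq -?cardE ?enum_uniq.
  have [q qP] := coding_far R a_ge2 vssc (scale_mono a_decr a_ge2 rho0) (zs _ _ ne).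
  have := le_trans (scale_side_ge a_ge2 q rho0) qP.
  apply/negP; rewrite -ltNge; apply: le_lt_trans r_lt.
  rewrite -/(c i) -/(c j).
  have -> : c i ord0 q - c j ord0 q = (c i ord0 q - y ord0 q) - (c j ord0 q - y ord0 q) by ring.
  apply: le_trans (ler_normB _ _) _; rewrite mulr_natl mulr2n.
  by apply: lerD; apply: le_trans (coord_le_edist _ _ _) _.
rewrite esum_fset ?finite_II//; last by move=> i _; rewrite lee_fin powR_ge0.
rewrite -fsbig_ord sumEFin lee_fin sumr_const card_ord -[_ *+ _]mulr_natl.
rewrite r2 -expRM mulNr expRN -ler_pdivrMr ?invr_gt0 ?expR_gt0//.
by rewrite invrK mul1r.
Qed.

(** In any countable cover, one member is dense in a cylinder of the balanced set
    and inherits its separated families at all small scales. *)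
Lemma packing_dim_lb (E : set 'rV[R]_d.+1) :
  (forall C w, balanced v alpha C w -> E (coding D R w)) -> (dimS%:E <= packing_dim E)%E.
Proof.
move=> EP; apply: le_ereal_inf_tmp => _ [s [s0 sE] <-].
rewrite lee_fin leNgt; apply/negP => s_lt.
have [C [exw fam]] := separated_balanced s_lt.
suff : (1 <= packing_measure s E)%E by rewrite sE lee_fin ler10.
apply: le_ereal_inf_tmp => _ [F [EF ->]].
have [|i [w0 [n0 [bw0 dense]]]] :=
    baire_balanced (F := fun i => [set w : nat -> A | F i (coding D R w)]) exw.
  by move=> w bw; have [i _ Fi] := EF _ (EP C w bw); exists i.
apply: (@le_trans _ _ (packing_premeasure s (F i))); last first.
  have ge0 n : (0 <= packing_premeasure s (F n))%E by exact: packing_premeasure_ge0.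
  apply: le_trans (nneseries_lim_ge i.+1 (fun n _ _ => ge0 n)).
  by rewrite big_nat_recr//= leeDr// sume_ge0.
apply: packing_premeasure_ge1 => rho1.
have [rho2 rP] := fam w0 n0 bw0.
pose rho := Num.max rho1 rho2.
have [|rho0 [I [z [zb za zs zc]]]] := rP rho; first by rewrite le_max lexx orbT.
exists rho; first by rewrite le_max lexx.
split=> //.
have /choice[z' z'P] x : exists w', agree (scale a rho ord_max) (z x) w' /\ F i (coding D R w').
  by have [w' [_ h1 h2]] := dense (z x) (zb x) (za x) (scale a rho ord_max); exists w'.
exists I, z'; split=> //; first by move=> x; have [] := z'P x.
move=> x y xy same; apply: zs xy _ => q n nL.
have nM : (n < scale a rho ord_max)%N.
  apply: leq_trans nL _; apply: (scale_mono a_decr a_ge2 rho0).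
  by rewrite -ltnS; exact: ltn_ord.
by rewrite (proj1 (z'P x) n nM) (proj1 (z'P y) n nM) (same q n nL).
Qed.

End packing_lower_bound.

Theorem theorem9 (R : realType) (d : nat) (a : 'I_d.+1 -> nat)
    (a_decr : forall q r : 'I_d.+1, (q < r)%N -> (a r < a q)%N)
    (a_ge2 : forall q : 'I_d.+1, (2 <= a q)%N)
    (D : neset (digit a))
    (vssc : very_strong_separation D)
    (p : alphabet D -> R) (p_prob : probability_vector p)
    (nu : probability (Sigma D) R) (nu_bernoulli : bernoulli_seq p nu)
    (k : 'I_d.+1) (p_onedim : one_dimensional p k)
    (alpha : R) (alpha_avg : averages (Ptilde p k) alpha) :
  packing_dim (local_dim_set (sponge D R) (bernoulli_image nu) alpha) =
    (H_ 0 (Ptilde p k) alpha * ((ln (a ord0)%:R)^-1)%:E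
     + \sum_(m < d)
         ((ln (a (lift ord0 m))%:R)^-1
            - (ln (a (widen_ord (leqnSn d) m))%:R)^-1)%:E
         * H_ m.+1 (Ptilde p k) alpha)%E.
Proof.
have nu_bern : bernoulli_law p nu.
  move=> n u; rewrite /pr.
  have -> : [set w : Sigma D | agree n w u] =
      [set w : Sigma D | forall i : 'I_n, w i = tnth [tuple u i | i < n] i].
    apply/seteqP; split=> w h i; first by rewrite tnth_mktuple h.
    by move=> ilt; have := h (Ordinal ilt); rewrite tnth_mktuple.
  by rewrite nu_bernoulli; apply: eq_bigr => i _; rewrite tnth_mktuple.
pose v := letter_value p k.
have fE (w : Sigma D) : Ptilde p k w = v (w 0%N) by exact: PtildeE.
have slice_ex := averages_slice fE alpha_avg.
transitivity (dimension_value v alpha)%:E; last first.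
  rewrite (H_max_entropy fE _ alpha_avg).
  under eq_bigr do rewrite (H_max_entropy fE _ alpha_avg) -EFinM.
  rewrite sumEFin -EFinM -EFinD /dimension_value big_ord_recl; congr (_ + _)%:E.
    rewrite mulrC /inv_log_gap /= subr0 /inv_log /log_base.
    by rewrite (_ : inord 0 = ord0) //; apply: val_inj; rewrite /= inordK.
  apply: eq_bigr => m _; rewrite /inv_log_gap /= /inv_log /log_base; congr (_ * _).
  congr ((ln (a _)%:R)^-1 - (ln (a _)%:R)^-1); apply: val_inj; rewrite /= inordK//.
    exact: (ltn_ord (lift ord0 m)).
  exact: (ltn_ord (widen_ord (leqnSn d) m)).
apply/eqP; rewrite eq_le; apply/andP; split.
  apply: (packing_dim_ub a_decr a_ge2 slice_ex) => x.
  by move=> /(birkhoff_of_local_dim a_decr a_ge2 vssc p_prob nu_bern p_onedim).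
apply: (packing_dim_lb a_decr a_ge2 vssc slice_ex) => C w bw.
apply: (local_dim_of_birkhoff a_decr a_ge2 vssc p_prob nu_bern p_onedim).
exact: birkhoff_balanced bw.
Qed.
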